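(* Let $\mathcal{M}$ be a norm closed subspace of $L^2(\mathbb{T})$ which is invariant for $H^\infty_1(\mathbb{D})$, but is not invariant for $H^\infty(\mathbb{D})$. Then there exist $\alpha,\beta\in\mathbb{C}$ with $|\alpha|^2+|\beta|^2=1$ and $\alpha\ne 0$, and a unimodular function $J$ on $\mathbb{T}$, such that $\mathcal{M}=J H^2_{\alpha,\beta}$. When $\mathcal{M}$ is a subspace of $H^2$, $J$ is an inner function.
   Context: $\mathbb{T}$ is the unit circle with normalized Lebesgue measure. $H^2=H^2(\mathbb{D})$ and $H^\infty=H^\infty(\mathbb{D})$ are the Hardy spaces, identified via boundary values with subspaces of $L^2(\mathbb{T})$ and $L^\infty(\mathbb{T})$. $H^\infty_1(\mathbb{D})=\{f\in H^\infty(\mathbb{D}): f'(0)=0\}$. A subspace $\mathcal{M}\subseteq L^2(\mathbb{T})$ is invariant for an algebra $\mathcal{B}\subseteq L^\infty(\mathbb{T})$ if $f g\in\mathcal{M}$ for all $f\in\mathcal{B}$, $g\in\mathcal{M}$. For $|\alpha|^2+|\beta|^2=1$, $H^2_{\alpha,\beta}=\operatorname{span}\{\alpha+\beta z,\ z^2H^2\}=\mathbb{C}(\alpha+\beta z)+z^2H^2$. A unimodular function is a measurable function $J$ on $\mathbb{T}$ with $|J|=1$ a.e.; an inner function is a unimodular function which belongs to $H^\infty$. *)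

(* Defs.v *)
From HB Require Import structures.
From mathcomp Require Import all_boot all_order all_algebra.
From mathcomp Require Import complex.
From mathcomp Require Import all_classical all_reals all_analysis.
Import Order.TTheory GRing.Theory Num.Theory.
Import numFieldNormedType.Exports.

Set Implicit Arguments.
Unset Strict Implicit.
Unset Printing Implicit Defensive.

Local Open Scope classical_set_scope.
Local Open Scope complex_scope.
Local Open Scope ring_scope.

Definition circle (R : realType) := {z : R[i] | `|z| == 1}.

Section circle_theory.
Variable R : realType.

Fact expi2pi_subproof (t : R) :
  `|cos (2 * pi * t) +i* sin (2 * pi * t)| == 1 :> R[i].
Proof. by rewrite normc_def /= cos2Dsin2 sqrtr1. Qed.

Definition expi2pi (t : R) : circle R :=
  exist (fun z : R[i] => `|z| == 1) _ (expi2pi_subproof t).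

HB.instance Definition _ := Choice.on (circle R).
HB.instance Definition _ := isPointed.Build (circle R) (expi2pi 0).

(* The quotient sigma-algebra under the parametrization of the circle by t;
   it coincides with the Borel sigma-algebra. *)
Definition circle_measurable : set (set (circle R)) :=
  image_set_system setT expi2pi measurable.

Fact circle_sigma_algebra : sigma_algebra setT circle_measurable.
Proof. exact/sigma_algebra_image/sigma_algebra_measurable. Qed.

Fact circle_measurable0 : circle_measurable set0.
Proof. by case: circle_sigma_algebra. Qed.

Fact circle_measurableC A : circle_measurable A -> circle_measurable (~` A).
Proof. by case: circle_sigma_algebra => _ mC _ /mC; rewrite setTD. Qed.

Fact circle_measurable_bigcup (F : (set (circle R))^nat) :
  (forall i, circle_measurable (F i)) -> circle_measurable (\bigcup_i F i).
Proof. by case: circle_sigma_algebra => _ _; exact. Qed.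

HB.instance Definition _ := isMeasurable.Build default_measure_display
  (circle R) circle_measurable0 circle_measurableC circle_measurable_bigcup.

Lemma measurable_expi2pi : measurable_fun setT expi2pi.
Proof. by move=> _ A mA; exact: mA. Qed.

(* Normalized Lebesgue measure: the law of e^{2 i pi t}, t uniform in [0, 1[. *)
Definition arc_measure : set (circle R) -> \bar R :=
  pushforward (mrestr lebesgue_measure (measurable_itv `[0%R, 1%R[)) expi2pi.

Fact arc_measure0 : arc_measure set0 = 0%E.
Proof. by rewrite /arc_measure /pushforward preimage_set0 measure0. Qed.

Fact arc_measure_ge0 A : (0 <= arc_measure A)%E.
Proof. exact: measure_ge0. Qed.

Fact arc_measure_sigma_additive : semi_sigma_additive arc_measure.
Proof.
exact: (@measure_semi_sigma_additive _ _ _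
  (pushforward (mrestr lebesgue_measure _) expi2pi)).
Qed.

HB.instance Definition _ := isMeasure.Build _ _ _ arc_measure
  arc_measure0 arc_measure_ge0 arc_measure_sigma_additive.

Fact arc_measure_setT : arc_measure setT = 1%E.
Proof.
by rewrite /arc_measure /pushforward /mrestr preimage_setT setTI
  lebesgue_measure_itv/= lte_fin ltr01 oppr0 adde0.
Qed.

HB.instance Definition _ :=
  Measure_isProbability.Build _ _ _ arc_measure arc_measure_setT.

End circle_theory.

(* Elements of L^p are represented by functions, and classes modulo almost
   everywhere equality by the sets of all their representatives. *)
Section lebesgue_spaces.
Variable R : realType.
Implicit Types (f g : circle R -> R[i]) (M A : set (circle R -> R[i])).

Definition ae_eq_circle f g : Prop :=
  {ae @arc_measure R, forall z, f z = g z}.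

Definition complex_measurable f : Prop :=
  measurable_fun setT (fun z => complex.Re (f z)) /\
  measurable_fun setT (fun z => complex.Im (f z)).

Definition LnormC (p : \bar R) f : \bar R :=
  Lnorm (@arc_measure R) p (fun z => (Normc.normc (f z))%:E).

Definition LspaceC (p : \bar R) : set (circle R -> R[i]) :=
  [set f | complex_measurable f /\ (LnormC p f < +oo)%E].

Definition L2 := LspaceC 2%:E.
Definition Linfty := LspaceC +oo%E.

Definition L2_subspace M : Prop :=
  [/\ M `<=` L2,
      M (fun _ => 0) &
      forall (a b : R[i]) f g, M f -> M g -> M (fun z => a * f z + b * g z)].

(* Norm closed, as LnormC 2%:E (f - g) is the L^2 distance; taking e -> 0 with
   g fixed, such an M contains every L^2 function a.e. equal to one of its
   elements. *)
Definition L2_closed M : Prop :=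
  forall f, L2 f ->
    (forall e : R, 0 < e ->
       exists2 g, M g & (LnormC 2%:E (fun z => f z - g z)%R < e%:E)%E) ->
    M f.

Definition invariant_for (B M : set (circle R -> R[i])) : Prop :=
  forall f g, B f -> M g -> M (fun z => f z * g z).

Definition L2_mul (J : circle R -> R[i]) A : set (circle R -> R[i]) :=
  [set f | L2 f /\ exists2 h, A h & ae_eq_circle f (fun z => J z * h z)].

Definition unimodular (J : circle R -> R[i]) : Prop :=
  complex_measurable J /\ {ae @arc_measure R, forall z, `|J z| = 1}.

End lebesgue_spaces.

Section hardy_spaces.
Variable R : realType.
Implicit Types (F : R[i]^o -> R[i]^o) (f : circle R -> R[i]).

Definition holomorphic_on_disc F : Prop :=
  forall z : R[i], `|z| < 1 -> derivable F z 1.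

Definition hardy2_disc F : Prop :=
  holomorphic_on_disc F /\
  exists C : R, forall r : R, 0 <= r < 1 ->
    (LnormC 2%:E (fun z : circle R => F (r%:C * val z)%R) <= C%:E)%E.

Definition hardyoo_disc F : Prop :=
  holomorphic_on_disc F /\
  exists C : R, forall z : R[i], `|z| < 1 -> `|F z| <= C%:C.

Definition hardyoo1_disc F : Prop := hardyoo_disc F /\ derive1 F 0 = 0.

(* Functions on the disc are identified with their radial limits; the values of
   F outside the open disc are irrelevant. *)
Definition boundary_value F f : Prop :=
  {ae @arc_measure R, forall z : circle R,
     F (r%:C * val z) @[r --> (1 : R)^'-] --> (f z : R[i]^o)}.

Definition H2 : set (circle R -> R[i]) :=
  [set f | L2 f /\ exists2 F, hardy2_disc F & boundary_value F f].

Definition Hinfty : set (circle R -> R[i]) :=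
  [set f | Linfty f /\ exists2 F, hardyoo_disc F & boundary_value F f].

Definition Hinfty1 : set (circle R -> R[i]) :=
  [set f | Linfty f /\ exists2 F, hardyoo1_disc F & boundary_value F f].

Definition H2_ab (alpha beta : R[i]) : set (circle R -> R[i]) :=
  [set h | L2 h /\ exists c : R[i], exists2 g, H2 g &
     ae_eq_circle h
       (fun z => c * (alpha + beta * val z) + val z ^+ 2 * g z)].

Definition inner (J : circle R -> R[i]) : Prop := unimodular J /\ Hinfty J.

End hardy_spaces.

(* Main.v *)
Require Import Defs.
From mathcomp Require Import all_boot all_order all_algebra.
From mathcomp Require Import complex.
From mathcomp Require Import all_classical all_reals all_analysis.
From mathcomp Require Import measurable_realfun ess_sup_inf.
From mathcomp Require Import ring lra.
Import Order.TTheory GRing.Theory Num.Theory.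
Import numFieldNormedType.Exports.

(* Let N be the closure of M + zM.  Then z^2 N is contained in M, and N is shift-invariant but zN <> N
   (otherwise M = N would be shift-invariant, hence invariant for H^oo).  A unit vector J of N
   orthogonal to zN satisfies <z^n J, J> = 0 for n > 0, so |J| = 1 almost everywhere by uniqueness of
   Fourier coefficients, and N = J H^2.  Since J z^2 H^2 is contained in M, membership of J h in M only
   depends on the first two coefficients of h, and these fill a line C (alpha, beta) with alpha <> 0:
   otherwise M would be shift-invariant.  If M is contained in H^2, then J z^2 and J (alpha + beta z)
   have no Fourier coefficients of negative index, so neither has J.

   Passing between H^2 on the disc and vanishing negative Fourier coefficients uses Goursat's theorem
   (in polar rectangles) in one direction, and in the other Fatou's theorem, which is reduced to the
   Lebesgue differentiation theorem by a dyadic majorisation of the Poisson kernel.  Fatou's theorem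
   also gives the uniqueness of Fourier coefficients of integrable functions. *)

(** The invariance hypothesis is used only through the monomials z^n with n >= 2. Multiplying m1 + z
    m2 by z gives z m1 + z^2 m2, and by z^2 gives z^2 m1 + z^3 m2; this is why M + zM is the right
    enlargement. The negative hypothesis is used in the form that M is not stable under z, so one
    has to know that a closed subspace stable under z is stable under all of H^oo. Polynomials are
    not norm dense there; bounded pointwise approximation by dilates replaces density. Uniqueness of
    Fourier coefficients is needed for integrable functions, not merely in L^2, because |J|^2 is
    only known to be integrable before it is known to be 1. The coefficient pairs lie on a line by a
    dichotomy: otherwise some element of M has the pair (0, 1), and since every z m with m in M has
    a pair (0, c), it would lie in M too. Subspaces consist of functions rather than classes:
    closedness absorbs equality almost everywhere, and J is made unimodular at every point so that
    division by J is exact. *)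

Set Implicit Arguments.
Unset Strict Implicit.
Unset Printing Implicit Defensive.
Local Open Scope classical_set_scope.
Local Open Scope complex_scope.
Local Open Scope ring_scope.

(* The real-valued modulus: [`|z|] has type [R[i]]. *)
Local Notation nc := Normc.normc.

(** * Complex modulus and complex-valued integrals *)

(* A constant hides the large predicate of the subtype from unification. *)
Definition coord (R : realType) (z : circle R) : R[i] := \val z.

Lemma coord_inj (R : realType) : injective (@coord R).
Proof. exact: val_inj. Qed.

Section cnorm.
Variable R : realType.
Implicit Types z w : R[i].
Lemma normrE z : `|z| = (nc z)%:C. Proof. by []. Qed.
Lemma nc_ge0 z : 0 <= nc z. Proof. by case: z => a b; rewrite sqrtr_ge0. Qed.
Lemma nc_sq z : nc z ^+ 2 = complex.Re z ^+ 2 + complex.Im z ^+ 2.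
Proof. by case: z => a b /=; rewrite sqr_sqrtr// addr_ge0// sqr_ge0. Qed.
Lemma ncM z w : nc (z * w) = nc z * nc w. Proof. exact: Normc.normcM. Qed.
Lemma nc0 : nc (0 : R[i]) = 0. Proof. exact: Normc.normc0. Qed.
Lemma nc1 : nc (1 : R[i]) = 1. Proof. exact: Normc.normc1. Qed.
Lemma ncN z : nc (- z) = nc z. Proof. exact: normcN. Qed.
Lemma ncV z : nc (z^-1) = (nc z)^-1. Proof. exact: Normc.normcV. Qed.
Lemma ncD z w : nc (z + w) <= nc z + nc w. Proof. exact: le_normcD. Qed.
Lemma ncB z w : nc (z - w) <= nc z + nc w. Proof. by rewrite -(ncN w) ncD. Qed.
Lemma ncBC z w : nc (z - w) = nc (w - z). Proof. by rewrite -ncN opprB. Qed.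
Lemma ncX z n : nc (z ^+ n) = nc z ^+ n.
Proof. by elim: n => [|n ih]; rewrite ?expr0 ?nc1// !exprS ncM ih. Qed.
Lemma nc_eq0 z : (nc z == 0) = (z == 0).
Proof. by apply/eqP/eqP => [/Normc.eq0_normc//|->]; rewrite nc0. Qed.
Lemma nc_real (r : R) : nc r%:C = `|r|.
Proof. by rewrite /= expr0n/= addr0 sqrtr_sqr. Qed.
Lemma ncJ z : nc z^* = nc z. Proof. by case: z => a b /=; rewrite sqrrN. Qed.
Lemma Re_le z : `|complex.Re z| <= nc z.
Proof. by have := normc_ge_Re z; rewrite normrE lecR. Qed.
Lemma Im_le z : `|complex.Im z| <= nc z.
Proof.
rewrite -(@ler_pXn2r _ 2)// ?nnegrE ?nc_ge0// nc_sq real_normK ?num_real//.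
by rewrite lerDr sqr_ge0.
Qed.
Lemma nc_le z : nc z <= `|complex.Re z| + `|complex.Im z|.
Proof.
rewrite -(@ler_pXn2r _ 2)// ?nnegrE ?nc_ge0 ?addr_ge0// nc_sq sqrrD.
by rewrite !real_normK ?num_real// -addrA lerD2l lerDr mulrn_wge0 ?mulr_ge0.
Qed.
Lemma mulcJ z : z * z^* = (nc z ^+ 2)%:C.
Proof.
by rewrite nc_sq; case: z => a b /=; apply/eqP; rewrite eq_complex /=; apply/andP; split; apply/eqP; ring.
Qed.
Lemma ReD z w : complex.Re (z + w) = complex.Re z + complex.Re w. Proof. by case: z w => [??][??]. Qed.
Lemma ImD z w : complex.Im (z + w) = complex.Im z + complex.Im w. Proof. by case: z w => [??][??]. Qed.
Lemma ReN z : complex.Re (- z) = - complex.Re z. Proof. by case: z. Qed.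
Lemma ImN z : complex.Im (- z) = - complex.Im z. Proof. by case: z. Qed.
Lemma ReM z w : complex.Re (z * w) = complex.Re z * complex.Re w - complex.Im z * complex.Im w.
Proof. by case: z w => [??][??]. Qed.
Lemma ImM z w : complex.Im (z * w) = complex.Re z * complex.Im w + complex.Im z * complex.Re w.
Proof. by case: z w => [??][??] /=; simpc. Qed.
Lemma conjR (r : R) : (r%:C)^* = r%:C. Proof. by congr (_ +i* _); exact: oppr0. Qed.
Lemma rCM (a b : R) : (a * b)%:C = a%:C * b%:C. Proof. exact: rmorphM. Qed.
Lemma rCB (a b : R) : (a - b)%:C = a%:C - b%:C. Proof. exact: rmorphB. Qed.
Lemma rCV (a : R) : (a^-1)%:C = (a%:C)^-1. Proof. exact: fmorphV. Qed.
Lemma rC1 : (1 : R)%:C = 1. Proof. by []. Qed.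
Lemma conjM z w : (z * w)^* = z^* * w^*. Proof. exact: rmorphM. Qed.
Lemma conjB z w : (z - w)^* = z^* - w^*. Proof. exact: rmorphB. Qed.
Lemma conjX z n : (z ^+ n)^* = z^* ^+ n. Proof. exact: rmorphXn. Qed.
Lemma conj1 : (1 : R[i])^* = 1. Proof. exact: rmorph1. Qed.
Lemma conj0 : (0 : R[i])^* = 0. Proof. exact: rmorph0. Qed.
Lemma conjK z : z^*^* = z. Proof. exact: conjcK. Qed.
Lemma conj_eq0 z : (z^* == 0) = (z == 0). Proof. exact: conjc_eq0. Qed.
Lemma nc_circle (z : circle R) : nc (coord z) = 1.
Proof. by rewrite /coord; case: z => z /= /eqP; rewrite normrE => -[]. Qed.
End cnorm.

Section cint.
Context d (T : measurableType d) (R : realType) (mu : {measure set T -> \bar R}).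
Implicit Types (D : set T) (f g : T -> R[i]).

Definition cmeas D f := measurable_fun D (fun x => complex.Re (f x)) /\
  measurable_fun D (fun x => complex.Im (f x)).
Definition cintegrable D f :=
  mu.-integrable D (EFin \o (fun x => complex.Re (f x))) /\
  mu.-integrable D (EFin \o (fun x => complex.Im (f x))).
Definition cint D f : R[i] :=
  (\int[mu]_(x in D) complex.Re (f x)) +i* (\int[mu]_(x in D) complex.Im (f x)).

Lemma cmeasD D f g : cmeas D f -> cmeas D g -> cmeas D (fun x => f x + g x).
Proof.
move=> [f1 f2] [g1 g2]; split.
  by under eq_fun do rewrite ReD; exact: measurable_funD.
by under eq_fun do rewrite ImD; exact: measurable_funD.
Qed.
Lemma cmeasN D f : cmeas D f -> cmeas D (fun x => - f x).
Proof.
move=> [f1 f2]; split.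
  by under eq_fun do rewrite ReN; exact: measurableT_comp.
by under eq_fun do rewrite ImN; exact: measurableT_comp.
Qed.
Lemma cmeasB D f g : cmeas D f -> cmeas D g -> cmeas D (fun x => f x - g x).
Proof. by move=> mf mg; exact: cmeasD mf (cmeasN mg). Qed.
Lemma cmeasM D f g : cmeas D f -> cmeas D g -> cmeas D (fun x => f x * g x).
Proof.
move=> [f1 f2] [g1 g2]; split.
  under eq_fun do rewrite ReM.
  by apply: measurable_funB; exact: measurable_funM.
under eq_fun do rewrite ImM.
by apply: measurable_funD; exact: measurable_funM.
Qed.
Lemma cmeas_cst D (c : R[i]) : cmeas D (fun=> c).
Proof. by split; exact: measurable_cst. Qed.
Lemma cmeasX D f n : cmeas D f -> cmeas D (fun x => f x ^+ n).
Proof.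
move=> mf; elim: n => [|n ih]; first exact: cmeas_cst.
by under eq_fun do rewrite exprS; exact: cmeasM.
Qed.
Lemma cmeasJ D f : cmeas D f -> cmeas D (fun x => (f x)^*).
Proof.
move=> [f1 f2]; split.
  by rewrite (_ : (fun _ => _) = (fun x => complex.Re (f x)))//; apply/funext => x; case: (f x).
rewrite (_ : (fun _ => _) = (fun x => - complex.Im (f x))); first exact: measurableT_comp.
by apply/funext => x; case: (f x).
Qed.
Lemma measurable_nc D f : measurable D -> cmeas D f -> measurable_fun D (fun x => nc (f x)).
Proof.
move=> mD [f1 f2].
rewrite (_ : (fun _ => _) = (fun x => Num.sqrt (complex.Re (f x) ^+ 2 + complex.Im (f x) ^+ 2))); last first.
  by apply/funext => x; case: (f x).
apply: (@measurableT_comp _ _ _ _ _ _ (@Num.sqrt R)).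
  exact: continuous_measurable_fun (@sqrt_continuous R).
by apply: measurable_funD; apply: measurable_funX.
Qed.

Lemma cintegrable_meas D f : cintegrable D f -> cmeas D f.
Proof. by move=> [/measurable_int/measurable_EFinP ? /measurable_int/measurable_EFinP ?]. Qed.

Lemma cintegrable_le D f (g : T -> R) : measurable D -> cmeas D f ->
  mu.-integrable D (EFin \o g) -> (forall x, D x -> nc (f x) <= g x) ->
  cintegrable D f.
Proof.
move=> mD [f1 f2] ig fg; split; apply: (le_integrable mD _ _ ig).
- exact/measurable_EFinP.
- by move=> x Dx /=; rewrite lee_fin (le_trans (Re_le _))// (le_trans (fg _ Dx))// ler_norm.
- exact/measurable_EFinP.
- by move=> x Dx /=; rewrite lee_fin (le_trans (Im_le _))// (le_trans (fg _ Dx))// ler_norm.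
Qed.

Lemma integrable_nc D f : measurable D -> cintegrable D f ->
  mu.-integrable D (EFin \o (fun x => nc (f x))).
Proof.
move=> mD cf; have [f1 f2] := cf.
apply: (le_integrable mD _ _ (integrableD mD (integrable_norm f1) (integrable_norm f2))).
  by apply/measurable_EFinP/measurable_nc => //; exact: cintegrable_meas.
move=> x Dx /=; rewrite lee_fin ger0_norm ?nc_ge0// (le_trans (nc_le _))//.
by rewrite ler_norm.
Qed.

Lemma cintegrableD D f g : measurable D -> cintegrable D f -> cintegrable D g ->
  cintegrable D (fun x => f x + g x).
Proof.
move=> mD [f1 f2] [g1 g2]; split.
  rewrite (_ : _ \o _ = (EFin \o (fun x => complex.Re (f x))) \+ (EFin \o (fun x => complex.Re (g x)))); first exact: integrableD.
  by apply/funext => x /=; rewrite ReD.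
rewrite (_ : _ \o _ = (EFin \o (fun x => complex.Im (f x))) \+ (EFin \o (fun x => complex.Im (g x)))); first exact: integrableD.
by apply/funext => x /=; rewrite ImD.
Qed.

Lemma cintegrableZ D f (c : R[i]) : measurable D -> cintegrable D f -> cintegrable D (fun x => c * f x).
Proof.
move=> mD cf; apply: (@cintegrable_le _ _ (fun x => nc c * nc (f x))) => //.
- by apply: cmeasM; [exact: cmeas_cst|exact: cintegrable_meas].
- rewrite (_ : _ \o _ = (fun x => (nc c)%:E * (EFin \o (fun x => nc (f x))) x)%E); last by apply/funext.
  by apply: integrableZl => //; exact: integrable_nc.
- by move=> x _; rewrite ncM.
Qed.

Lemma cintD D f g : measurable D -> cintegrable D f -> cintegrable D g ->
  cint D (fun x => f x + g x) = cint D f + cint D g.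
Proof.
move=> mD [f1 f2] [g1 g2]; rewrite /cint; simpc; congr (_ +i* _).
  by rewrite -RintegralD//; apply: eq_Rintegral => x _; rewrite ReD.
by rewrite -RintegralD//; apply: eq_Rintegral => x _; rewrite ImD.
Qed.

Lemma cintZ D f (c : R[i]) : measurable D -> cintegrable D f ->
  cint D (fun x => c * f x) = c * cint D f.
Proof.
have iZ (r : R) h : measurable D -> mu.-integrable D (EFin \o h) -> mu.-integrable D (EFin \o (fun x => r * h x)).
  move=> mD ih; rewrite (_ : _ \o _ = (fun x => r%:E * (EFin \o h) x)%E); last by apply/funext.
  exact: integrableZl.
case: c => a b mD [f1 f2]; rewrite /cint; simpc; congr (_ +i* _).
  by rewrite -!RintegralZl// -RintegralB//; [|exact: iZ..]; apply: eq_Rintegral => x _; rewrite ReM.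
by rewrite -!RintegralZl// -RintegralD//; [|exact: iZ..]; apply: eq_Rintegral => x _; rewrite ImM.
Qed.

Lemma eq_cint D f g : (forall x, D x -> f x = g x) -> cint D f = cint D g.
Proof. by move=> fg; rewrite /cint; congr (_ +i* _); apply: eq_Rintegral => x; rewrite inE => /fg ->. Qed.

Lemma eq_cintegrable D f g : measurable D -> (forall x, D x -> f x = g x) ->
  cintegrable D f -> cintegrable D g.
Proof.
by move=> mD fg [f1 f2]; split; [apply: eq_integrable f1 => // x|apply: eq_integrable f2 => // x];
  rewrite inE /= => /fg ->.
Qed.

Lemma cintegrableN D f : measurable D -> cintegrable D f -> cintegrable D (fun x => - f x).
Proof.
by move=> mD /(cintegrableZ (-1) mD); apply: eq_cintegrable => // x _; rewrite mulN1r.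
Qed.

Lemma cintN D f : measurable D -> cintegrable D f -> cint D (fun x => - f x) = - cint D f.
Proof.
by move=> mD cf; rewrite -mulN1r -cintZ//; apply: eq_cint => x _; rewrite mulN1r.
Qed.

Lemma cintegrableB D f g : measurable D -> cintegrable D f -> cintegrable D g ->
  cintegrable D (fun x => f x - g x).
Proof. by move=> mD cf cg; apply: cintegrableD => //; exact: cintegrableN. Qed.

Lemma cintB D f g : measurable D -> cintegrable D f -> cintegrable D g ->
  cint D (fun x => f x - g x) = cint D f - cint D g.
Proof. by move=> mD cf cg; rewrite cintD ?cintN//; exact: cintegrableN. Qed.

Lemma cint0 D : cint D (fun=> 0) = 0.
Proof. by rewrite /cint /Rintegral/= integral0. Qed.

Lemma cintegrable0 D : measurable D -> cintegrable D (fun=> 0).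
Proof. by move=> mD; split; exact: integrable0. Qed.

Lemma cint_sum D (I : Type) (s : seq I) (f : I -> T -> R[i]) : measurable D ->
  (forall i, cintegrable D (f i)) ->
  cintegrable D (fun x => \sum_(i <- s) f i x) /\
  cint D (fun x => \sum_(i <- s) f i x) = \sum_(i <- s) cint D (f i).
Proof.
move=> mD cf; elim: s => [|i s [ih1 ih2]].
  have e : (fun x => \sum_(i <- [::]) f i x) = fun=> 0 by apply/funext => x; rewrite big_nil.
  by rewrite e big_nil; split; [exact: cintegrable0|exact: cint0].
have e : (fun x => \sum_(j <- i :: s) f j x) = fun x => f i x + \sum_(j <- s) f j x.
  by apply/funext => x; rewrite big_cons.
by rewrite e big_cons; split; [exact: cintegrableD|rewrite cintD// ih2].
Qed.

Lemma cintJ D f : measurable D -> cintegrable D f ->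
  cint D (fun x => (f x)^*) = (cint D f)^*.
Proof.
move=> mD [f1 f2]; rewrite /cint; congr (_ +i* _).
  by apply: eq_Rintegral => x _; case: (f x).
rewrite -[RHS]mulN1r -RintegralZl//; apply: eq_Rintegral => x _; rewrite mulN1r.
by case: (f x).
Qed.

(* Rotating the integral onto the positive axis reduces this to the real case. *)
Lemma nc_cint_le D f : measurable D -> cintegrable D f ->
  nc (cint D f) <= \int[mu]_(x in D) nc (f x).
Proof.
move=> mD cf; set I := cint D f.
have [->|I0] := eqVneq I 0.
  by rewrite nc0; apply: Rintegral_ge0 => x _; exact: nc_ge0.
have nI0 : 0 < nc I by rewrite lt_neqAle nc_ge0 eq_sym nc_eq0 I0.
have : nc I * nc I <= nc I * \int[mu]_(x in D) nc (f x).
  have -> : nc I * nc I = complex.Re (cint D (fun x => I^* * f x)).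
    by rewrite cintZ// [I^* * _]mulrC mulcJ -expr2.
  rewrite -RintegralZl//; last exact: integrable_nc.
  apply: le_Rintegral => //.
  - by have [] := @cintegrableZ D f I^* mD cf.
  - rewrite (_ : _ \o _ = (fun x => (nc I)%:E * (EFin \o (fun x => nc (f x))) x)%E); last by apply/funext.
    by apply: integrableZl => //; exact: integrable_nc.
  - by move=> x Dx; rewrite (le_trans (ler_norm _))// (le_trans (Re_le _))// ncM ncJ.
by rewrite ler_pM2l.
Qed.

End cint.

(** * The Hilbert space L^2 *)

Section dct.
Context d (T : measurableType d) (R : realType) (mu : {measure set T -> \bar R}).
Implicit Types (D : set T).

Lemma Rintegral_cvg0 D (h : nat -> T -> R) (g : T -> R) : measurable D ->
  (forall n, measurable_fun D (h n)) ->
  {ae mu, forall x, D x -> h n x @[n --> \oo] --> 0} ->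
  mu.-integrable D (EFin \o g) ->
  {ae mu, forall x n, D x -> `|h n x| <= g x} ->
  \int[mu]_(x in D) h n x @[n --> \oo] --> 0.
Proof.
move=> mD mh h0 ig hg.
have [||//||_ _] := @dominated_convergence _ _ _ mu D mD (fun n => EFin \o h n) (cst 0%E) (EFin \o g) _ _ _ ig.
- by move=> n; exact/measurable_EFinP.
- exact: measurable_cst.
- by apply: filterS h0 => x hx Dx; apply/fine_cvgP; split; [exact: nearW|exact: hx].
- by apply: filterS hg => x hx n Dx /=; rewrite lee_fin hx.
by rewrite integral0 => /fine_cvgP[_].
Qed.

Lemma cint_cvg D (f_ : nat -> T -> R[i]) f (g : T -> R) : measurable D ->
  (forall n, cintegrable mu D (f_ n)) -> cintegrable mu D f ->
  {ae mu, forall x, D x -> nc (f_ n x - f x) @[n --> \oo] --> 0} ->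
  mu.-integrable D (EFin \o g) ->
  {ae mu, forall x n, D x -> nc (f_ n x - f x) <= g x} ->
  nc (cint mu D (f_ n) - cint mu D f) @[n --> \oo] --> 0.
Proof.
move=> mD if_ ife h0 ig hg.
have c0 : \int[mu]_(x in D) nc (f_ n x - f x) @[n --> \oo] --> 0.
  apply: (Rintegral_cvg0 mD _ h0 ig) => [n|].
    by apply: measurable_nc => //; apply: cmeasB; [exact: (cintegrable_meas (if_ n))|exact: (cintegrable_meas ife)].
  by apply: filterS hg => x hx n Dx; rewrite ger0_norm ?nc_ge0// hx.
apply: (squeeze_cvgr _ (cvg_cst 0) c0); near=> n.
by have := nc_cint_le mD (cintegrableB mD (if_ n) ife); rewrite cintB// nc_ge0.
Unshelve. all: by end_near. Qed.

Lemma ae_eq_cint D f g : measurable D -> cmeas D f -> cmeas D g ->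
  {ae mu, forall x, D x -> f x = g x} -> cint mu D f = cint mu D g.
Proof.
move=> mD [f1 f2] [g1 g2] fg; rewrite /cint /Rintegral; f_equal; f_equal.
  apply: ae_eq_integral => //; last by apply: filterS fg => x fgx Dx; rewrite fgx.
    exact/measurable_EFinP.
  exact/measurable_EFinP.
apply: ae_eq_integral => //; last by apply: filterS fg => x fgx Dx; rewrite fgx.
  exact/measurable_EFinP.
exact/measurable_EFinP.
Qed.

Lemma ae_eq_integrable D (f g : T -> \bar R) : measurable D ->
  mu.-integrable D f -> measurable_fun D g ->
  {ae mu, forall x, D x -> f x = g x} -> mu.-integrable D g.
Proof.
move=> mD /integrableP[mf fi] mg fg; apply/integrableP; split => //.
rewrite (@ae_eq_integral _ _ _ mu D (fun x => `|f x|)%E)//; [exact: measurableT_comp|exact: measurableT_comp|].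
by apply: filterS fg => x fgx Dx; rewrite fgx.
Qed.

Lemma ae_eq_cintegrable D f g : measurable D -> cintegrable mu D f -> cmeas D g ->
  {ae mu, forall x, D x -> f x = g x} -> cintegrable mu D g.
Proof.
move=> mD cf [g1 g2] fg; split.
  apply: (ae_eq_integrable mD cf.1); first exact/measurable_EFinP.
  by apply: filterS fg => x fgx Dx /=; rewrite fgx.
apply: (ae_eq_integrable mD cf.2); first exact/measurable_EFinP.
by apply: filterS fg => x fgx Dx /=; rewrite fgx.
Qed.

End dct.

(** * Norm and inner product of L^2 of the circle *)

Section L2theory.
Variable R : realType.
Local Notation mu := (@arc_measure R).
Local Notation T := (circle R).
Implicit Types (f g h : T -> R[i]).

(** The squared norm is used throughout, so that estimates stay polynomial; [L2_LnormC] converts to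
    the norm itself. *)
Definition N2 f : R := \int[mu]_z (nc (f z) ^+ 2).
Definition dot f g : R[i] := cint mu setT (fun z => f z * (g z)^*).

Let mT : measurable (setT : set T). Proof. exact: measurableT. Qed.

Lemma LnormC2E f : LnormC 2%:E f = ((\int[mu]_z (nc (f z) ^+ 2)%:E) `^ 2^-1)%E.
Proof.
rewrite /LnormC unlock; congr (_ `^ _)%E; apply: eq_integral => z _.
by rewrite /= powR_mulrn ?normr_ge0// ger0_norm// nc_ge0.
Qed.

Lemma L2E f : L2 f <-> cmeas setT f /\ mu.-integrable setT (EFin \o (fun z => nc (f z) ^+ 2)).
Proof.
rewrite /L2 /LspaceC /= LnormC2E; split=> -[mf lf]; split=> //.
  apply/integrableP; split.
    by apply/measurable_EFinP/measurable_funX/measurable_nc.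
  apply: (@lty_poweRy _ _ 2^-1); first by rewrite invr_eq0.
  by under eq_integral do rewrite /= ger0_norm ?sqr_ge0//.
apply: poweR_lty; have /integrableP[_] := lf.
by under eq_integral do rewrite /= ger0_norm ?sqr_ge0//.
Qed.

Lemma N2_ge0 f : 0 <= N2 f.
Proof. by apply: Rintegral_ge0 => z _; rewrite sqr_ge0. Qed.

Lemma L2_int f : L2 f -> (\int[mu]_z (nc (f z) ^+ 2)%:E)%E = (N2 f)%:E.
Proof.
by move=> /L2E[_ h]; rewrite /N2 /Rintegral fineK//; exact: integrable_fin_num.
Qed.

Lemma L2_LnormC f : L2 f -> LnormC 2%:E f = (Num.sqrt (N2 f))%:E.
Proof. by move=> Lf; rewrite LnormC2E L2_int// poweR_EFin powR12_sqrt// N2_ge0. Qed.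

Lemma L2_cmeas f : L2 f -> cmeas setT f. Proof. by case. Qed.
Hint Resolve L2_cmeas : core.

Lemma L2_dom f (g : T -> R) : cmeas setT f -> mu.-integrable setT (EFin \o g) ->
  (forall x, nc (f x) ^+ 2 <= g x) -> L2 f.
Proof.
move=> mf ig fg; apply/L2E; split => //; apply: le_integrable ig => //.
  by apply/measurable_EFinP/measurable_funX/measurable_nc.
by move=> x _ /=; rewrite lee_fin ger0_norm ?sqr_ge0// (le_trans (fg x))// ler_norm.
Qed.

Lemma arc_integrable_cst (r : R) : mu.-integrable setT (EFin \o (fun=> r)).
Proof. by apply: finite_measure_integrable_cst. Qed.

Lemma L2_integrable_sqr f : L2 f -> mu.-integrable setT (EFin \o (fun z => nc (f z) ^+ 2)).
Proof. by move=> /L2E[]. Qed.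

Lemma arc_integrableD (f g : T -> R) : mu.-integrable setT (EFin \o f) -> mu.-integrable setT (EFin \o g) ->
  mu.-integrable setT (EFin \o (fun z => f z + g z)).
Proof. by move=> i1 i2; exact: (integrableD mT i1 i2). Qed.
Lemma arc_integrableZ (r : R) (f : T -> R) : mu.-integrable setT (EFin \o f) ->
  mu.-integrable setT (EFin \o (fun z => r * f z)).
Proof. by move=> i1; exact: (integrableZl mT r i1). Qed.

Lemma L2_mul_bounded f (b : T -> R[i]) (C : R) : L2 f -> cmeas setT b -> (forall z, nc (b z) <= C) ->
  L2 (fun z => b z * f z).
Proof.
move=> Lf mb bC; apply: (@L2_dom _ (fun z => C ^+ 2 * nc (f z) ^+ 2)).
- by apply: cmeasM => //; exact: L2_cmeas.
- exact/arc_integrableZ/L2_integrable_sqr.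
- move=> x; rewrite ncM exprMn ler_wpM2r ?sqr_ge0// lerXn2r ?nnegrE ?nc_ge0//.
  by rewrite (le_trans _ (bC x))// nc_ge0.
Qed.

Lemma L2Z f (c : R[i]) : L2 f -> L2 (fun z => c * f z).
Proof. by move=> Lf; apply: (@L2_mul_bounded f _ (nc c)) => //; exact: cmeas_cst. Qed.

Lemma L2D f g : L2 f -> L2 g -> L2 (fun z => f z + g z).
Proof.
move=> Lf Lg; apply: (@L2_dom _ (fun z => 2 * nc (f z) ^+ 2 + 2 * nc (g z) ^+ 2)).
- by apply: cmeasD; exact: L2_cmeas.
- by apply: arc_integrableD; exact/arc_integrableZ/L2_integrable_sqr.
- move=> x; apply: (@le_trans _ _ ((nc (f x) + nc (g x)) ^+ 2)).
    by rewrite lerXn2r ?nnegrE ?addr_ge0 ?nc_ge0// ncD.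
  by have := sqr_ge0 (nc (f x) - nc (g x)); nra.
Qed.

Lemma L2N f : L2 f -> L2 (fun z => - f z).
Proof. by move=> Lf; under eq_fun do rewrite -mulN1r; exact: L2Z. Qed.
Lemma L2B f g : L2 f -> L2 g -> L2 (fun z => f z - g z).
Proof. by move=> Lf Lg; apply: L2D => //; exact: L2N. Qed.
Lemma L2_bounded f (C : R) : cmeas setT f -> (forall z, nc (f z) <= C) -> L2 f.
Proof.
move=> mf fC; apply: (@L2_dom _ (fun=> C ^+ 2)) => //; first exact: arc_integrable_cst.
move=> x; rewrite lerXn2r ?nnegrE ?nc_ge0//.
by rewrite (le_trans _ (fC x))// nc_ge0.
Qed.
Lemma L2_cst (c : R[i]) : L2 (fun=> c : R[i]).
Proof. by apply: (@L2_bounded _ (nc c)) => //; exact: cmeas_cst. Qed.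

Lemma L2_cintegrableM f g : L2 f -> L2 g -> cintegrable mu setT (fun z => f z * g z).
Proof.
move=> Lf Lg; apply: (@cintegrable_le _ _ _ _ _ _ (fun z => nc (f z) ^+ 2 + nc (g z) ^+ 2)) => //.
- by apply: cmeasM; exact: L2_cmeas.
- by apply: arc_integrableD; exact: L2_integrable_sqr.
- move=> x _; rewrite ncM; have := sqr_ge0 (nc (f x) - nc (g x)).
  by have := mulr_ge0 (nc_ge0 (f x)) (nc_ge0 (g x)); nra.
Qed.
Lemma L2J f : L2 f -> L2 (fun z => (f z)^*).
Proof.
move=> Lf; apply: (@L2_dom _ (fun z => nc (f z) ^+ 2)); last by move=> x; rewrite ncJ.
  exact/cmeasJ/L2_cmeas.
exact: L2_integrable_sqr.
Qed.
Lemma L2_dotP f g : L2 f -> L2 g -> cintegrable mu setT (fun z => f z * (g z)^*).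
Proof. by move=> Lf Lg; apply: L2_cintegrableM => //; exact: L2J. Qed.
Lemma L2_cintegrable f : L2 f -> cintegrable mu setT f.
Proof.
move=> Lf; apply: eq_cintegrable (L2_cintegrableM Lf (L2_cst 1)) => // z _.
by rewrite mulr1.
Qed.

Lemma dotDl f g h : L2 f -> L2 g -> L2 h -> dot (fun z => f z + g z) h = dot f h + dot g h.
Proof.
move=> Lf Lg Lh; rewrite /dot -cintD//; [|exact: L2_dotP..].
by apply: eq_cint => z _; rewrite mulrDl.
Qed.
Lemma dotZl f g (c : R[i]) : L2 f -> L2 g -> dot (fun z => c * f z) g = c * dot f g.
Proof.
move=> Lf Lg; rewrite /dot -cintZ//; [|exact: L2_dotP].
by apply: eq_cint => z _; rewrite mulrA.
Qed.
Lemma dotBl f g h : L2 f -> L2 g -> L2 h -> dot (fun z => f z - g z) h = dot f h - dot g h.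
Proof.
move=> Lf Lg Lh; rewrite dotDl//; last exact: L2N.
congr (_ + _); rewrite -mulN1r -(dotZl _ Lg Lh); apply: eq_cint => z _.
by rewrite mulN1r.
Qed.
Lemma dotff f : L2 f -> dot f f = (N2 f)%:C.
Proof.
move=> Lf; rewrite /dot /cint /N2; apply/eqP; rewrite eq_complex /=; apply/andP; split; apply/eqP.
  by apply: eq_Rintegral => z _; rewrite mulcJ.
transitivity (\int[mu]_(z in setT) (0 : R)); last by rewrite Rintegral_cst// mul0r.
by apply: eq_Rintegral => z _; rewrite mulcJ.
Qed.

Lemma N2DZ f g (c : R[i]) : L2 f -> L2 g ->
  N2 (fun z => f z + c * g z) = N2 f + nc c ^+ 2 * N2 g + 2 * complex.Re (c^* * dot f g).
Proof.
move=> Lf Lg.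
have -> : complex.Re (c^* * dot f g) = \int[mu]_z complex.Re (c^* * (f z * (g z)^*)).
  by rewrite /dot -cintZ//; exact: L2_dotP.
have [i1 _] := cintegrableZ c^* mT (L2_dotP Lf Lg).
have i2 := L2_integrable_sqr Lf; have i3 := arc_integrableZ (nc c ^+ 2) (L2_integrable_sqr Lg).
rewrite /N2 -(RintegralZl _ mT (L2_integrable_sqr Lg)) -(RintegralZl _ mT i1).
rewrite -(RintegralD mT i2 i3) -(RintegralD mT (arc_integrableD i2 i3) (arc_integrableZ 2 i1)).
apply: eq_Rintegral => z _; rewrite !nc_sq.
by case: c (f z) (g z) {i1 i2 i3} => [c1 c2] [a b] [a' b'] /=; ring.
Qed.

Lemma N2Z f (c : R[i]) : L2 f -> N2 (fun z => c * f z) = nc c ^+ 2 * N2 f.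
Proof.
move=> Lf; rewrite /N2 -RintegralZl//; last exact: L2_integrable_sqr.
by apply: eq_Rintegral => z _; rewrite ncM exprMn.
Qed.

Lemma N2B f g : L2 f -> L2 g -> N2 (fun z => f z - g z) = N2 f + N2 g - 2 * complex.Re (dot f g).
Proof.
move=> Lf Lg; have := N2DZ (-1) Lf Lg; rewrite ncN nc1 expr1n mul1r.
rewrite (_ : (-1)^* = -1 :> R[i]); last by rewrite rmorphN rmorph1.
rewrite mulN1r ReN mulrN => <-; congr N2; apply/funext => z; by rewrite mulN1r.
Qed.
Lemma N2D f g : L2 f -> L2 g -> N2 (fun z => f z + g z) = N2 f + N2 g + 2 * complex.Re (dot f g).
Proof.
move=> Lf Lg; have := N2DZ 1 Lf Lg; rewrite nc1 expr1n mul1r rmorph1 mul1r => <-.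
by congr N2; apply/funext => z; rewrite mul1r.
Qed.
Lemma N2_le f (g : T -> R) : L2 f -> mu.-integrable setT (EFin \o g) -> (forall x, nc (f x) ^+ 2 <= g x) ->
  N2 f <= \int[mu]_x g x.
Proof. by move=> Lf ig fg; apply: le_Rintegral => //; exact: L2_integrable_sqr. Qed.
Lemma N2D_le f g : L2 f -> L2 g -> N2 (fun z => f z + g z) <= 2 * N2 f + 2 * N2 g.
Proof.
by move=> Lf Lg; have := N2_ge0 (fun z => f z - g z); rewrite N2B// N2D//; lra.
Qed.
Lemma parallelogram f g : L2 f -> L2 g ->
  N2 (fun z => f z + g z) + N2 (fun z => f z - g z) = 2 * N2 f + 2 * N2 g.
Proof. by move=> Lf Lg; rewrite N2B// N2D//; ring. Qed.
Lemma N2BC f g : N2 (fun z => f z - g z) = N2 (fun z => g z - f z).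
Proof. by apply: eq_Rintegral => z _; rewrite ncBC. Qed.
Lemma N2_tri f g h : L2 f -> L2 g -> L2 h ->
  N2 (fun z => f z - h z) <= 2 * N2 (fun z => f z - g z) + 2 * N2 (fun z => g z - h z).
Proof.
move=> Lf Lg Lh; have := N2D_le (L2B Lf Lg) (L2B Lg Lh).
by rewrite (_ : (fun z => _ + _) = (fun z => f z - h z))//; apply/funext => z; rewrite addrA subrK.
Qed.
Lemma N2_eq0 f : L2 f -> N2 f = 0 -> {ae mu, forall z, f z = 0}.
Proof.
move=> Lf N0; have := L2_int Lf; rewrite N0 => i0.
have : ae_eq mu setT (EFin \o (fun z => nc (f z) ^+ 2)) (cst 0%E).
  apply/ae_eq_integral_abs => //.
    by apply/measurable_EFinP/measurable_funX/measurable_nc => //; exact: L2_cmeas.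
  by rewrite -[RHS]i0; apply: eq_integral => z _ /=; rewrite ger0_norm ?sqr_ge0.
apply: filterS => z /(_ Logic.I) /= [/eqP]; rewrite expf_eq0/= => /eqP.
by move=> /eqP; rewrite nc_eq0 => /eqP.
Qed.
Lemma N2_ae f g : cmeas setT f -> cmeas setT g -> ae_eq_circle f g -> N2 f = N2 g.
Proof.
move=> mf mg fg; rewrite /N2 /Rintegral; congr fine; apply: ae_eq_integral => //.
- by apply/measurable_EFinP/measurable_funX/measurable_nc.
- by apply/measurable_EFinP/measurable_funX/measurable_nc.
- by apply: filterS fg => z fgz _ /=; rewrite fgz.
Qed.
Lemma L2_ae f g : L2 f -> cmeas setT g -> ae_eq_circle f g -> L2 g.
Proof.
move=> /L2E[mf i] mg fg; apply/L2E; split => //.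
apply: (ae_eq_integrable _ i) => //.
- by apply/measurable_EFinP/measurable_funX/measurable_nc.
- by apply: filterS fg => z fgz _ /=; rewrite fgz.
Qed.

Lemma L2_closedP (M : set (T -> R[i])) : M `<=` @L2 R -> L2_closed M <->
  (forall f, L2 f -> (forall e : R, 0 < e -> exists2 g, M g & N2 (fun z => f z - g z) < e) -> M f).
Proof.
move=> ML; split=> cM f Lf h; apply: cM => // e e0.
  have [g Mg ge] := h (e ^+ 2) (exprn_gt0 _ e0); exists g => //.
  rewrite L2_LnormC ?lte_fin; last by apply: L2B => //; exact: ML.
  by rewrite -[ltRHS]gtr0_norm// -sqrtr_sqr ltr_sqrt// exprn_gt0.
have se : 0 < Num.sqrt e by rewrite sqrtr_gt0.
have [g Mg ge] := h (Num.sqrt e) se.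
exists g => //; move: ge; rewrite L2_LnormC ?lte_fin; last by apply: L2B => //; exact: ML.
by rewrite ltr_sqrt.
Qed.

End L2theory.

(** * Completeness and projections *)

Lemma cvg_summable_increments (R : realType) (u v : R^nat) :
  (forall k, `|u k.+1 - u k| <= v k) -> (\sum_(0 <= k <oo) (v k)%:E < +oo)%E -> cvgn u.
Proof.
move=> uv sv.
have v0 k : 0 <= v k by rewrite (le_trans _ (uv k)).
have cv : cvgn (series v).
  apply: nondecreasing_is_cvgn; first exact: nondecreasing_series.
  exists (fine (\sum_(0 <= k <oo) (v k)%:E)%E) => _ [n _ <-].
  rewrite -lee_fin fineK; last first.
    by rewrite ge0_fin_numE// nneseries_ge0// => k _ _; rewrite lee_fin.
  rewrite /series/= -sumEFin; apply: nneseries_lim_ge => k _ _; by rewrite lee_fin.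
have : cvgn (series (telescope u)).
  apply: (@normed_cvg _ R^o); by apply: (series_le_cvg _ v0 _ cv) => n; [exact: normr_ge0|exact: uv].
move=> /cvgP ct; have -> : u = (fun n => u 0%N + series (telescope u) n).
  by apply/funext => n; exact: eq_sum_telescope.
by apply: is_cvgD => //; exact: is_cvg_cst.
Qed.

Section complete.
Variable R : realType.
Local Notation mu := (@arc_measure R).
Local Notation T := (circle R).
Implicit Types (f g h : T -> R[i]).

Let mT : measurable (setT : set T). Proof. exact: measurableT. Qed.

Lemma limn_einf_le (u : (\bar R)^nat) (c : \bar R) k :
  (forall m, (k <= m)%N -> (u m <= c)%E) -> (limn_einf u <= c)%E.
Proof.
move=> uc; rewrite limn_einf_lim.
rewrite (cvg_lim (@ereal_hausdorff R) (@cvg_einfs_sup R u)); apply: ge_ereal_sup => _ [n _ <-].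
apply: (@le_trans _ _ (u (maxn n k))); last by apply: uc; rewrite leq_maxr.
by apply: ereal_inf_lbound; exists (maxn n k) => //=; rewrite leq_maxl.
Qed.

(** The constant 4 is the fixed point of C = 2 * C / 4 + 2, the recursion produced by [N2_tri] when
    the first step is split off. *)
Lemma fast_cauchy_dist (f : nat -> T -> R[i]) : (forall k, L2 (f k)) ->
  (forall k, N2 (fun z => f k.+1 z - f k z) <= 4^-1 ^+ k) ->
  forall n k, N2 (fun z => f (n + k)%N z - f k z) <= 4 * 4^-1 ^+ k.
Proof.
move=> Lf df; elim=> [|n ih] k.
  rewrite add0n (_ : N2 _ = 0) ?mulr_ge0// ?exprn_ge0// ?invr_ge0//.
  transitivity (\int[mu]_(z in setT) (0 : R)); last by rewrite Rintegral_cst// mul0r.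
  by apply: eq_Rintegral => z _; rewrite subrr nc0 expr0n.
rewrite addSnnS.
apply: le_trans (N2_tri (Lf _) (Lf k.+1) (Lf _)) _.
have := ih k.+1; have := df k; rewrite exprS.
have : 0 <= (4^-1 : R) ^+ k by rewrite exprn_ge0// invr_ge0.
set a := _ ^+ k; set b := N2 _; set c := N2 _ => a0; lra.
Qed.

Lemma sum_increments_fin (f : nat -> T -> R[i]) : (forall k, L2 (f k)) ->
  (forall k, N2 (fun z => f k.+1 z - f k z) <= 4^-1 ^+ k) ->
  {ae mu, forall z, (\sum_(0 <= k <oo) (nc (f k.+1 z - f k z))%:E < +oo)%E}.
Proof.
move=> Lf df; pose d k z := nc (f k.+1 z - f k z).
have Ld k : L2 (fun z => f k.+1 z - f k z) by exact: L2B.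
have md k : measurable_fun setT (EFin \o d k).
  by apply/measurable_EFinP/measurable_nc => //; exact: L2_cmeas.
have d0 k z : (0 <= (d k z)%:E)%E by rewrite lee_fin nc_ge0.
pose G z := (\sum_(0 <= k <oo) (d k z)%:E)%E.
have G0 z : (0 <= G z)%E by apply: nneseries_ge0 => k _ _.
have iG : mu.-integrable setT G.
  apply/integrableP; split.
    by apply: (ge0_emeasurable_sum (P := xpredT)) => [k x _ _|k _]; [exact: d0|exact: md].
  under eq_integral do rewrite gee0_abs//.
  rewrite integral_nneseries//.
  apply: (@le_lt_trans _ _ (\sum_(0 <= k <oo) (geometric 2 2^-1 k)%:E)%E).
    apply: lee_nneseries => [k _ _|k _]; first by apply: integral_ge0 => z _.
    (* Arithmetic-geometric mean inequality, weighted so that each of the two terms has integral at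
       most 2^-k. *)
    have dk z : d k z <= 2^-1 ^+ k + 2 ^+ k * d k z ^+ 2.
      have := sqr_ge0 (1 - 2 ^+ k * d k z); have : 0 <= d k z by exact: nc_ge0.
      have : (2^-1 : R) ^+ k * 2 ^+ k = 1 by rewrite -exprMn mulVf ?expr1n.
      have : 0 < (2 : R) ^+ k by rewrite exprn_gt0.
      have : 0 < (2^-1 : R) ^+ k by rewrite exprn_gt0// invr_gt0.
      set a := _ ^+ k; set b := _ ^+ k; set x := d k z => a0 b0 ab x0 sq.
      suff : 0 <= a * (1 - b * x) ^+ 2 + x.
        have -> : a * (1 - b * x) ^+ 2 = a - 2 * (a * b) * x + (a * b) * (b * x ^+ 2) by ring.
        rewrite ab; lra.
      by rewrite addr_ge0// mulr_ge0// ltW.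
    have i1 : mu.-integrable setT (EFin \o (fun z => 2^-1 ^+ k + 2 ^+ k * d k z ^+ 2)).
      apply: arc_integrableD; first exact: arc_integrable_cst.
      by apply: arc_integrableZ; exact: L2_integrable_sqr.
    apply: (@le_trans _ _ (\int[mu]_z (2^-1 ^+ k + 2 ^+ k * d k z ^+ 2)%R%:E)%E).
      apply: ge0_le_integral => //.
      - exact: md.
      - exact: measurable_int i1.
      - by move=> z _; rewrite lee_fin.
    rewrite -[leLHS]fineK; last exact: integrable_fin_num.
    rewrite lee_fin -/(Rintegral _ _ _) RintegralD//; last 2 first.
      exact: arc_integrable_cst.
      by apply: arc_integrableZ; exact: L2_integrable_sqr.
    rewrite Rintegral_cst// RintegralZl//; last exact: L2_integrable_sqr.
    rewrite [X in fine X]arc_measure_setT /= mulr1.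
    have := df k; rewrite /N2 -/(d k) /geometric /=.
    have -> : (4^-1 : R) ^+ k = 2^-1 ^+ k * 2^-1 ^+ k.
      by rewrite -exprMn -invfM; congr (_^-1 ^+ _); rewrite -natrM.
    have : (2^-1 : R) ^+ k * 2 ^+ k = 1 by rewrite -exprMn mulVf ?expr1n.
    have : 0 < (2 : R) ^+ k by rewrite exprn_gt0.
    set a := _ ^+ k; set b := 2^-1 ^+ k; set x := Rintegral _ _ _ => a0 ab xb.
    have : a * x <= a * (b * b) by rewrite ler_pM2l.
    rewrite mulrA [a * b]mulrC ab; lra.
  have half : `|2^-1 : R| < 1 by rewrite ger0_norm ?invr_ge0// invf_lt1// ltr1n.
  rewrite [X in (X < _)%E](_ : _ = (limn (series (geometric (2 : R) 2^-1)))%:E) ?ltry//.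
  rewrite -EFin_lim; last exact: is_cvg_geometric_series.
  by congr (limn _); apply/funext => n; rewrite /= sumEFin.
apply: filterS (integrable_ae mT iG) => z /(_ Logic.I).
by rewrite ge0_fin_numE.
Qed.

Lemma L2_complete (f : nat -> T -> R[i]) : (forall k, L2 (f k)) ->
  (forall k, N2 (fun z => f k.+1 z - f k z) <= 4^-1 ^+ k) ->
  exists2 g, L2 g & forall k, N2 (fun z => g z - f k z) <= 4 * 4^-1 ^+ k.
Proof.
move=> Lf df; have [N [mN N0 subN]] := sum_increments_fin Lf df.
(* Setting the sequence to 0 on the exceptional null set makes it converge at every point, so that
   the pointwise limit [g] is measurable. *)
pose F k z : R[i] := (\1_(~` N) z)%:C * f k z.
have mind : cmeas setT (fun z : T => (\1_(~` N) z : R)%:C).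
  by split => /=; [exact: measurable_indic (measurableC mN)|exact: measurable_cst].
have mF k : cmeas setT (F k) by apply: cmeasM => //; exact: L2_cmeas.
have FE k z : ~ N z -> F k z = f k z.
  by move=> Nz; rewrite /F indicE mem_set// mul1r.
have F0 k z : N z -> F k z = 0.
  move=> Nz; rewrite /F indicE memNset ?mul0r//; exact.
have cF z : cvgn (fun k => complex.Re (F k z)) /\ cvgn (fun k => complex.Im (F k z)).
  have [Nz|Nz] := pselect (N z).
    by under [X in cvgn X /\ _]eq_fun do rewrite F0//; under [X in _ /\ cvgn X]eq_fun do rewrite F0//;
      split; exact: is_cvg_cst.
  have sf : (\sum_(0 <= k <oo) (nc (f k.+1 z - f k z))%:E < +oo)%E.
    by apply: contrapT => h; apply: Nz; apply: subN.
  split; apply: cvg_summable_increments sf => k; rewrite !FE//.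
    by rewrite -ReN -ReD Re_le.
  by rewrite -ImN -ImD Im_le.
pose g z := (limn (fun k => complex.Re (F k z))) +i* (limn (fun k => complex.Im (F k z))).
have mg : cmeas setT g.
  split; [apply: (@measurable_fun_cvg _ _ _ _ (fun k z => complex.Re (F k z)))|
          apply: (@measurable_fun_cvg _ _ _ _ (fun k z => complex.Im (F k z)))].
  - by move=> k; have [] := mF k.
  - by move=> z _; have [] := cF z.
  - by move=> k; have [] := mF k.
  - by move=> z _; have [] := cF z.
have aeF k : ae_eq_circle (F k) (f k).
  by exists N; split => // z /= h; apply: contrapT => Nz; apply: h; exact: FE.
have LF k : L2 (F k).
  by apply: L2_ae (Lf k) (mF k) _; apply: filterS (aeF k) => z ->.
have dF n k : N2 (fun z => F (n + k)%N z - F k z) <= 4 * 4^-1 ^+ k.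
  rewrite (_ : N2 _ = N2 (fun z => f (n + k)%N z - f k z)); first exact: fast_cauchy_dist.
  apply: N2_ae; [by apply: cmeasB|by apply: cmeasB; exact: L2_cmeas|].
  by apply: filterS2 (aeF (n + k)%N) (aeF k) => z -> ->.
(* Fatou's lemma in m: the distance from [F k] to the limit inherits the bound on the distances to
   [F m], m >= k. *)
have fat k : (\int[mu]_z (nc (g z - F k z) ^+ 2)%:E <= (4 * 4^-1 ^+ k)%:E)%E.
  have -> : (\int[mu]_z (nc (g z - F k z) ^+ 2)%:E =
      \int[mu]_z limn_einf (fun m => (nc (F m z - F k z) ^+ 2)%:E))%E.
    apply: eq_integral => z _; apply/esym.
    suff /cvg_limn_einf_sup[] : (fun m => (nc (F m z - F k z) ^+ 2)%:E) @ \oo --> (nc (g z - F k z) ^+ 2)%:E by [].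
    apply/fine_cvgP; split; first exact: nearW.
    rewrite (_ : fine \o _ = fun m => (complex.Re (F m z) - complex.Re (F k z)) ^+ 2 + (complex.Im (F m z) - complex.Im (F k z)) ^+ 2); last first.
      by apply/funext => m /=; rewrite nc_sq ReD ImD ReN ImN.
    rewrite /= nc_sq ReD ImD ReN ImN /=; have [c1 c2] := cF z.
    by apply: cvgD; apply: cvgM; apply: cvgB => //; exact: cvg_cst.
  apply: le_trans (fatou _ _ _ _) _ => //.
  - move=> m; apply/measurable_EFinP/measurable_funX/measurable_nc; [exact: measurableT|exact: cmeasB].
  - by move=> m z _; rewrite lee_fin sqr_ge0.
  apply: (limn_einf_le (k := k)) => m km; rewrite L2_int; last exact: L2B.
  by rewrite lee_fin -(subnK km) dF.
have Lgk k : L2 (fun z => g z - F k z).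
  apply/L2E; split; first exact: cmeasB.
  apply/integrableP; split; first by apply/measurable_EFinP/measurable_funX/measurable_nc; [exact: measurableT|exact: cmeasB].
  under eq_integral do rewrite /= ger0_norm ?sqr_ge0//.
  by apply: le_lt_trans (fat k) _; exact: ltry.
exists g.
  by rewrite (_ : g = fun z => (g z - F 0%N z) + F 0%N z); [exact: L2D|apply/funext => z; rewrite subrK].
move=> k; rewrite (_ : N2 _ = N2 (fun z => g z - F k z)).
  by rewrite -lee_fin -L2_int.
apply: N2_ae; [by apply: cmeasB; [|exact: L2_cmeas]|exact: cmeasB|].
by apply: filterS (aeF k) => z ->.
Qed.

(** Expand the squared norm of f - g / t and multiply by t. Unlike in [N2D_le], the coefficient of
    [N2 f] can be brought arbitrarily close to 1, which is what passing to the limit in a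
    minimisation requires. *)
Lemma N2D_eps f g (t : R) : 0 < t -> L2 f -> L2 g ->
  N2 (fun z => f z + g z) <= (1 + t) * N2 f + (1 + t^-1) * N2 g.
Proof.
move=> t0 Lf Lg; have := N2_ge0 (fun z => f z + (- t^-1)%:C * g z).
rewrite N2DZ// N2D// nc_real conjR.
have -> : complex.Re ((- t^-1)%:C * dot f g) = - t^-1 * complex.Re (dot f g).
  by case: (dot f g) => a b /=; rewrite mul0r subr0.
rewrite normrN gtr0_norm ?invr_gt0// => h.
have : 0 <= t * (N2 f + t^-1 ^+ 2 * N2 g + 2 * (- t^-1 * complex.Re (dot f g))).
  by rewrite mulr_ge0// ltW.
have -> : t * (N2 f + t^-1 ^+ 2 * N2 g + 2 * (- t^-1 * complex.Re (dot f g))) =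
  t * N2 f + t^-1 * N2 g - 2 * complex.Re (dot f g) by field; rewrite gt_eqF.
lra.
Qed.

(** Closedness is phrased with the squared distance; by [L2_closedP] this is the same as
    [L2_closed]. *)
Definition subspace_closed (M : set (T -> R[i])) := L2_subspace M /\
  (forall f, L2 f -> (forall e : R, 0 < e -> exists2 g, M g & N2 (fun z => f z - g z) < e) -> M f).

(* A minimising sequence for the distance to M is Cauchy by the parallelogram law. *)
Lemma L2_nearest (M : set (T -> R[i])) f : subspace_closed M -> L2 f ->
  exists2 g, M g & forall h, M h -> N2 (fun z => f z - g z) <= N2 (fun z => f z - h z).
Proof.
move=> [[ML M0 Mlin] Mc] Lf.
pose S := [set N2 (fun z => f z - h z) | h in M].
have Sinf : has_inf S.
  by split; [exists (N2 (fun z => f z - 0)), (fun=> 0)|exists 0 => _ [h _ <-]; exact: N2_ge0].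
pose dd := inf S.
have dle h : M h -> dd <= N2 (fun z => f z - h z) by move=> Mh; apply: ge_inf; [case: Sinf|exists h].
(* With these tolerances the parallelogram law bounds the squared increments by (1/2 + 1/8) 4^-k,
   within the rate asked by [L2_complete]. *)
have seqM k : exists h, M h /\ N2 (fun z => f z - h z) <= dd + 4^-1 * 4^-1 ^+ k.
  have e0 : (0 : R) < 4^-1 * 4^-1 ^+ k by rewrite mulr_gt0// ?exprn_gt0// invr_gt0.
  have [_ [h Mh <-] hd] := inf_adherent e0 Sinf.
  by exists h; split => //; exact: ltW.
have [m mP] := choice seqM.
have Mm k : M (m k) by case: (mP k).
have Lm k : L2 (m k) by exact: ML.
have dm k : N2 (fun z => m k.+1 z - m k z) <= 4^-1 ^+ k.
  have := parallelogram (L2B Lf (Lm k)) (L2B Lf (Lm k.+1)).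
  have -> : (fun z => f z - m k z - (f z - m k.+1 z)) = (fun z => m k.+1 z - m k z).
    by apply/funext => z; ring.
  have -> : N2 (fun z => f z - m k z + (f z - m k.+1 z)) =
      4 * N2 (fun z => f z - (2^-1 * m k z + 2^-1 * m k.+1 z)).
    have -> : (fun z => f z - m k z + (f z - m k.+1 z)) =
      (fun z => 2 * (f z - (2^-1 * m k z + 2^-1 * m k.+1 z))).
      by apply/funext => z; field.
    rewrite N2Z; last exact: L2B Lf (L2D (L2Z _ (Lm k)) (L2Z _ (Lm k.+1))).
    congr (_ * _); rewrite (_ : (2 : R[i]) = (2 : R)%:C); last by rewrite rmorph_nat.
    by rewrite nc_real ger0_norm// -natrX.
  have := dle _ (Mlin 2^-1 2^-1 _ _ (Mm k) (Mm k.+1)).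
  have [_ +] := mP k; have [_] := mP k.+1; rewrite exprS.
  have : 0 <= (4^-1 : R) ^+ k by rewrite exprn_ge0// invr_ge0.
  set a := _ ^+ k; set b := N2 _; set c := N2 _; set d := N2 _; set e := N2 _; lra.
have [g Lg gm] := L2_complete Lm dm.
have small (e : R) : 0 < e -> exists k, 4 * 4^-1 ^+ k < e.
  move=> e0.
  have half : `|4^-1 : R| < 1 by rewrite ger0_norm ?invr_ge0// invf_lt1// ltr1n.
  have /cvgrPdist_lt/(_ e e0)[k _ /(_ k (leqnn _))] := @cvg_geometric _ (4 : R) _ half.
  by rewrite sub0r normrN /geometric /= ger0_norm ?mulr_ge0 ?exprn_ge0 ?invr_ge0// => h; exists k.
have Mg : M g.
  apply: Mc => // e /small[k ke]; exists (m k) => //; exact: le_lt_trans (gm k) ke.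
exists g => // h Mh; apply: le_trans (dle h Mh); apply/ler_addgt0Pl => e e0.
have dd0 : 0 <= dd by apply: lb_le_inf; [case: Sinf|move=> _ [k _ <-]; exact: N2_ge0].
(* [t] makes the surplus [t * dd] of [N2D_eps] at most e / 2 (the 1 avoids dividing by 0 when [dd]
   vanishes); [K] collects the coefficients of the remaining errors of order 4^-k. *)
pose t := e / (2 * (dd + 1)).
have t0 : 0 < t by rewrite divr_gt0// mulr_gt0// ltr_wpDl.
have tdd : t * dd <= e / 2.
  have -> : e / 2 = t * (dd + 1) by rewrite /t; field; rewrite gt_eqF// ltr_wpDl.
  by rewrite ler_pM2l// lerDl.
pose K := (1 + t) + (1 + t^-1) * 4.
have ti0 : 0 < t^-1 by rewrite invr_gt0.
have K0 : 0 < K by rewrite /K; lra.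
have eK : 0 < e / (2 * K) by rewrite divr_gt0// mulr_gt0.
have [k] := small _ eK.
rewrite ltr_pdivlMr; last by rewrite mulr_gt0.
have -> : (fun z => f z - g z) = (fun z => (f z - m k z) + (m k z - g z)).
  by apply/funext => z; rewrite addrA subrK.
move=> ke; apply: le_trans (N2D_eps t0 (L2B Lf (Lm k)) (L2B (Lm k) Lg)) _.
have [_ mk] := mP k; have := gm k; rewrite N2BC => gk.
have q0 : 0 <= (4^-1 : R) ^+ k by rewrite exprn_ge0// invr_ge0.
move: q0 ke mk gk; set q := _ ^+ k; set a := N2 _; set b := N2 _ => q0 ke mk gk.
have h1 : (1 + t) * a <= (1 + t) * (dd + 4^-1 * q) by rewrite ler_pM2l//; lra.
have h2 : (1 + t^-1) * b <= (1 + t^-1) * (4 * q) by rewrite ler_pM2l//; lra.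
have h3 : K * q = (1 + t) * q + (1 + t^-1) * (4 * q) by rewrite /K; ring.
have h4 : 0 <= t * q by rewrite mulr_ge0// ltW.
move: ke; rewrite (_ : 4 * q * (2 * K) = 8 * (K * q)); last by ring.
have : (1 + t) * (dd + 4^-1 * q) = dd + t * dd + 4^-1 * q + 4^-1 * (t * q) by ring.
have h5 : (1 + t) * q = q + t * q by ring.
rewrite h5 in h3.
have : 0 <= (1 + t^-1) * (4 * q) by rewrite mulr_ge0 ?mulr_ge0//; lra.
lra.
Qed.

(* Moving from the nearest point g to g + t <f - g, h> h with small t > 0 must not decrease the
   distance to f. *)
Lemma L2_projection (M : set (T -> R[i])) f : subspace_closed M -> L2 f ->
  exists2 g, M g & forall h, M h -> dot (fun z => f z - g z) h = 0.
Proof.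
move=> cM Lf; have [g Mg gP] := L2_nearest cM Lf; exists g => // h Mh.
have [[ML M0 Mlin] _] := cM.
have Lg : L2 g by exact: ML.
have Lh : L2 h by exact: ML.
have Lu := L2B Lf Lg; set u := (fun z => f z - g z) in Lu *.
set w := dot u h.
have key (t : R) : 0 <= t ^+ 2 * (nc w ^+ 2 * N2 h) - 2 * t * nc w ^+ 2.
  have := gP _ (Mlin 1 (t%:C * w) _ _ Mg Mh).
  have -> : (fun z => f z - (1 * g z + t%:C * w * h z)) = (fun z => u z + (- (t%:C * w)) * h z).
    by apply/funext => z; rewrite /u; ring.
  rewrite N2DZ// -/w ncN ncM nc_real exprMn real_normK ?num_real//.
  have -> : complex.Re ((- (t%:C * w))^* * w) = - (t * nc w ^+ 2).
    rewrite nc_sq; case: w => a b /=; ring.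
  rewrite -/u; lra.
apply/eqP; rewrite -nc_eq0 -sqrf_eq0.
(* At this value of t the quadratic of [key] is - W (n + 2) / (n + 1)^2, which is nonnegative only
   if W = 0. *)
have := key (N2 h + 1)^-1; have := N2_ge0 h; have := sqr_ge0 (nc w).
set W := nc w ^+ 2; set n := N2 h => W0 n0 hk.
have n1 : 0 < n + 1 by lra.
have : 0 <= (n + 1) ^+ 2 * ((n + 1)^-1 ^+ 2 * (W * n) - 2 * (n + 1)^-1 * W).
  by rewrite mulr_ge0// sqr_ge0.
rewrite (_ : _ * _ = - (W * (n + 2))); last by field; rewrite gt_eqF.
rewrite oppr_ge0 pmulr_lle0; last by lra.
by move=> W1; rewrite eq_le W1 W0.
Qed.
End complete.

(** * Calculus along curves *)

Section ccalc.
Variable R : realType.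
Local Notation leb := (@lebesgue_measure R).
Implicit Types (F G : R -> R[i]) (t : R).

Definition cder F t (l : R[i]) := is_derive t 1 (fun s => complex.Re (F s)) (complex.Re l) /\
  is_derive t 1 (fun s => complex.Im (F s)) (complex.Im l).
Definition ccont F := continuous (fun s => complex.Re (F s)) /\ continuous (fun s => complex.Im (F s)).

Lemma eq_cder F t l l' : cder F t l -> l = l' -> cder F t l'. Proof. by move=> ? <-. Qed.
Lemma cder_cst (c : R[i]) t : cder (fun=> c) t 0.
Proof. by split; exact: is_derive_cst. Qed.
Lemma cder_real t : cder (fun s => s%:C) t 1.
Proof. by split; [exact: is_derive_id|exact: is_derive_cst]. Qed.
Lemma cderD F G t l k : cder F t l -> cder G t k -> cder (fun s => F s + G s) t (l + k).
Proof.
move=> [f1 f2] [g1 g2]; split.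
  under eq_fun do rewrite ReD; rewrite ReD; exact: is_deriveD.
under eq_fun do rewrite ImD; rewrite ImD; exact: is_deriveD.
Qed.
Lemma cderM F G t l k : cder F t l -> cder G t k ->
  cder (fun s => F s * G s) t (l * G t + F t * k).
Proof.
move=> [f1 f2] [g1 g2]; split.
  under eq_fun do rewrite ReM; rewrite ReD !ReM.
  have := is_deriveB (is_deriveM f1 g1) (is_deriveM f2 g2).
  by move=> /is_derive_eq; apply; rewrite /GRing.scale/=; ring.
under eq_fun do rewrite ImM; rewrite ImD !ImM.
have := is_deriveD (is_deriveM f1 g2) (is_deriveM f2 g1).
by move=> /is_derive_eq; apply; rewrite /GRing.scale/=; ring.
Qed.
Lemma cderZ F (c : R[i]) t l : cder F t l -> cder (fun s => c * F s) t (c * l).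
Proof. by move=> /(cderM (cder_cst c t))/eq_cder; apply; rewrite mul0r add0r. Qed.

Definition ei t : R[i] := cos (2 * pi * t) +i* sin (2 * pi * t).
Lemma coord_expi2pi t : coord (expi2pi t) = ei t. Proof. by []. Qed.
Lemma nc_ei t : nc (ei t) = 1. Proof. by rewrite /= cos2Dsin2 sqrtr1. Qed.
Lemma ei0 : ei 0 = 1. Proof. by rewrite /ei mulr0 cos0 sin0. Qed.
Lemma ei1 : ei 1 = 1.
Proof. by rewrite /ei mulr1 mulr_natl cos2pi sin2pi. Qed.
Lemma eiD s t : ei (s + t) = ei s * ei t.
Proof. by rewrite /ei mulrDr cosD sinD; simpc; rewrite [sin _ * cos _ + _]addrC. Qed.
Lemma eiN t : ei (- t) = (ei t)^*. Proof. by rewrite /ei mulrN cosN sinN. Qed.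

Lemma cder_ei t : cder ei t ((2 * pi)%:C * 'i * ei t).
Proof.
have d2 : is_derive t 1 (fun s : R => 2 * pi * s) (2 * pi).
  by have := is_deriveZ (2 * pi) (is_derive_id t 1) => /is_derive_eq; apply; rewrite /GRing.scale/= mulr1.
split => /=.
  have := @is_derive1_comp _ (@cos R) (fun s => 2 * pi * s) t _ _ (is_derive_cos _) d2.
  by move=> /is_derive_eq; apply; ring.
have := @is_derive1_comp _ (@sin R) (fun s => 2 * pi * s) t _ _ (is_derive_sin _) d2.
by move=> /is_derive_eq; apply; ring.
Qed.

Lemma cderX F t l n : cder F t l -> cder (fun s => F s ^+ n) t (n%:R * F t ^+ n.-1 * l).
Proof.
move=> dF; elim: n => [|n ih].
  by under eq_fun do rewrite expr0; rewrite !mul0r; exact: cder_cst.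
under eq_fun do rewrite exprS; apply: eq_cder (cderM dF ih) _ => /=.
case: n {ih} => [|n]; first by rewrite !expr0; ring.
by rewrite /= exprS -natr1; ring.
Qed.

Lemma cder_cont F : (forall t, exists l, cder F t l) -> ccont F.
Proof.
move=> dF; split => t; have [l [h1 h2]] := dF t.
  by apply/differentiable_continuous/derivable1_diffP; case: h1.
by apply/differentiable_continuous/derivable1_diffP; case: h2.
Qed.

Lemma ccontM F G : ccont F -> ccont G -> ccont (fun s => F s * G s).
Proof.
move=> [f1 f2] [g1 g2]; split => t.
  by under eq_fun do rewrite ReM; apply: cvgB; apply: cvgM; [exact: f1|exact: g1|exact: f2|exact: g2].
by under eq_fun do rewrite ImM; apply: cvgD; apply: cvgM; [exact: f1|exact: g2|exact: f2|exact: g1].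
Qed.
Lemma ccontD F G : ccont F -> ccont G -> ccont (fun s => F s + G s).
Proof.
move=> [f1 f2] [g1 g2]; split => t.
  by under eq_fun do rewrite ReD; apply: cvgD; [exact: f1|exact: g1].
by under eq_fun do rewrite ImD; apply: cvgD; [exact: f2|exact: g2].
Qed.
Lemma ccont_cst (c : R[i]) : ccont (fun=> c).
Proof. by apply: cder_cont => t; exists 0; exact: cder_cst. Qed.
Lemma ccont_ei : ccont ei.
Proof. by apply: cder_cont => t; eexists; exact: cder_ei. Qed.

Lemma ccont_int F a b : ccont F -> cintegrable leb `[a, b] F.
Proof.
move=> [f1 f2]; split; apply: continuous_compact_integrable; try exact: segment_compact.
  exact: continuous_subspaceT.
exact: continuous_subspaceT.
Qed.

Lemma cint_FTC F f a b : a <= b -> (forall t, cder F t (f t)) -> ccont f ->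
  cint leb `[a, b] f = F b - F a.
Proof.
have key (H h : R -> R) : a < b -> (forall t, is_derive t 1 H (h t)) -> continuous h ->
    \int[leb]_(x in `[a, b]) h x = H b - H a.
  move=> ab dH ch; rewrite /Rintegral (@continuous_FTC2 _ h H a b)//.
  - exact: continuous_subspaceT.
  - have cH t : {for t, continuous H}.
      by apply/differentiable_continuous/derivable1_diffP; have [] := dH t.
    split.
    + by move=> t _; have [] := dH t.
    + by apply: cvg_at_right_filter; exact: cH.
    + by apply: cvg_at_left_filter; exact: cH.
  - by move=> t _; rewrite derive1E; have [_ ->] := dH t.
rewrite le_eqVlt => /predU1P[<- _ _|ab dF [c1 c2]].
  rewrite subrr set_itv1 /cint !Rintegral_set1//.
have -> : F b - F a = (complex.Re (F b) - complex.Re (F a)) +i* (complex.Im (F b) - complex.Im (F a)).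
  by case: (F b) (F a) => [??] [??].
rewrite /cint; congr (_ +i* _).
  by apply: (key (fun s => complex.Re (F s))) => // t; have [] := dF t.
by apply: (key (fun s => complex.Im (F s))) => // t; have [] := dF t.
Qed.

End ccalc.

(** * Fatou's theorem *)

Section approximate_identity.
Variable R : realType.
Local Notation leb := (@lebesgue_measure R).
Local Open Scope ereal_scope.

(** In the application [phi] is the deviation of the boundary function from its value at a Lebesgue
    point [x], [h] is a scale below which its means are small, and [d] is the distance 1 - r to the
    circle. *)
Variables (phi : R -> R) (x h d e : R).
Hypotheses (mphi : measurable_fun setT phi) (phi0 : forall t, (0 <= phi t)%R).
Hypotheses (d0 : (0 < d)%R) (dh : (d <= h)%R) (e0 : (0 <= e)%R).
Hypothesis small : forall s : R, (0 < s <= h)%R ->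
  \int[leb]_(t in ball x s) (phi t)%:E <= (e * s)%:E.

(** Up to the factor 1/pi, the Poisson kernel of the half-plane at height [d]. *)
Let K (t : R) : R := (d / (d ^+ 2 + (t - x) ^+ 2))%R.

Let den0 t : (0 < d ^+ 2 + (t - x) ^+ 2)%R.
Proof. by rewrite ltr_pwDl ?sqr_ge0// exprn_gt0. Qed.
Let K0 t : (0 <= K t)%R.
Proof. by rewrite divr_ge0// ltW. Qed.
Let mK : measurable_fun setT K.
Proof.
apply: continuous_measurable_fun => t; apply: cvgM; first exact: cvg_cst.
apply: cvgV; first by rewrite gt_eqF.
apply: cvgD; first exact: cvg_cst.
by apply: cvgM; (apply: cvgB; [exact: cvg_id|exact: cvg_cst]).
Qed.
Let mKphi D : measurable_fun D (fun t => (K t * phi t)%:E).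
Proof. by apply/measurable_EFinP/measurable_funTS/measurable_funM. Qed.
Let mphiD D : measurable_fun D (EFin \o phi).
Proof. by apply/measurable_EFinP/measurable_funTS. Qed.

Let mcphi (c : R) D : measurable_fun D (fun t => c%:E * (phi t)%:E).
Proof.
under eq_fun do rewrite -EFinM; apply/measurable_EFinP.
by apply/measurable_funTS/measurable_funM => //; exact: measurable_cst.
Qed.

Let bound_on (A B : set R) (c : R) : measurable A -> measurable B -> A `<=` B -> (0 <= c)%R ->
  (forall t, A t -> (K t <= c)%R) ->
  \int[leb]_(t in A) (K t * phi t)%:E <= c%:E * \int[leb]_(t in B) (phi t)%:E.
Proof.
move=> mA mB AB c0 Kc; rewrite -ge0_integralZl//; last by move=> t _; rewrite lee_fin.
  2: exact: mphiD.
apply: (@le_trans _ _ (\int[leb]_(t in A) (c%:E * (phi t)%:E))).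
  apply: ge0_le_integral => //.
  - by move=> t _; rewrite lee_fin mulr_ge0.
  - exact: mKphi.
  - exact: mcphi.
  - by move=> t At; rewrite -EFinM lee_fin ler_wpM2r// Kc.
apply: ge0_subset_integral => //; first exact: mcphi.
by move=> t _; rewrite mule_ge0 ?lee_fin.
Qed.

Let Kle a t : (0 < a)%R -> (a <= d ^+ 2 + (t - x) ^+ 2)%R -> (K t <= d / a)%R.
Proof. by move=> a0 ad; rewrite /K ler_wpM2l ?(ltW d0)// lef_pV2// posrE den0. Qed.

Let outside t s : (0 <= s)%R -> ~ ball x s t -> (s ^+ 2 <= d ^+ 2 + (t - x) ^+ 2)%R.
Proof.
move=> s0; rewrite /ball /= => /negP; rewrite -leNgt => sx.
rewrite -[X in (_ + X)%R]real_normK ?num_real// distrC.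
rewrite (@le_trans _ _ (`|x - t| ^+ 2)%R)//; last by rewrite lerDr sqr_ge0.
by rewrite lerXn2r ?nnegrE.
Qed.

(* Cut the ball into the annuli [2^n d <= |t - x| < 2^(n+1) d], on which [K <= 4^-n / d]. *)
Let dyadic n : (2 ^+ n * d <= h)%R ->
  \int[leb]_(t in ball x (2 ^+ n * d)%R) (K t * phi t)%:E <= (e * (5 - 4 * 2^-1 ^+ n))%:E.
Proof.
elim: n => [|n ih] nh.
  rewrite expr0 mul1r in nh *.
  apply: le_trans (bound_on (c := (d / d ^+ 2)%R) (measurable_ball _ _) (measurable_ball _ _) (@subset_refl _ _) _ _) _.
  - by rewrite divr_ge0 ?sqr_ge0// ltW.
  - by move=> t _; apply: Kle; [rewrite exprn_gt0|rewrite lerDl sqr_ge0].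
  have dh' : (0 < d <= h)%R by rewrite d0.
  apply: le_trans (lee_wpmul2l _ (small dh')) _.
    by rewrite lee_fin divr_ge0 ?sqr_ge0 ?(ltW d0).
  rewrite -EFinM lee_fin expr0 mulr1.
  have -> : (d / d ^+ 2 * (e * d) = e)%R by field; rewrite gt_eqF.
  lra.
have p0 : (0 < 2 ^+ n * d)%R by rewrite mulr_gt0// exprn_gt0.
have sub : ball x (2 ^+ n * d)%R `<=` ball x (2 ^+ n.+1 * d)%R.
  by apply: le_ball; rewrite exprS -mulrA ler_peMl ?ler1n// ltW.
have nh' : (2 ^+ n * d <= h)%R.
  by apply: le_trans nh; rewrite exprS -mulrA ler_peMl ?ler1n// ltW.
rewrite -(setDUK sub) ge0_integral_setU//; last 5 first.
- exact: measurable_ball.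
- by apply: measurableD; exact: measurable_ball.
- exact: mKphi.
- by move=> t _; rewrite lee_fin mulr_ge0.
- by rewrite disj_set2E setDIK.
apply: le_trans (leeD (ih nh') (bound_on (c := (d / (2 ^+ n * d) ^+ 2)%R) (measurableD _ _) (measurable_ball x (2 ^+ n.+1 * d)%R) (@subDsetl _ _ _) _ _)) _.
- exact: measurable_ball.
- exact: measurable_ball.
- by rewrite divr_ge0 ?sqr_ge0// ltW.
- by move=> t [_ tn]; apply: Kle; [rewrite exprn_gt0|apply: outside => //; exact: ltW].
have dh' : (0 < 2 ^+ n.+1 * d <= h)%R by rewrite nh mulr_gt0// exprn_gt0.
apply: le_trans (leeD2l _ (lee_wpmul2l _ (small dh'))) _.
  by rewrite lee_fin divr_ge0 ?sqr_ge0 ?(ltW d0).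
(* The new annulus contributes e * 2 * 2^-n, which is exactly the increment of e * (5 - 4 *
   2^-n). *)
rewrite -EFinM -EFinD lee_fin (exprS 2 n) (exprS 2^-1 n).
have : (2^-1 ^+ n * 2 ^+ n = 1 :> R)%R by rewrite -exprMn mulVf ?expr1n.
have : (0 < 2 ^+ n :> R)%R by rewrite exprn_gt0.
set a := (2 ^+ n)%R; set b := (2^-1 ^+ n)%R => a0 ab.
have -> : (d / (a * d) ^+ 2 * (e * (2 * a * d)) = e * (2 * (b * a) / a))%R.
  by rewrite ab; field; rewrite !gt_eqF.
rewrite mulrA mulfK ?gt_eqF// -mulrDr ler_wpM2l//; lra.
Qed.

Lemma dyadic_scale : exists n, (2 ^+ n * d <= h < 2 ^+ n.+1 * d)%R.
Proof.
have ex : exists n, (h < 2 ^+ n * d)%R.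
  exists (Num.bound (h / d)); rewrite -ltr_pdivrMr//.
  apply: (lt_le_trans (archi_boundP _)); first by rewrite divr_ge0 ?(ltW d0)// (le_trans (ltW d0)).
  by rewrite -natrX ler_nat ltnW// ltn_expl.
case: (ex_minnP ex) => -[|n] hn nmin; first by move: hn; rewrite expr0 mul1r ltNge dh.
exists n; rewrite hn andbT leNgt; apply/negP => /nmin; by rewrite ltnn.
Qed.

(** The largest dyadic ball of radius at most [h] contributes at most 5 e, uniformly in [d]. Its
    radius exceeds h / 2, so outside it the kernel is at most 4 d / h^2, which tends to 0 with
    [d]. *)
Lemma approximate_identity_bound (D : set R) : measurable D ->
  \int[leb]_(t in D) (d / (d ^+ 2 + (t - x) ^+ 2) * phi t)%:E <=
  (5 * e)%:E + (4 * d / h ^+ 2)%:E * \int[leb]_(t in D) (phi t)%:E.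
Proof.
move=> mD; have [n /andP[nh hn]] := dyadic_scale.
have h0 : (0 < h)%R by exact: lt_le_trans dh.
set B := ball x (2 ^+ n * d)%R.
have mB : measurable B by exact: measurable_ball.
rewrite -(setUIDK D B) ge0_integral_setU//; last 5 first.
- exact: measurableI.
- exact: measurableD.
- exact: mKphi.
- by move=> t _; rewrite lee_fin; exact: mulr_ge0 (K0 t) (phi0 t).
- by rewrite disj_set2E setDE setIACA setICr setI0.
apply: leeD.
  apply: (@le_trans _ _ (\int[leb]_(t in B) (K t * phi t)%:E)).
    apply: ge0_subset_integral => //; [exact: measurableI|exact: mKphi|].
    by move=> t _; rewrite lee_fin; exact: mulr_ge0 (K0 t) (phi0 t).
  apply: le_trans (dyadic nh) _; rewrite lee_fin mulrC ler_wpM2r//.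
  by rewrite gerBl mulr_ge0// exprn_ge0// invr_ge0.
have -> : (4 * d / h ^+ 2 = d / (h / 2) ^+ 2)%R by field; rewrite gt_eqF.
apply: bound_on => //.
- exact: measurableD.
- by rewrite setUIDK.
- by rewrite divr_ge0 ?sqr_ge0// ltW.
- move=> t [_ tB]; apply: Kle; first by rewrite exprn_gt0// divr_gt0.
  apply: le_trans (outside _ tB); last by rewrite mulr_ge0 ?exprn_ge0// ltW.
  rewrite lerXn2r ?nnegrE ?divr_ge0 ?mulr_ge0 ?exprn_ge0 ?(ltW d0) ?(ltW h0)//.
  by rewrite ler_pdivrMr// mulrC mulrA -exprS ltW.
Qed.
End approximate_identity.

(** * Arc measure through the parametrisation by [0, 1[ *)

Section arc.
Variable R : realType.
Local Notation leb := (@lebesgue_measure R).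
Local Notation mu := (@arc_measure R).
Local Notation T := (circle R).
Let I01 := `[0%R : R, 1%R[%classic.
Let mI : measurable (I01 : set R). Proof. exact: measurable_itv. Qed.

(** The sigma-algebra of the circle is the quotient one, so measurability need only be tested along
    [expi2pi]. *)
Lemma measurable_arc (u : T -> \bar R) : measurable_fun setT (u \o @expi2pi R) -> measurable_fun setT u.
Proof.
by move=> mu_ _ B mB; rewrite setTI; exact: mu_ measurableT B mB.
Qed.

Lemma ge0_arc_integral (u : T -> \bar R) : measurable_fun setT u -> (forall z, (0 <= u z)%E) ->
  (\int[mu]_z u z = \int[leb]_(t in I01) u (expi2pi t))%E.
Proof.
move=> mf u0.
have me := @measurable_expi2pi R.
have mue : measurable_fun setT (u \o @expi2pi R) by exact: measurableT_comp.
transitivity (\int[pushforward (mrestr leb mI) (@expi2pi R)]_(z in setT) u z)%E.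
  apply: eq_measure_integral => A mA _. by [].
rewrite ge0_integral_pushforward// preimage_setT.
rewrite -(setUv I01) ge0_integral_setU//; last 4 first.
- exact: measurableC.
- by rewrite setUv.
- by move=> t _; exact: u0.
- by rewrite disj_set2E setICr.
rewrite [X in (_ + X)%E](_ : _ = 0%E) ?adde0.
  by apply: eq_measure_integral => A mA AI; rewrite /= /mrestr setIidl.
rewrite (eq_measure_integral mzero) ?integral_measure_zero// => A mA AI; rewrite /= /mrestr /mzero.

by rewrite (_ : A `&` _ = set0) ?measure0// -subset0 => t [/AI].
Qed.

Lemma arc_integral (u : T -> \bar R) : measurable_fun setT u ->
  (\int[mu]_z u z = \int[leb]_(t in I01) u (expi2pi t))%E.
Proof.
move=> mf; rewrite integralE [RHS]integralE; congr (_ - _)%E.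
  by rewrite (ge0_arc_integral (measurable_funepos mf))//; apply: eq_integral => t _; rewrite !funeposE.
by rewrite (ge0_arc_integral (measurable_funeneg mf))//; apply: eq_integral => t _; rewrite !funenegE.
Qed.

Lemma arc_cint (f : T -> R[i]) : cmeas setT f ->
  cint mu setT f = cint leb I01 (fun t => f (expi2pi t)).
Proof.
move=> [f1 f2]; rewrite /cint /Rintegral; f_equal; f_equal; apply: arc_integral; exact/measurable_EFinP.
Qed.

Lemma cint_co (F : R -> R[i]) : ccont F -> cint leb I01 F = cint leb `[0%R, 1%R] F.
Proof.
move=> cF; have [i1 i2] := ccont_int 0 1 cF; have sub : I01 `<=` `[0%R, 1%R]%classic by exact: subset_itv_co_cc.
rewrite /cint; f_equal; apply: Rintegral_itv_bndo_bndc; [apply: integrableS i1 => //|apply: integrableS i2 => //].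
Qed.

Lemma cmeas_coord : cmeas setT (fun z : T => coord z).
Proof.
have [c1 c2] := ccont_ei R; split; apply/measurable_EFinP; apply: measurable_arc; apply/measurable_EFinP.
  exact: continuous_measurable_fun.
exact: continuous_measurable_fun.
Qed.

Lemma cint_coord_exp n : cint mu setT (fun z : T => coord z ^+ n.+1) = 0.
Proof.
rewrite arc_cint; last exact/cmeasX/cmeas_coord.
have dX t := @cderX R (@ei R) t _ n.+1 (cder_ei t).
have cX : ccont (fun t => ei t ^+ n.+1 : R[i]).
  by apply: cder_cont => t; eexists; exact: dX.
transitivity (cint leb `[0%R, 1%R] (fun t => ei t ^+ n.+1)); first exact: cint_co.
set k : R[i] := n.+1%:R * (2 * pi)%:C * 'i.
have k0 : k != 0.
  rewrite !mulf_neq0 ?pnatr_eq0//.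
    by rewrite eq_complex /= eqxx andbT mulf_neq0 ?pnatr_eq0// gt_eqF ?pi_gt0.
  by rewrite eq_complex /= oner_eq0 andbF.
apply: (mulfI k0); rewrite mulr0 -cintZ//; last exact: ccont_int.
rewrite (@cint_FTC _ (fun t => ei t ^+ n.+1))//.
- by rewrite ei1 ei0 subrr.
- by move=> t; apply: eq_cder (dX t) _; rewrite /k/= exprS; ring.
- by apply: ccontM => //; exact: ccont_cst.
Qed.

Lemma ei_int (k : int) : ei k%:~R = 1 :> R[i].
Proof.
have en n : ei n%:R = 1 :> R[i].
  by elim: n => [|n ih]; rewrite ?ei0// -natr1 eiD ih ei1 mulr1.
case: k => n; first exact: en.
by rewrite NegzE mulrNz eiN -pmulrn en rmorph1.
Qed.

Lemma ei_inj (s t : R) : 0 <= s < 1 -> 0 <= t < 1 -> ei s = ei t -> s = t.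
Proof.
move=> /andP[s0 s1] /andP[t0 t1] est.
have : ei (s - t) = 1.
  rewrite eiD eiN est mulcJ.
  by rewrite nc_ei expr1n.
rewrite /ei => -[+ _]; rewrite (_ : 2 * pi * (s - t) = (pi * (s - t)) *+ 2); last by rewrite mulr2n; ring.
rewrite cos_mulr2n cos2sin2 => h.
have : sin (pi * (s - t)) = 0.
  apply/eqP; rewrite -sqrf_eq0; apply/eqP; move: h; rewrite mulr2n; lra.
have pi0 := @pi_gt0 R.
have [st|st|//] := ltgtP s t => /eqP.
  rewrite -oppr_eq0 -sinN -mulrN opprB gt_eqF// sin_gt0_pi// mulr_gt0 ?subr_gt0//=.
  by rewrite -[ltRHS]mulr1 ltr_pM2l//; lra.
rewrite gt_eqF// sin_gt0_pi// mulr_gt0 ?subr_gt0//=.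
by rewrite -[ltRHS]mulr1 ltr_pM2l//; lra.
Qed.

Lemma expi2pi_surj (z : T) : exists2 t : R, 0 <= t < 1 & expi2pi t = z.
Proof.
case: z => -[a b] /= nab; have ab : a ^+ 2 + b ^+ 2 = 1.
  by move: (nab) => /eqP; rewrite normrE => /(congr1 (@complex.Re _)) /= /(congr1 (fun x => x ^+ 2)); rewrite sqr_sqrtr ?addr_ge0 ?sqr_ge0// expr1n.
have a1 : -1 <= a <= 1.
  by rewrite -ler_norml -(@ler_pXn2r _ 2)// ?nnegrE// real_normK ?num_real// expr1n -ab lerDl sqr_ge0.
have sb : sin (acos a) = `|b|.
  by rewrite sin_acos// -sqrtr_sqr; congr Num.sqrt; rewrite -ab addrAC subrr add0r.
have pi0 := @pi_gt0 R.
have th0 := acos_ge0 a1; have th1 := acos_lepi a1.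
have tpi : 2 * pi * (acos a / (2 * pi)) = acos a.
  by rewrite mulrC divfK// mulf_neq0 ?pnatr_eq0// gt_eqF.
have [b0|b0] := leP 0 b.
  exists (acos a / (2 * pi)); last first.
    by apply/coord_inj; rewrite coord_expi2pi /ei tpi acosK ?in_itv//= sb ger0_norm.
  by rewrite divr_ge0 ?mulr_ge0// ?ltW//= ltr_pdivrMr ?mulr_gt0//; lra.
(* The lower half circle. There a <> 1, so [acos a] is positive and the parameter stays below 1. *)
exists (1 - acos a / (2 * pi)); last first.
  apply/coord_inj; rewrite coord_expi2pi eiD ei1 mul1r eiN /ei tpi acosK ?in_itv//= sb ltr0_norm//.
  by congr (_ +i* _); exact: opprK.
have th00 : 0 < acos a.
  apply: acos_gt0; case/andP: a1 => -> a1; rewrite lt_neqAle a1 andbT; apply/eqP => a1'.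
  by move: ab; rewrite a1' expr1n => /eqP; rewrite -subr_eq0 addrAC subrr add0r sqrf_eq0 lt_eqF.
have : 0 < acos a / (2 * pi) by rewrite divr_gt0// mulr_gt0.
have : acos a / (2 * pi) <= 1 by rewrite ler_pdivrMr ?mulr_gt0//; lra.
by move=> h1 h2; apply/andP; split; lra.
Qed.

(** The preimage of the image is the union of the integer translates of [N], hence measurable. This
    is what carries null sets from the interval to the circle. *)
Lemma measurable_expi2pi_image (N : set R) : measurable N -> N `<=` I01 ->
  measurable (@expi2pi R @` N) /\ mu (@expi2pi R @` N) = leb N.
Proof.
move=> mN NI; set B := _ @` N.
have pre : @expi2pi R @^-1` B = \bigcup_(k : int) [set t | N (t - k%:~R)].
  apply/seteqP; split=> [t [s Ns est]|t [k _ /= Nt]].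
    have [fl1 fl2] : (Num.floor t)%:~R <= t /\ t < (Num.floor t + 1)%:~R.
      by split; [exact: floor_le|exact: floorD1_gt].
    exists (Num.floor t) => //=.
    rewrite -(@ei_inj s (t - (Num.floor t)%:~R))//.
    - by have := NI _ Ns; rewrite /I01 /= in_itv.
    - by rewrite subr_ge0 fl1/= ltrBlDl -intrD1.
    - by rewrite eiD eiN ei_int rmorph1 mulr1 -!coord_expi2pi est.
  exists (t - k%:~R) => //; apply/coord_inj; rewrite !coord_expi2pi eiD eiN ei_int rmorph1 mulr1//.
have mB : measurable B.
  suff : measurable (@expi2pi R @^-1` B) by move=> h; rewrite /measurable/= /circle_measurable /image_set_system /= setTI.
  rewrite pre; apply: countable_bigcupT_measurable; first exact: countableP.
  move=> k.
  have mf : measurable_fun setT (fun t : R => t - k%:~R) by apply: measurable_funB => //; exact: measurable_cst.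
  by have := mf measurableT N mN; rewrite setTI.
split => //.
rewrite [LHS]/arc_measure /pushforward /mrestr; congr (leb _).
apply/seteqP; split=> [t [[s Ns est]] /= It|t Nt]; last by split; [exists t|exact: NI].
rewrite -(@ei_inj s t)//.
- by have := NI _ Ns; rewrite /I01 /= in_itv.
- by rewrite -!coord_expi2pi est.
Qed.

Lemma ae_arc (P : T -> Prop) : {ae leb, forall t, 0 < t < 1 -> P (expi2pi t)} ->
  {ae mu, forall z, P z}.
Proof.
move=> [N [mN N0 sub]].
(* The point 0 is added because the hypothesis says nothing at the endpoint, that is at z = 1. *)
pose N1 := (N `&` I01) `|` [set 0%R].
have mN1 : measurable N1 by apply: measurableU => //; exact: measurableI.
have N10 : leb N1 = 0%E.
  apply/eqP; rewrite eq_le measure_ge0 andbT.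
  apply: le_trans (measureU2 _ _ _) _ => //; first exact: measurableI.
  rewrite [X in (_ + X)%E](_ : _ = 0%E) ?adde0; last exact: lebesgue_measure_set1.
  rewrite -N0; apply: le_measure; rewrite ?inE//.
  exact: measurableI.
have N1I : N1 `<=` I01.
  by move=> t [[]//|->]; rewrite /I01 /= in_itv /= lexx ltr01.
have [mB B0] := measurable_expi2pi_image mN1 N1I.
exists (@expi2pi R @` N1); split => //; first by rewrite B0.
move=> z /= Pz; have [t /andP[t0 t1] tz] := expi2pi_surj z.
exists t => //; move: t0; rewrite le_eqVlt => /predU1P[<-|t0]; first by right.
left; split; last by rewrite /I01 /= in_itv /= (ltW t0).
by apply: sub => /= h; apply: Pz; rewrite -tz; apply: h; rewrite t0.
Qed.
End arc.

(** * Poisson and Cauchy integrals *)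

Section poisson.
Variable R : realType.
Local Notation leb := (@lebesgue_measure R).
Local Notation mu := (@arc_measure R).
Local Notation T := (circle R).
Implicit Types (f : T -> R[i]) (w : R[i]).
Let mT : measurable (setT : set T). Proof. exact: measurableT. Qed.

Definition pois w (z : R[i]) : R := (1 - nc w ^+ 2) / nc (1 - w * z^*) ^+ 2.
(** Since dz = 2 i pi z dt on the circle, this is the usual Cauchy integral of [f]; its expansion in
    powers of [w] has the Fourier coefficients of nonnegative index as coefficients. *)
Definition cauchy f w : R[i] := cint mu setT (fun z => f z / (1 - w * (coord z)^*)).
Definition poisson f w : R[i] := cint mu setT (fun z => (pois w (coord z))%:C * f z).

Lemma nc_1B_ge (a : R[i]) : 1 - nc a <= nc (1 - a).
Proof. by rewrite lerBlDr; have := ncD (1 - a) a; rewrite subrK nc1. Qed.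

Lemma sub1_neq0 (a : R[i]) : nc a < 1 -> 1 - a != 0.
Proof. by move=> a1; rewrite -nc_eq0 gt_eqF// (lt_le_trans _ (nc_1B_ge a))// subr_gt0. Qed.

(** The two summands are the geometric series in w conj(z), from exponent 0, and in conj(w) z, from
    exponent 1: the analytic and antianalytic halves of the kernel. *)
Lemma pois_decomp w (z : T) : nc w < 1 ->
  (pois w (coord z))%:C = (1 - w * (coord z)^*)^-1 + w^* * coord z / (1 - w^* * coord z).
Proof.
move=> w1; set u := coord z.
have u1 : u * u^* = 1 by rewrite mulcJ nc_circle expr1n.
have d1 : 1 - w * u^* != 0 by apply: sub1_neq0; rewrite ncM ncJ nc_circle mulr1.
have d2 : 1 - w^* * u != 0 by apply: sub1_neq0; rewrite ncM ncJ nc_circle mulr1.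
have e2 : (1 - w * u^*)^* = 1 - w^* * u by rewrite conjB conjM conj1 conjK.
rewrite /pois rCM rCV -mulcJ e2 rCB rC1 -mulcJ.
have -> : 1 - w * w^* = (1 - w^* * u) + w^* * u * (1 - w * u^*).
  transitivity (1 - w * w^* * (u * u^*)); first by rewrite u1 mulr1.
  by ring.
by field; rewrite d1 d2.
Qed.

Lemma pois_ge0 w (z : R[i]) : nc w < 1 -> 0 <= pois w z.
Proof.
move=> w1; rewrite divr_ge0 ?sqr_ge0// subr_ge0 expr_le1 ?nc_ge0//; exact: ltW.
Qed.

Lemma pois_le w (z : T) : nc w < 1 -> pois w (coord z) <= (1 - nc w)^-1 ^+ 2.
Proof.
move=> w1; rewrite /pois exprVn.
have d0 : 0 < 1 - nc w by rewrite subr_gt0.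
have h : 1 - nc w <= nc (1 - w * (coord z)^*).
  by apply: le_trans (nc_1B_ge _); rewrite ncM ncJ nc_circle mulr1.
rewrite -[leRHS]mul1r ler_pM ?subr_ge0 ?invr_ge0 ?sqr_ge0//.
- by rewrite expr_le1 ?nc_ge0// ltW.
- by rewrite gerBl sqr_ge0.
- rewrite lef_pV2 ?posrE ?exprn_gt0//; last exact: lt_le_trans h.
  by rewrite lerXn2r ?nnegrE ?nc_ge0// ltW.
Qed.

Lemma cmeas_inv (g : T -> R[i]) : cmeas setT g -> cmeas setT (fun z => (g z)^-1).
Proof.
move=> mg; have mn : measurable_fun setT (fun z => (nc (g z) ^+ 2)^-1).
  rewrite (_ : (fun z => _) = (fun z => (nc (g z) ^+ 2) `^ (-1))); last first.
    by apply/funext => z; rewrite powR_inv1// sqr_ge0.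
  apply: (measurableT_comp (measurable_powR _)).
  by apply: measurable_funX; exact: measurable_nc.
rewrite (_ : (fun z => (g z)^-1) = (fun z => ((nc (g z) ^+ 2)^-1)%:C * (g z)^*)).
  apply: cmeasM; last exact: cmeasJ.
  by split => //=; exact: measurable_cst.
(* With the convention 0^-1 = 0 the identity also holds at the zeros of [g]. *)
apply/funext => z; have [->|g0] := eqVneq (g z) 0; first by rewrite invr0 conj0 mulr0.
have g0' : (g z)^* != 0 by rewrite conj_eq0.
by rewrite rCV -mulcJ invfM -mulrA mulVf// mulr1.
Qed.

Lemma cintegrable_bounded f (b : T -> R[i]) (C : R) : cintegrable mu setT f -> cmeas setT b ->
  (forall z, nc (b z) <= C) -> cintegrable mu setT (fun z => f z * b z).
Proof.
move=> cf mb bC; apply: (@cintegrable_le _ _ _ _ _ _ (fun z => C * nc (f z))) => //.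
- by apply: cmeasM => //; exact: cintegrable_meas cf.
- by apply: arc_integrableZ; exact: integrable_nc.
- by move=> z _; rewrite ncM mulrC ler_wpM2r ?nc_ge0.
Qed.

(** The remainder of the geometric series is (w b)^N / (1 - w b). Taking [b] to be the coordinate or
    its conjugate serves both halves of the Poisson kernel. *)
Lemma geom_cint f (b : T -> R[i]) w N : cintegrable mu setT f -> cmeas setT b ->
  (forall z, nc (b z) <= 1) -> nc w < 1 ->
  nc (cint mu setT (fun z => f z / (1 - w * b z)) - \sum_(n <- iota 0 N) w ^+ n * cint mu setT (fun z => f z * b z ^+ n))
  <= nc w ^+ N / (1 - nc w) * \int[mu]_z nc (f z).
Proof.
move=> cf mb b1 w1.
have wb z : nc (w * b z) <= nc w by rewrite ncM ler_piMr ?nc_ge0.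
have wb1 z : nc (w * b z) < 1 by exact: le_lt_trans (wb z) w1.
have d0 z : 1 - w * b z != 0 by exact: sub1_neq0.
have dinv z : nc (1 - w * b z)^-1 <= (1 - nc w)^-1.
  rewrite ncV lef_pV2 ?posrE ?subr_gt0//.
    by apply: le_trans (nc_1B_ge _); rewrite lerB.
  by rewrite (lt_le_trans _ (nc_1B_ge _))// subr_gt0.
have md : cmeas setT (fun z => (1 - w * b z)^-1).
  apply: cmeas_inv; apply: cmeasB; first exact: cmeas_cst.
  by apply: cmeasM => //; exact: cmeas_cst.
have i1 := cintegrable_bounded cf md dinv.
have bn n z : nc (b z ^+ n) <= 1 by rewrite ncX exprn_ile1 ?nc_ge0.
have i2 n : cintegrable mu setT (fun z => w ^+ n * (f z * b z ^+ n)).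
  by apply: cintegrableZ => //; apply: (cintegrable_bounded cf _ (bn n)); exact: cmeasX.
have [i3 e3] := cint_sum (iota 0 N) mT i2.
have -> : \sum_(n <- iota 0 N) w ^+ n * cint mu setT (fun z => f z * b z ^+ n) =
    cint mu setT (fun z => \sum_(n <- iota 0 N) w ^+ n * (f z * b z ^+ n)).
  rewrite e3; apply: eq_bigr => n _; rewrite cintZ//.
  by apply: (cintegrable_bounded cf _ (bn n)); exact: cmeasX.
rewrite -cintB//; apply: le_trans (nc_cint_le _ _) _ => //; first exact: cintegrableB.
rewrite -RintegralZl//; last exact: integrable_nc.
apply: le_Rintegral => //.
- by apply: integrable_nc => //; exact: cintegrableB.
- by apply: arc_integrableZ; exact: integrable_nc.
move=> z _.
have -> : f z / (1 - w * b z) - \sum_(n <- iota 0 N) w ^+ n * (f z * b z ^+ n) =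
    f z * ((w * b z) ^+ N * (1 - w * b z)^-1).
  have geo : (1 - w * b z) * \sum_(n <- iota 0 N) (w * b z) ^+ n = 1 - (w * b z) ^+ N.
    rewrite -opprB mulNr -[RHS]opprB subrX1; congr (- (_ * _)).
    by rewrite -(big_mkord xpredT (fun n => (w * b z) ^+ n)) /index_iota subn0.
  have -> : \sum_(n <- iota 0 N) w ^+ n * (f z * b z ^+ n) = f z * \sum_(n <- iota 0 N) (w * b z) ^+ n.
    by rewrite mulr_sumr; apply: eq_bigr => n _; rewrite exprMn; ring.
  apply: (mulfI (d0 z)).
  rewrite mulrBr [X in _ - X]mulrCA geo mulrCA mulfV// mulr1.
  rewrite [RHS]mulrCA [(1 - _) * _]mulrCA mulfV//; ring.
rewrite ncM ncM ncX mulrC ler_wpM2r ?nc_ge0// ler_pM ?nc_ge0 ?exprn_ge0 ?nc_ge0//.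
by rewrite lerXn2r ?nnegrE ?nc_ge0.
Qed.

Lemma geometric_le0 (x q C : R) : 0 <= q < 1 -> (forall N, x <= q ^+ N.+1 * C) -> x <= 0.
Proof.
move=> /andP[q0 q1] xq; have nq : `|q| < 1 by rewrite ger0_norm.
have : (fun N => q ^+ N.+1 * C) @ \oo --> 0 * C.
  apply: cvgM; last exact: cvg_cst.
  have := @cvg_geometric _ (q : R) _ nq; rewrite /geometric.
  by under eq_fun do rewrite -exprS.
rewrite mul0r => c0; apply: (@ler_cvg_to _ _ _ _ (fun=> x) _ x 0 _ c0); first exact: cvg_cst.
exact: nearW.
Qed.

(* The Fourier coefficients of negative index vanish. *)
Definition analytic f := forall m, cint mu setT (fun z => f z * coord z ^+ m.+1) = 0.

Lemma nc_pow (z : T) n : nc (coord z ^+ n) <= 1.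
Proof. by rewrite ncX nc_circle expr1n. Qed.

Lemma cintegrable_pow f n : cintegrable mu setT f -> cintegrable mu setT (fun z => f z * coord z ^+ n).
Proof. move=> cf; apply: (cintegrable_bounded cf _ (fun z => nc_pow z n)); exact/cmeasX/cmeas_coord. Qed.

Lemma nc_powJ (z : T) n : nc ((coord z)^* ^+ n) <= 1.
Proof. by rewrite ncX ncJ nc_circle expr1n. Qed.

Lemma cintegrable_powJ f n : cintegrable mu setT f -> cintegrable mu setT (fun z => f z * (coord z)^* ^+ n).
Proof. move=> cf; apply: (cintegrable_bounded cf _ (fun z => nc_powJ z n)); exact/cmeasX/cmeasJ/cmeas_coord. Qed.

Lemma nc_circle1 (z : T) : nc (coord z) <= 1. Proof. by rewrite nc_circle. Qed.
Lemma nc_circle1J (z : T) : nc (coord z)^* <= 1. Proof. by rewrite ncJ nc_circle. Qed.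

Lemma cintegrable_geom f (b : T -> R[i]) w : cintegrable mu setT f -> cmeas setT b ->
  (forall z, nc (b z) <= 1) -> nc w < 1 -> cintegrable mu setT (fun z => f z / (1 - w * b z)).
Proof.
move=> cf mb b1 w1; apply: (@cintegrable_bounded _ _ (1 - nc w)^-1 cf).
  apply: cmeas_inv; apply: cmeasB; first exact: cmeas_cst.
  by apply: cmeasM => //; exact: cmeas_cst.
move=> z; have : 1 - nc w <= nc (1 - w * b z).
  by apply: le_trans (nc_1B_ge _); rewrite lerB// ncM ler_piMr ?nc_ge0.
by move=> h; rewrite ncV lef_pV2 ?posrE ?subr_gt0// (lt_le_trans _ h)// subr_gt0.
Qed.

Lemma poissonE f w : cintegrable mu setT f -> nc w < 1 ->
  poisson f w = cauchy f w + w^* * cint mu setT (fun z => f z * coord z / (1 - w^* * coord z)).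
Proof.
move=> cf w1.
have w1' : nc w^* < 1 by rewrite ncJ.
have cf1 : cintegrable mu setT (fun z => f z * coord z).
  by have := cintegrable_pow 1 cf; under eq_fun do rewrite expr1.
have i1 := cintegrable_geom cf (cmeasJ (cmeas_coord R)) nc_circle1J w1.
have i2 := cintegrable_geom cf1 (cmeas_coord R) nc_circle1 w1'.
rewrite -cintZ// -cintD//; last exact: cintegrableZ.
by apply: eq_cint => z _; rewrite pois_decomp// mulrDl mulrC; congr (_ + _); ring.
Qed.

(** The antianalytic half of the kernel only sees the integrals of f z^n with n >= 1, which vanish;
    the remainder estimate of [geom_cint] replaces termwise integration. *)
Lemma poisson_cauchy f w : cintegrable mu setT f -> analytic f -> nc w < 1 ->
  poisson f w = cauchy f w.
Proof.
move=> cf af w1; rewrite poissonE//.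
have w1' : nc w^* < 1 by rewrite ncJ.
have cf1 : cintegrable mu setT (fun z => f z * coord z).
  by have := cintegrable_pow 1 cf; under eq_fun do rewrite expr1.
suff -> : cint mu setT (fun z => f z * coord z / (1 - w^* * coord z)) = 0 by rewrite mulr0 addr0.
apply/eqP; rewrite -nc_eq0 eq_le nc_ge0 andbT.
apply: (@geometric_le0 _ (nc w^*) ((1 - nc w^*)^-1 * \int[mu]_z nc (f z * coord z))) => [|N].
  by rewrite nc_ge0.
have := geom_cint N.+1 cf1 (cmeas_coord R) nc_circle1 w1'.
rewrite big1 ?subr0 ?mulrA// => n _.
rewrite (_ : cint _ _ _ = 0) ?mulr0// -(af n).
by apply: eq_cint => z _; rewrite exprS mulrA.
Qed.

Lemma cint_cst (c : R[i]) : cint mu setT (fun=> c) = c.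
Proof.
rewrite /cint !Rintegral_cst//= [X in fine X]arc_measure_setT /= !mulr1.
by case: c.
Qed.

Lemma cint_coordJ_exp n : cint mu setT (fun z : T => (coord z)^* ^+ n.+1) = 0.
Proof.
rewrite -conj0 -(cint_coord_exp R n) -cintJ//; last first.
  by have := cintegrable_pow n.+1 (L2_cintegrable (L2_cst 1)); under eq_fun do rewrite mul1r.
by apply: eq_cint => z _; rewrite conjX.
Qed.

Lemma poisson1 w : nc w < 1 -> poisson (fun=> 1) w = 1.
Proof.
move=> w1; have c1 := L2_cintegrable (L2_cst (1 : R[i])).
rewrite poisson_cauchy//; last first.
  by move=> m; under eq_cint do rewrite mul1r; exact: cint_coord_exp.
apply/eqP; rewrite -subr_eq0 -nc_eq0 eq_le nc_ge0 andbT.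
apply: (@geometric_le0 _ (nc w) ((1 - nc w)^-1 * \int[mu]_z nc (1 : R[i]))) => [|N].
  by rewrite nc_ge0.
have := geom_cint N.+1 c1 (cmeasJ (cmeas_coord R)) nc_circle1J w1.
rewrite mulrA /= big_cons big1_seq ?addr0; last first.
  move=> n /= ; rewrite mem_iota => /andP[]; case: n => // n _ _.
  rewrite (_ : cint _ _ _ = 0) ?mulr0// -(cint_coordJ_exp n).
  by apply: eq_cint => z _; rewrite mul1r.
rewrite expr0 mul1r (_ : cint _ _ (fun z : T => 1 * (coord z)^* ^+ 0) = 1)//.
by rewrite -[RHS]cint_cst; apply: eq_cint => z _; rewrite expr0 mulr1.
Qed.
End poisson.

(** * Radial limits of Poisson integrals and uniqueness of Fourier coefficients *)

Section poisson_ae.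
Variable R : realType.
Local Notation leb := (@lebesgue_measure R).
Local Notation mu := (@arc_measure R).
Local Notation T := (circle R).
Implicit Types (f : T -> R[i]) (w : R[i]).
Let mT : measurable (setT : set T). Proof. exact: measurableT. Qed.
Let I01 := `[0%R : R, 1%R[%classic.

(** Write sin(2 y) = 2 sin y cos y with y = pi s / 2 and sin y = y cos k by the mean value theorem;
    both cosines are at least cos(pi (1 - d) / 2). The sine vanishes again at |s| = 1, so [d] must
    stay positive. *)
Lemma sin_lower_bound (d : R) : 0 < d < 1 ->
  exists2 c : R, 0 < c & forall s, `|s| <= 1 - d -> c * s ^+ 2 <= sin (pi * s) ^+ 2.
Proof.
move=> /andP[d0 d1]; have pi0 := @pi_gt0 R.
pose y0 : R := pi / 2 * (1 - d).
have y00 : 0 <= y0 by rewrite mulr_ge0 ?divr_ge0 ?(ltW pi0)//; lra.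
have y01 : y0 < pi / 2 by rewrite /y0 gtr_pMr ?divr_gt0//; lra.
pose c0 : R := cos y0.
have c00 : 0 < c0 by apply: cos_gt0_pihalf; rewrite y01 andbT; lra.
have cosge y : 0 <= y <= y0 -> c0 <= cos y.
  move=> /andP[h1 h2]; rewrite leNgt ltr_cos ?in_itv/=; [by rewrite -leNgt|lra|lra].
have pos s : 0 <= s <= 1 - d -> c0 ^+ 2 * pi * s <= sin (pi * s).
  move=> /andP[s0 s1]; pose y := pi / 2 * s.
  have yy0 : 0 <= y by rewrite mulr_ge0// divr_ge0// ltW.
  have yy1 : y <= y0 by rewrite ler_pM2l ?divr_gt0.
  have -> : pi * s = y *+ 2 by rewrite /y mulr2n; field.
  rewrite sin_mulr2n mulr2n.
  have [k +] := @MVT_segment _ (@sin R) cos 0 y yy0 (fun x _ => is_derive_sin x) (continuous_subspaceT (@continuous_sin R)).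
  rewrite in_itv /= sin0 !subr0 => /andP[k0 k1] ->.
  have hk : c0 <= cos k by apply: cosge; rewrite k0 (le_trans k1).
  have hy : c0 <= cos y by apply: cosge; rewrite yy0 yy1.
  have -> : c0 ^+ 2 * pi * s = c0 * c0 * y *+ 2 by rewrite /y mulr2n; field.
  have : c0 * c0 * y <= cos y * (cos k * y).
    by rewrite mulrA ler_wpM2r// ler_pM// ltW.
  by rewrite mulr2n; lra.
exists ((c0 ^+ 2 * pi) ^+ 2); first by rewrite exprn_gt0// mulr_gt0 ?exprn_gt0.
move=> s sd; rewrite -exprMn.
have := pos `|s|; rewrite normr_ge0 sd => /(_ isT).
have b0 : 0 <= c0 ^+ 2 * pi * `|s| by rewrite mulr_ge0// mulr_ge0 ?sqr_ge0 ?(ltW pi0).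
move=> h.
have -> : sin (pi * s) ^+ 2 = sin (pi * `|s|) ^+ 2.
  have [s0|s0] := leP 0 s; first by rewrite ger0_norm.
  by rewrite ltr0_norm// mulrN sinN sqrrN.
have -> : (c0 ^+ 2 * pi * s) ^+ 2 = (c0 ^+ 2 * pi * `|s|) ^+ 2.
  by rewrite !exprMn real_normK ?num_real.
by rewrite lerXn2r ?nnegrE ?(le_trans b0 h).
Qed.

Lemma kernel_denom (r x t : R) :
  nc (1 - r%:C * ei x * (ei t)^*) ^+ 2 = (1 - r) ^+ 2 + 4 * r * sin (pi * (t - x)) ^+ 2.
Proof.
rewrite -mulrA -eiN -eiD nc_sq /ei.
have -> : 2 * pi * (x - t) = - ((pi * (t - x)) *+ 2) by rewrite mulr2n; ring.
rewrite cosN sinN cos_mulr2n sin_mulr2n; have := cos2Dsin2 (pi * (t - x)).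
set C := cos _; set S := sin _ => h /=.
rewrite !mulr2n.
have -> : C ^+ 2 = 1 - S ^+ 2 by rewrite -h addrK.
have h2 : (C * S) ^+ 2 = (1 - S ^+ 2) * S ^+ 2 by rewrite exprMn -h addrK.
transitivity ((1 - r * (1 - S ^+ 2 + (1 - S ^+ 2) - 1)) ^+ 2 + 4 * r ^+ 2 * (C * S) ^+ 2); first by ring.
by rewrite h2; ring.
Qed.

(** Comparison with the half-plane kernel. Chord length and |t - x| are comparable only when |t - x|
    stays away from 1, so [A] depends on the distance of [x] to the endpoints; this is harmless for
    a statement at almost every point. The condition r >= 1/2 gives 4 r >= 2 in the denominator, and
    the 2 in [A] bounds 1 + r. *)
Lemma kernel_bound (x : R) : 0 < x < 1 -> exists2 A : R, 0 < A &
  forall r t : R, 2^-1 <= r < 1 -> 0 <= t < 1 ->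
  pois (r%:C * ei x) (ei t) <= A * ((1 - r) / ((1 - r) ^+ 2 + (t - x) ^+ 2)).
Proof.
move=> /andP[x0 x1]; pose d := Num.min x (1 - x).
have d01 : 0 < d < 1.
  by rewrite /d lt_min gt_min x0 x1 subr_gt0 x1.
have [c c0 cs] := sin_lower_bound d01.
pose m := Num.min 1 (2 * c).
have m0 : 0 < m by rewrite lt_min ltr01 mulr_gt0.
exists (2 / m); first by rewrite divr_gt0.
move=> r t /andP[r0 r1] /andP[t0 t1].
have rr : nc (r%:C * ei x) = r.
  by rewrite ncM nc_real nc_ei mulr1 ger0_norm//; apply: le_trans r0; rewrite invr_ge0.
rewrite /pois rr kernel_denom.
have td : `|t - x| <= 1 - d.
  rewrite ler_norml; apply/andP; split; rewrite /d.
    have : Num.min x (1 - x) <= 1 - x by rewrite ge_min lexx orbT.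
    lra.
  have : Num.min x (1 - x) <= x by rewrite ge_min lexx.
  lra.
have := cs _ td; set S := sin _ ^+ 2; set u := (t - x) ^+ 2 => hS.
have u0 : 0 <= u by rewrite sqr_ge0.
have S0 : 0 <= S by rewrite sqr_ge0.
have e1 : 0 < (1 - r) ^+ 2 by rewrite exprn_gt0// subr_gt0.
have m1 : m <= 1 by rewrite ge_min lexx.
have m2 : m <= 2 * c by rewrite ge_min lexx orbT.
have D1 : m * ((1 - r) ^+ 2 + u) <= (1 - r) ^+ 2 + 4 * r * S.
  have k1 : m * (1 - r) ^+ 2 <= 1 * (1 - r) ^+ 2 by rewrite ler_wpM2r// ltW.
  have k2 : m * u <= 2 * c * u by rewrite ler_wpM2r.
  have k3 : 2 * S <= 4 * r * S by rewrite ler_wpM2r//; lra.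
  rewrite mulrDr; lra.
have D0 : 0 < (1 - r) ^+ 2 + u by rewrite ltr_pwDl.
rewrite ler_pdivrMr; last by rewrite (lt_le_trans _ D1)// mulr_gt0.
have -> : 1 - r ^+ 2 = (1 - r) * (1 + r) by ring.
set D := _ + u in D1 D0 *; set E := _ + _ * S in D1 *.
have -> : 2 / m * ((1 - r) / D) * E = (1 - r) * (2 * (E / (m * D))) by field; rewrite !gt_eqF.
rewrite ler_pM2l ?subr_gt0//.
have : 1 <= E / (m * D) by rewrite ler_pdivlMr ?mulr_gt0// mul1r.
lra.
Qed.

(** A ball of radius s has length 2 s, so a mean below e / 2 gives an integral of at most e s. *)
Lemma lebesgue_pt_small (v : R -> R) (x e : R) : lebesgue_pt v x -> 0 < e ->
  exists2 h, 0 < h & forall s, 0 < s <= h ->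
  (\int[leb]_(t in ball x s) `|v t - v x|%:E <= (e * s)%:E)%E.
Proof.
move=> vx e0.
have : \forall r \near (0 : R)^'+, (davg v x r < (e / 2)%:E)%E.
  move/fine_cvgP: vx => [fin /cvgrPdist_lt cv].
  have e20 : 0 < e / 2 by rewrite divr_gt0.
  near=> r; have fr : davg v x r \is a fin_num by near: r.
  rewrite -(fineK fr) lte_fin (le_lt_trans (ler_norm _))// -normrN -sub0r.
  by near: r; exact: cv.
move=> [h /= h0 hP]; exists (h / 2); first by rewrite divr_gt0.
move=> s /andP[s0 sh]; have : (davg v x s < (e / 2)%:E)%E.
  by apply: hP => //=; rewrite sub0r normrN gtr0_norm//; lra.
rewrite /davg /iavg (lebesgue_measure_ball _ (ltW s0)) inver.
rewrite mulrn_eq0/= gt_eqF// => hd.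
have -> : (e * s)%:E = ((s *+ 2)%:E * (e / 2)%:E)%E by rewrite -EFinM mulr2n; congr _%:E; field.
rewrite -lee_pdivrMl ?mulrn_wgt0//; exact: ltW.
Unshelve. all: by end_near. Qed.
Lemma integrable_arc_restrict (u : T -> R) : mu.-integrable setT (EFin \o u) ->
  locally_integrable setT ((fun t => u (expi2pi t)) \_ I01).
Proof.
move=> /integrableP[mu_ iu]; apply: open_integrable_locally; first exact: openT.
have mue : measurable_fun setT (fun t : R => u (expi2pi t)).
  have /measurable_EFinP mu' := mu_.
  exact: (measurableT_comp mu' (@measurable_expi2pi R)).
have -> : EFin \o ((fun t => u (expi2pi t)) \_ I01) = (fun t => (u (expi2pi t))%:E) \_ I01.
  by rewrite restrict_EFin.
apply/(integrable_mkcond _ _).1; first exact: measurable_itv.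
apply/integrableP; split; first by apply/measurable_EFinP; exact: measurable_funTS.
move: iu; rewrite ge0_arc_integral//; exact: measurableT_comp.
Qed.

(** Fatou's theorem. The kernel has integral 1, so the error is the average of f - f(z) against it,
    and [approximate_identity_bound] controls this at a common Lebesgue point of the real and
    imaginary parts. The bound [d0 <= 2^-1] keeps [r] in the range of [kernel_bound]. *)
Lemma poisson_ae f : cintegrable mu setT f ->
  {ae mu, forall z, forall e : R, 0 < e -> exists2 d0 : R, 0 < d0 <= 2^-1 & forall r : R,
     1 - d0 < r < 1 -> nc (poisson f (r%:C * coord z) - f z) < e}.
Proof.
move=> cf; have [ifr ifi] := cf.
apply: ae_arc.
have Lr := lebesgue_differentiation (integrable_arc_restrict ifr).
have Li := lebesgue_differentiation (integrable_arc_restrict ifi).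
move: Lr Li; set vr := _ \_ I01; set vi := _ \_ I01 => Lr Li.
suff key : forall x : R, lebesgue_pt vr x -> lebesgue_pt vi x -> 0 < x < 1 -> forall e : R, 0 < e ->
    exists2 d0 : R, 0 < d0 <= 2^-1 & forall r : R,
     1 - d0 < r < 1 -> nc (poisson f (r%:C * coord (expi2pi x)) - f (expi2pi x)) < e.
  by apply: (@filterS2 _ _ (ae_filter_ringOfSetsType leb) _ _ _ _ Lr Li) => x; exact: key.
move=> x {}Lr {}Li x01 e e0.
have [A A0 AP] := kernel_bound x01.
(* The near part will be A * 5 * (2 * e1) = e / 2, the factor 2 coming from the real and imaginary
   parts. *)
pose e1 := e / (20 * A).
have e10 : 0 < e1 by rewrite divr_gt0// mulr_gt0.
have [h1 h10 h1P] := lebesgue_pt_small Lr e10.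
have [h2 h20 h2P] := lebesgue_pt_small Li e10.
pose h := Num.min h1 h2.
have h0 : 0 < h by rewrite lt_min h10.
have hh1 : h <= h1 by rewrite ge_min lexx.
have hh2 : h <= h2 by rewrite ge_min lexx orbT.
clearbody h.
have mvr : measurable_fun setT vr by have [] := integrable_arc_restrict ifr.
have mvi : measurable_fun setT vi by have [] := integrable_arc_restrict ifi.
pose phi t := `|vr t - vr x| + `|vi t - vi x|.
have mp1 : measurable_fun setT (fun t => `|vr t - vr x|).
  by apply: measurableT_comp => //; apply: measurable_funB => //; exact: measurable_cst.
have mp2 : measurable_fun setT (fun t => `|vi t - vi x|).
  by apply: measurableT_comp => //; apply: measurable_funB => //; exact: measurable_cst.
have mphi : measurable_fun setT phi by exact: measurable_funD.
have phi0 t : 0 <= phi t by rewrite addr_ge0.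
have small s : 0 < s <= h -> (\int[leb]_(t in ball x s) (phi t)%:E <= (2 * e1 * s)%:E)%E.
  move=> /andP[s0 sh].
  under eq_integral do rewrite EFinD.
  rewrite ge0_integralD//; last 3 first.
  - exact: measurable_ball.
  - exact/measurable_EFinP/measurable_funTS.
  - exact/measurable_EFinP/measurable_funTS.
  have -> : (2 * e1 * s)%:E = ((e1 * s)%:E + (e1 * s)%:E)%E by rewrite -EFinD; congr _%:E; ring.
  apply: leeD; first by apply: h1P; rewrite s0 (le_trans sh).
  by apply: h2P; rewrite s0 (le_trans sh).
have mI : measurable I01 by exact: measurable_itv.
set z := expi2pi x.
have Ix : I01 x by rewrite /I01 /= in_itv /=; case/andP: x01 => /ltW -> ->.
pose g y := f y - f z.
have cg : cintegrable mu setT g.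
  by apply: cintegrableB => //; exact: L2_cintegrable (L2_cst _).
have mg := cintegrable_meas cg.
have phiE t : I01 t -> phi t = `|complex.Re (g (expi2pi t))| + `|complex.Im (g (expi2pi t))|.
  by move=> It; rewrite /phi /vr /vi !patchE !mem_set// ReD ImD ReN ImN.
have [C C0 iphi] : exists2 C : R, 0 <= C & (\int[leb]_(t in I01) (phi t)%:E = C%:E)%E.
  pose psi y := `|complex.Re (g y)| + `|complex.Im (g y)|.
  have ipsi : mu.-integrable setT (EFin \o psi).
    by case: cg => g1 g2; apply: arc_integrableD; [exact: (integrable_norm g1)|exact: (integrable_norm g2)].
  have psi0 y : 0 <= psi y by rewrite addr_ge0.
  exists (\int[mu]_y psi y); first by apply: Rintegral_ge0.
  rewrite /Rintegral fineK; last exact: integrable_fin_num.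
  rewrite ge0_arc_integral//; last first.
    exact: measurable_int ipsi.
  by apply: eq_integral => t; rewrite inE => It; rewrite phiE.
(* The far part is at most [K * d], hence below e / 4 once d < e / (4 K); the summand 1 keeps [K]
   positive. *)
pose K := 1 + A * 4 * C / h ^+ 2.
have K0 : 0 < K.
  by rewrite ltr_pwDl// divr_ge0 ?sqr_ge0// mulr_ge0// mulr_ge0// ltW.
exists (Num.min (2^-1) (Num.min h (e / (4 * K)))).
  by rewrite ge_min lexx !lt_min invr_gt0 h0 ?ltr0n ?divr_gt0 ?mulr_gt0.
move=> r /andP[r0 r1].
pose d := 1 - r.
have d0 : 0 < d by rewrite subr_gt0.
have : d < Num.min (2^-1) (Num.min h (e / (4 * K))) by rewrite /d; move: r0; clear; lra.
rewrite !lt_min => /and3P[d2 dh dK].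
have w1 : nc (r%:C * coord z) < 1.
  have r00 : 0 <= r by move: d2; rewrite /d; clear; lra.
  by rewrite ncM nc_circle mulr1 nc_real ger0_norm.
have mpo : cmeas setT (fun y : T => (pois (r%:C * coord z) (coord y))%:C).
  split; last exact: measurable_cst.
  rewrite /= /pois; under eq_fun do rewrite -powR_inv1 ?sqr_ge0//.
  apply: measurable_funM; first exact: measurable_cst.
  apply: (measurableT_comp (measurable_powR _)).
  apply: measurable_funX; apply: measurable_nc; first exact: measurableT.
  apply: cmeasB; first exact: cmeas_cst.
  by apply: cmeasM; [exact: cmeas_cst|exact/cmeasJ/cmeas_coord].
have po0 (y : T) : 0 <= pois (r%:C * coord z) (coord y) by exact: pois_ge0.
have bpo (y : T) : nc (pois (r%:C * coord z) (coord y))%:C <= (1 - nc (r%:C * coord z))^-1 ^+ 2.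
  by rewrite nc_real ger0_norm// pois_le.
have ipf k : cintegrable mu setT k -> cintegrable mu setT (fun y : T => (pois (r%:C * coord z) (coord y))%:C * k y).
  move=> ck; apply: eq_cintegrable (cintegrable_bounded ck mpo bpo) => // y _.
  by rewrite mulrC.
have -> : poisson f (r%:C * coord z) - f z = cint mu setT (fun y => (pois (r%:C * coord z) (coord y))%:C * g y).
  have -> : f z = cint mu setT (fun y => f z * ((pois (r%:C * coord z) (coord y))%:C * 1)).
    rewrite cintZ//; last exact/ipf/L2_cintegrable/L2_cst.
    by rewrite [cint _ _ _]poisson1// mulr1.
  rewrite -cintB//; last 2 first.
  - exact: ipf.
  - by apply: cintegrableZ => //; exact/ipf/L2_cintegrable/L2_cst.
  by apply: eq_cint => y _; rewrite /g; ring.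
apply: (le_lt_trans (nc_cint_le _ (ipf _ cg))) => //.
have ing := integrable_nc measurableT (ipf _ cg).
rewrite -lte_fin /Rintegral fineK; last exact: integrable_fin_num.
rewrite ge0_arc_integral; last 2 first.
- exact: measurable_int ing.
- by move=> y; rewrite lee_fin nc_ge0.
have r2 : 2^-1 <= r < 1 by rewrite r1 andbT; move: d2; rewrite /d; clear; lra.
pose k (t : R) : R := d / (d ^+ 2 + (t - x) ^+ 2).
have mk : measurable_fun setT k.
  apply: continuous_measurable_fun => t; apply: cvgM; first exact: cvg_cst.
  apply: cvgV; first by rewrite gt_eqF// ltr_pwDl ?sqr_ge0// exprn_gt0.
  apply: cvgD; first exact: cvg_cst.
  by apply: cvgM; (apply: cvgB; [exact: cvg_id|exact: cvg_cst]).
have k0 t : 0 <= k t.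
  by apply: divr_ge0; [exact: ltW|rewrite addr_ge0 ?sqr_ge0].
have mkp : measurable_fun setT (fun t => (k t * phi t)%:E).
  by apply/measurable_EFinP/measurable_funM.
apply: (@le_lt_trans _ _ (\int[leb]_(t in I01) (A%:E * (k t * phi t)%:E))%E).
  apply: ge0_le_integral => //.
  - by move=> t _; rewrite lee_fin nc_ge0.
  - have /measurable_int/measurable_EFinP mm := ing.
    apply/measurable_EFinP/measurable_funTS.
    exact: (measurableT_comp mm (@measurable_expi2pi R)).
  - apply: measurable_funTS; under eq_fun do rewrite -EFinM.
    by apply/measurable_EFinP/measurable_funM => //; exact/measurable_EFinP.
  - move=> t It /=; rewrite -EFinM lee_fin ncM nc_real ger0_norm; last exact: (po0 (expi2pi t)).
    rewrite (_ : A * (k t * phi t) = A * k t * phi t); last exact: mulrA.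
    have t01 : 0 <= t < 1 by move: It; rewrite /I01 /= in_itv.
    apply: ler_pM; [exact: (po0 (expi2pi t))|exact: nc_ge0|exact: AP|].
    by rewrite phiE//; exact: nc_le.
rewrite ge0_integralZl//; last 3 first.
- exact: measurable_funTS.
- by move=> t _; rewrite lee_fin mulr_ge0.
- by rewrite lee_fin ltW.
have := approximate_identity_bound mphi phi0 d0 (ltW dh) (mulr_ge0 (ler0n _ 2) (ltW e10)) small mI.
move=> bnd.
have A0' : (0 <= A%:E)%E by rewrite lee_fin ltW.
apply: le_lt_trans (lee_wpmul2l A0' bnd) _.
rewrite iphi -EFinM lte_fin /e1.
have -> : A * (5 * (2 * (e / (20 * A))) + 4 * d / h ^+ 2 * C) = e / 2 + A * 4 * C / h ^+ 2 * d.
  by field; rewrite !gt_eqF.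
have : A * 4 * C / h ^+ 2 * d <= K * d by rewrite ler_wpM2r ?(ltW d0)// /K lerDr.
move: dK; rewrite ltr_pdivlMr ?mulr_gt0// => dK.
have : K * d = d * (4 * K) / 4 by field.
move: e0 dK; clear; lra.
Qed.

(* The Poisson integral of f vanishes identically, and converges to f almost everywhere. *)
Lemma fourier_unique f : cintegrable mu setT f ->
  (forall n, cint mu setT (fun z => f z * coord z ^+ n) = 0) ->
  (forall n, cint mu setT (fun z => f z * (coord z)^* ^+ n) = 0) ->
  {ae mu, forall z, f z = 0}.
Proof.
move=> cf f1 f2.
have p0 w : nc w < 1 -> poisson f w = 0.
  move=> w1; rewrite poisson_cauchy//.
  apply/eqP; rewrite -nc_eq0 eq_le nc_ge0 andbT.
  apply: (@geometric_le0 _ _ (nc w) ((1 - nc w)^-1 * \int[mu]_z nc (f z))) => [|N].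
    by rewrite nc_ge0.
  have := geom_cint N.+1 cf (cmeasJ (cmeas_coord R)) (@nc_circle1J R) w1.
  by rewrite big1 ?subr0 ?mulrA// => n _; rewrite f2 mulr0.
apply: (@filterS _ _ (ae_filter_ringOfSetsType mu) _ _ _ (poisson_ae cf)) => z hz.
apply/eqP; rewrite -nc_eq0 eq_le nc_ge0 andbT; apply/ler_addgt0Pl => e e0.
have [d0 /andP[d00 d02] dP] := hz e e0.
have := dP (1 - d0 / 2); rewrite p0 ?sub0r ?ncN; last first.
  by rewrite ncM nc_circle nc_real mulr1 ger0_norm; move: d00 d02; clear; lra.
by rewrite addr0 => /(_ _)/ltW; apply; apply/andP; split; move: d00 d02; clear; lra.
Qed.
End poisson_ae.

(** * Cauchy's theorem *)

Section goursat.
Variable R : realType.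
Local Notation leb := (@lebesgue_measure R).
Implicit Types (F : R -> R[i]) (G : R[i] -> R[i]).

Definition ccat F t := {for t, continuous (fun s => complex.Re (F s))} /\
  {for t, continuous (fun s => complex.Im (F s))}.

Definition cont_at G w := forall e : R, 0 < e -> exists2 d : R, 0 < d &
  forall u, nc (u - w) < d -> nc (G u - G w) < e.

Definition disc_cont G := forall w, nc w < 1 -> cont_at G w.

Lemma ccatM F1 F2 t : ccat F1 t -> ccat F2 t -> ccat (fun s => F1 s * F2 s) t.
Proof.
move=> [f1 f2] [g1 g2]; split; rewrite /prop_for/=.
  rewrite /continuous_at ReM; under eq_cvg do rewrite ReM.
  by apply: cvgB; apply: cvgM; [exact: f1|exact: g1|exact: f2|exact: g2].
rewrite /continuous_at ImM; under eq_cvg do rewrite ImM.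
by apply: cvgD; apply: cvgM; [exact: f1|exact: g2|exact: f2|exact: g1].
Qed.

Lemma ccont_ccat F t : ccont F -> ccat F t.
Proof. by move=> [h1 h2]; split; [exact: h1|exact: h2]. Qed.

Lemma ccat_comp G F t : cont_at G (F t) -> ccat F t -> ccat (fun s => G (F s)) t.
Proof.
move=> cG [f1 f2].
have key (e : R) : 0 < e -> \forall s \near t, nc (G (F s) - G (F t)) < e.
  move=> /cG[d d0 dP]; have d20 : 0 < d / 2 by rewrite divr_gt0.
  move: f1 f2 => /cvgrPdist_lt/(_ _ d20) f1 /cvgrPdist_lt/(_ _ d20) f2.
  near=> s; apply: dP; rewrite ncBC.
  apply: (le_lt_trans (nc_le _)); rewrite ReD ImD ReN ImN [ltRHS]splitr.
  by apply: ltrD; near: s.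
split; apply/cvgrPdist_lt => e /key; apply: filterS => s; apply: le_lt_trans; rewrite ncBC.
  by rewrite -ReN -ReD Re_le.
by rewrite -ImN -ImD Im_le.
Unshelve. all: by end_near. Qed.

Lemma ccat_int F a b : (forall s, a <= s <= b -> ccat F s) -> cintegrable leb `[a, b] F.
Proof.
move=> h; split; apply: continuous_compact_integrable; try exact: segment_compact.
  by apply: continuous_in_subspaceT => s; rewrite inE /= in_itv /= => /h[].
by apply: continuous_in_subspaceT => s; rewrite inE /= in_itv /= => /h[].
Qed.

Lemma cint_split F a m b : a <= m <= b -> cintegrable leb `[a, b] F ->
  cint leb `[a, b] F = cint leb `[a, m] F + cint leb `[m, b] F.
Proof.
have key (u : R -> R) : a <= m <= b -> leb.-integrable `[a, b] (EFin \o u) ->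
    \int[leb]_(x in `[a, b]) u x = \int[leb]_(x in `[a, m]) u x + \int[leb]_(x in `[m, b]) u x.
  move=> /andP[am mb] iu.
  rewrite -[X in _ + X]Rintegral_itv_obnd_cbnd; last first.
    by apply: integrableS iu => //; apply: subset_itvr; rewrite bnd_simp.
  have := Rintegral_itvB iu; move=> <-.
  - by rewrite addrC subrK.
  - by rewrite bnd_simp.
  - by rewrite bnd_simp.
by move=> amb [i1 i2]; rewrite /cint (key _ amb i1) (key _ amb i2).
Qed.

Definition dei (t : R) : R[i] := (2 * pi)%:C * 'i * ei t.
Definition radial_edge G a b t := cint leb `[a, b] (fun s => G (s%:C * ei t) * ei t).
Definition arc_edge G c d s := cint leb `[c, d] (fun t => G (s%:C * ei t) * (s%:C * dei t)).
(** The contour integral, counterclockwise, around the sector of radii a to b and angles c to d,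
    angles being measured in turns. In polar coordinates a full circle is the boundary of a
    rectangle, so no separate homotopy argument is needed. *)
Definition rect G a b c d := radial_edge G a b c + arc_edge G c d b - radial_edge G a b d - arc_edge G c d a.

Lemma nc_polar (s t : R) : 0 <= s -> nc (s%:C * ei t) = s.
Proof. by move=> s0; rewrite ncM nc_real nc_ei mulr1 ger0_norm. Qed.

Lemma ccont_dei : ccont dei.
Proof. by apply: ccontM; [exact: ccont_cst|exact: ccont_ei]. Qed.
Lemma ccont_real : ccont (fun s : R => s%:C).
Proof. by apply: cder_cont => t; exists 1; exact: cder_real. Qed.

Lemma radial_edge_integrable G a b t : disc_cont G -> 0 <= a -> b < 1 ->
  cintegrable leb `[a, b] (fun s => G (s%:C * ei t) * ei t).
Proof.
move=> cG a0 b1; apply: ccat_int => s /andP[as_ sb].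
apply: ccatM; last exact/ccont_ccat/ccont_cst.
apply: ccat_comp.
  by apply: cG; rewrite nc_polar ?(le_trans a0)// (le_lt_trans sb).
by apply/ccont_ccat/ccontM; [exact: ccont_real|exact: ccont_cst].
Qed.

Lemma arc_edge_integrable G c d s : disc_cont G -> 0 <= s < 1 ->
  cintegrable leb `[c, d] (fun t => G (s%:C * ei t) * (s%:C * dei t)).
Proof.
move=> cG /andP[s0 s1]; apply: ccat_int => t _.
apply: ccatM; last by apply/ccont_ccat/ccontM; [exact: ccont_cst|exact: ccont_dei].
apply: ccat_comp; first by apply: cG; rewrite nc_polar.
by apply/ccont_ccat/ccontM; [exact: ccont_cst|exact: ccont_ei].
Qed.

Lemma rect_splits G a m b c d : disc_cont G -> 0 <= a <= m -> m <= b < 1 ->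
  rect G a b c d = rect G a m c d + rect G m b c d.
Proof.
move=> cG /andP[a0 am] /andP[mb b1]; rewrite /rect /radial_edge.
by rewrite !(@cint_split _ a m b) ?am//; try exact: radial_edge_integrable; ring.
Qed.

Lemma rect_splitt G a b c m d : disc_cont G -> 0 <= a < 1 -> 0 <= b < 1 -> c <= m <= d ->
  rect G a b c d = rect G a b c m + rect G a b m d.
Proof.
move=> cG a1 b1 cmd; rewrite /rect /arc_edge.
by rewrite !(@cint_split _ c m d) ?am//; try exact: arc_edge_integrable; ring.
Qed.

(* [u |-> g (u - w) + l (u - w)^2 / 2] is a primitive along all four edges. *)
Lemma rect_affine (w g l : R[i]) a b c d : a <= b -> c <= d ->
  rect (fun u => g + l * (u - w)) a b c d = 0.
Proof.
move=> ab cd.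
pose P (u : R[i]) : R[i] := g * (u - w) + 2^-1 * l * (u - w) ^+ 2.
have dP (F : R -> R[i]) t k : cder F t k -> cder (fun s => P (F s)) t ((g + l * (F t - w)) * k).
  move=> dF; have dFw := cderD dF (cder_cst (- w) t).
  apply: eq_cder (cderD (cderZ g dFw) (cderZ (2^-1 * l) (cderX 2 dFw))) _.
  by rewrite /= expr1; field.
have contF (F f : R -> R[i]) : ccont F -> ccont f -> ccont (fun t => (g + l * (F t - w)) * f t).
  move=> cF cf; apply: ccontM => //; apply: ccontD; first exact: ccont_cst.
  by apply: ccontM; [exact: ccont_cst|apply: ccontD => //; exact: ccont_cst].
have EX t : radial_edge (fun u => g + l * (u - w)) a b t = P (b%:C * ei t) - P (a%:C * ei t).
  apply: (@cint_FTC _ (fun s => P (s%:C * ei t))) => //.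
    move=> s; apply: dP; apply: eq_cder (cderM (cder_real s) (cder_cst (ei t) s)) _.
    by rewrite mul1r mulr0 addr0.
  apply: contF; last exact: ccont_cst.
  by apply: ccontM; [exact: ccont_real|exact: ccont_cst].
have EY s : arc_edge (fun u => g + l * (u - w)) c d s = P (s%:C * ei d) - P (s%:C * ei c).
  apply: (@cint_FTC _ (fun t => P (s%:C * ei t))) => //.
    by move=> t; apply: dP; exact: cderZ (cder_ei t).
  apply: contF; first by apply: ccontM; [exact: ccont_cst|exact: ccont_ei].
  by apply: ccontM; [exact: ccont_cst|exact: ccont_dei].
by rewrite /rect !EX !EY; ring.
Qed.

Lemma rectB G1 G2 a b c d : disc_cont G1 -> disc_cont G2 -> 0 <= a <= b -> b < 1 ->
  rect (fun u => G1 u - G2 u) a b c d = rect G1 a b c d - rect G2 a b c d.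
Proof.
move=> c1 c2 /andP[a0 ab] b1.
have b01 : 0 <= b < 1 by rewrite b1 (le_trans a0).
have a01 : 0 <= a < 1 by rewrite a0 (le_lt_trans ab).
have EX t : radial_edge (fun u => G1 u - G2 u) a b t = radial_edge G1 a b t - radial_edge G2 a b t.
  by rewrite /radial_edge -cintB//; [apply: eq_cint => s _; rewrite mulrBl|exact: radial_edge_integrable|exact: radial_edge_integrable].
have EY s : 0 <= s < 1 -> arc_edge (fun u => G1 u - G2 u) c d s = arc_edge G1 c d s - arc_edge G2 c d s.
  by move=> s1; rewrite /arc_edge -cintB//; [apply: eq_cint => t _; rewrite mulrBl|exact: arc_edge_integrable|exact: arc_edge_integrable].
by rewrite /rect !EX !EY//; ring.
Qed.

Lemma nc_cint_itv F a b (C : R) : a <= b -> cintegrable leb `[a, b] F ->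
  (forall s, a <= s <= b -> nc (F s) <= C) -> nc (cint leb `[a, b] F) <= C * (b - a).
Proof.
move=> ab iF FC; apply: le_trans (nc_cint_le _ iF) _ => //.
have -> : C * (b - a) = \int[leb]_(x in `[a, b]) C.
  rewrite Rintegral_cst//= lebesgue_measure_itv/= lte_fin; congr (_ * _).
  by move: ab; rewrite le_eqVlt => /predU1P[->|->]; rewrite ?ltxx ?subrr.
apply: le_Rintegral => //.
- exact: integrable_nc.
- by have [] := ccont_int a b (ccont_cst C%:C).
Qed.

(** Each component contributes 8, by the mean value theorem and the crude bound 2 pi < 8. *)
Lemma ei_lipschitz (s t : R) : nc (ei s - ei t) <= 16 * `|s - t|.
Proof.
have pi4 : pi < 4 :> R by have := @pihalf_lt2 R; lra.
have pi0 := @pi_gt0 R.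
wlog st : s t / t <= s.
  by move=> h; have [/h//|/ltW/h] := leP t s; rewrite ncBC distrC.
have key (f df : R -> R) : (forall x : R, is_derive x 1 f (df x)) -> continuous f -> (forall x, `|df x| <= 1) ->
    `|f (2 * pi * s) - f (2 * pi * t)| <= 8 * (s - t).
  move=> df1 cf dfb.
  have tt : 2 * pi * t <= 2 * pi * s by rewrite ler_pM2l// mulr_gt0.
  have [k _ ->] := @MVT_segment _ f df _ _ tt (fun x _ => df1 x) (continuous_subspaceT cf).
  rewrite normrM -mulrBr [X in _ * X]ger0_norm; last by rewrite mulr_ge0 ?subr_ge0// mulr_ge0// ltW.
  apply: (@le_trans _ _ (1 * (2 * pi * (s - t)))).
    by rewrite ler_wpM2r ?dfb// mulr_ge0 ?subr_ge0// mulr_ge0// ltW.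
  by rewrite mul1r ler_wpM2r ?subr_ge0//; lra.
rewrite (ger0_norm (_ : 0 <= s - t)) ?subr_ge0//.
apply: (le_trans (nc_le _)); rewrite ReD ImD ReN ImN.
have k1 : `|cos (2 * pi * s) - cos (2 * pi * t)| <= 8 * (s - t).
  apply: (key (@cos R) (fun x => - sin x)) => [|x]; [exact: continuous_cos|].
  by rewrite normrN sin_max.
have k2 : `|sin (2 * pi * s) - sin (2 * pi * t)| <= 8 * (s - t).
  by apply: (key (@sin R) (@cos R)) => [|x]; [exact: continuous_sin|exact: cos_max].
rewrite /=; lra.
Qed.
End goursat.

(** * Goursat's theorem by bisection *)

Section goursat_theorem.
Variable R : realType.
Local Notation leb := (@lebesgue_measure R).
Local Notation mu := (@arc_measure R).
Implicit Types (F : R -> R[i]) (G : R[i] -> R[i]).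

Definition diff_at G w := exists l : R[i], forall e : R, 0 < e -> exists2 d : R, 0 < d &
  forall u, nc (u - w) < d -> nc (G u - (G w + l * (u - w))) <= e * nc (u - w).
Definition holo G := forall w, nc w < 1 -> diff_at G w.

Lemma diff_cont G w : diff_at G w -> cont_at G w.
Proof.
move=> [l lP] e e0; have [d d0 dP] := lP 1 ltr01.
pose L := nc l + 1; have L0 : 0 < L by rewrite ltr_wpDl ?nc_ge0.
exists (Num.min d (e / L)); first by rewrite lt_min d0 divr_gt0.
move=> u; rewrite lt_min => /andP[u1 u2].
have := dP u u1; rewrite mul1r => h.
have -> : G u - G w = (G u - (G w + l * (u - w))) + l * (u - w) by ring.
apply: (le_lt_trans (ncD _ _)); rewrite ncM.
move: u2; rewrite ltr_pdivlMr// /L => u2.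
have : nc l * nc (u - w) = nc (u - w) * nc l by rewrite mulrC.
lra.
Qed.

Lemma holo_cont G : holo G -> disc_cont G.
Proof. by move=> hG w w1; exact/diff_cont/hG. Qed.

Notation quad := (R * R * R * R)%type.
Definition qrect G (q : quad) := let: (a, b, c, d) := q in rect G a b c d.
Definition qvalid (q : quad) := let: (a, b, c, d) := q in [/\ 0 <= a <= b, b < 1 & c <= d].
Definition qhalf (q q' : quad) := let: (a, b, c, d) := q in let: (a', b', c', d') := q' in
  [/\ a <= a', b' <= b, c <= c', d' <= d & (b' - a' = (b - a) / 2) /\ (d' - c' = (d - c) / 2)].

Lemma bisection_step G q : disc_cont G -> qvalid q ->
  exists q', [/\ qvalid q', qhalf q q' & nc (qrect G q) <= 4 * nc (qrect G q')].
Proof.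
have quarter (x x1 x2 x3 x4 : R) : x <= x1 + x2 + (x3 + x4) ->
  4 * x1 < x -> 4 * x2 < x -> 4 * x3 < x -> x <= 4 * x4 by clear; lra.
move: q => [[[a b] c] d] cG [/andP[a0 ab] b1 cd].
pose m := (a + b) / 2; pose k := (c + d) / 2.
have am : a <= m by rewrite /m; lra.
have mb : m <= b by rewrite /m; lra.
have ck : c <= k by rewrite /k; lra.
have kd : k <= d by rewrite /k; lra.
have hm : m - a = (b - a) / 2 by rewrite /m; lra.
have hm' : b - m = (b - a) / 2 by rewrite /m; lra.
have hk : k - c = (d - c) / 2 by rewrite /k; lra.
have hk' : d - k = (d - c) / 2 by rewrite /k; lra.
have m1 : m < 1 by exact: le_lt_trans mb b1.
have m0 : 0 <= m by exact: le_trans am.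
have a1 : a < 1 by exact: le_lt_trans ab b1.
have b0 : 0 <= b by exact: le_trans ab.
have e : rect G a b c d = rect G a m c k + rect G a m k d + (rect G m b c k + rect G m b k d).
  rewrite (@rect_splits _ _ _ m)// ?a0 ?mb ?b1//.
  by congr (_ + _); apply: rect_splitt => //; apply/andP; split.
have h : nc (rect G a b c d) <= nc (rect G a m c k) + nc (rect G a m k d) + (nc (rect G m b c k) + nc (rect G m b k d)).
  by rewrite e; apply: (le_trans (ncD _ _)); apply: lerD; exact: ncD.
have [q1|q1] := leP (nc (rect G a b c d)) (4 * nc (rect G a m c k)).
  by exists (a, m, c, k); split => //=; split => //; rewrite ?a0.
have [q2|q2] := leP (nc (rect G a b c d)) (4 * nc (rect G a m k d)).
  by exists (a, m, k, d); split => //=; split => //; rewrite ?a0.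
have [q3|q3] := leP (nc (rect G a b c d)) (4 * nc (rect G m b c k)).
  by exists (m, b, c, k); split => //=; split => //; rewrite ?m0.
exists (m, b, k, d); split; [by split => //; rewrite m0|by split|].
exact: quarter h q1 q2 q3.
Qed.

(* Bisection in the polar coordinates (s, t). *)
Lemma goursat G a b : holo G -> 0 <= a <= b -> b < 1 -> rect G a b 0 1 = 0.
Proof.
move=> hG ab b1; have cG := holo_cont hG.
(* Validity is placed under the existential so that the relation is total and [choice] yields a
   function that can be iterated. *)
have stepP q : exists q', qvalid q -> [/\ qvalid q', qhalf q q' & nc (qrect G q) <= 4 * nc (qrect G q')].
  have [vq|vq] := pselect (qvalid q); last by exists q.
  by have [q' h] := bisection_step cG vq; exists q'.
have [step sP] := choice stepP.
pose Q n := iter n step (a, b, 0, 1).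
have vQ n : qvalid (Q n).
  by elim: n => [|n /sP[]//]; split.
pose qa (q : quad) := q.1.1.1; pose qb (q : quad) := q.1.1.2; pose qc (q : quad) := q.1.2; pose qd (q : quad) := q.2.
have half n : [/\ qa (Q n) <= qa (Q n.+1), qb (Q n.+1) <= qb (Q n), qc (Q n) <= qc (Q n.+1), qd (Q n.+1) <= qd (Q n) &
   (qb (Q n.+1) - qa (Q n.+1) = (qb (Q n) - qa (Q n)) / 2) /\ (qd (Q n.+1) - qc (Q n.+1) = (qd (Q n) - qc (Q n)) / 2)].
  have [_ + _] := sP _ (vQ n); rewrite -[step (Q n)]/(Q n.+1).
  by case: (Q n) (Q n.+1) => [[[? ?] ?] ?] [[[? ?] ?] ?].
have val n : [/\ 0 <= qa (Q n) <= qb (Q n), qb (Q n) < 1 & qc (Q n) <= qd (Q n)].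
  by have := vQ n; case: (Q n) => [[[? ?] ?] ?].
have size n : qb (Q n) - qa (Q n) = (b - a) * 2^-1 ^+ n /\ qd (Q n) - qc (Q n) = 2^-1 ^+ n.
  elim: n => [|n [ih1 ih2]]; first by rewrite /qb /qa /qd /qc /= expr0 mulr1 subr0.
  by have [_ _ _ _ [-> ->]] := half n; rewrite ih1 ih2 exprS; split; field.
have big n : nc (rect G a b 0 1) <= 4 ^+ n * nc (qrect G (Q n)).
  elim: n => [|n ih]; first by rewrite expr0 mul1r.
  apply: (le_trans ih); rewrite exprSr -mulrA ler_pM2l ?exprn_gt0//.
  by have [] := sP _ (vQ n).
have nest (l u : nat -> R) : (forall n, l n <= l n.+1) -> (forall n, u n.+1 <= u n) ->
    (forall n, l n <= u n) -> exists x, forall n, l n <= x <= u n.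
  move=> hl hu lu.
  have ml : {homo l : m n / (m <= n)%N >-> m <= n} by apply: homo_leq => //; exact: le_trans.
  have mu_ : {homo u : m n / (m <= n)%N >-> n <= m}.
    by apply: (homo_leq (r := fun x y => y <= x)) => // x y z h1 h2; exact: le_trans h2 h1.
  have lun m n : l m <= u n.
    apply: (le_trans (ml _ _ (leq_maxl m n))); apply: (le_trans (lu _)).
    by apply: mu_; exact: leq_maxr.
  exists (sup (range l)) => n; apply/andP; split.
    by apply: ub_le_sup; [exists (u 0%N) => _ [m _ <-]|exists n].
  by apply: ge_sup; [exists (l 0%N), 0%N|move=> _ [m _ <-]].
have [s0 sP0] : exists x, forall n, qa (Q n) <= x <= qb (Q n).
  by apply: nest => n; [have [] := half n|have [] := half n|have [/andP[]] := val n].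
have [t0 tP0] : exists x, forall n, qc (Q n) <= x <= qd (Q n).
  by apply: nest => n; [have [] := half n|have [] := half n|have [] := val n].
have s00 : 0 <= s0 by have /andP[+ _] := sP0 0%N; apply: le_trans; have [/andP[]] := val 0%N.
have s01 : s0 < 1 by have /andP[_] := sP0 0%N; move=> /le_lt_trans; apply; have [] := val 0%N.
pose w := s0%:C * ei t0.
have w1 : nc w < 1 by rewrite nc_polar.
have [l lP] := hG w w1.
apply/eqP; rewrite -nc_eq0 eq_le nc_ge0 andbT; apply/ler_addgt0Pl => e e0; rewrite addr0.
(* The two radial edges count 1 each and the two arcs 8 each, in units of e1 * 17 * p^2, and 18 * 17
   = 306 < 400. The factor 4^n lost in the bisection is compensated by p^2 = 4^-n. *)
pose e1 := e / 400.
have e10 : 0 < e1 by exact: divr_gt0 e0 (ltr0n _ 400).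
have [d d0 dP] := lP e1 e10.
have half1 : `|2^-1 : R| < 1 by rewrite ger0_norm ?invr_ge0// invf_lt1// ltr1n.
have [n nd] : exists n, 17 * 2^-1 ^+ n < d.
  have /cvgrPdist_lt/(_ _ d0)[n _ /(_ n (leqnn _))] := @cvg_geometric _ (17 : R) _ half1.
  by rewrite sub0r normrN /geometric /= ger0_norm ?mulr_ge0 ?exprn_ge0 ?invr_ge0// => h; exists n.
have p0 : 0 < (2^-1 : R) ^+ n by rewrite exprn_gt0// invr_gt0.
apply: (le_trans (big n)).
have := val n; have := size n; have := sP0 n; have := tP0 n.
have -> : qrect G (Q n) = rect G (qa (Q n)) (qb (Q n)) (qc (Q n)) (qd (Q n)).
  by case: (Q n) => [[[? ?] ?] ?].
move: (qa (Q n)) (qb (Q n)) (qc (Q n)) (qd (Q n)) => a' b' c' d'.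
move=> /andP[t1 t2] /andP[s1 s2] [zb zd] [/andP[a'0 ab'] b'1 cd'].
set p := _ ^+ n in p0 zb zd nd *.
have zb' : b' - a' <= p.
  rewrite zb -[leRHS]mul1r ler_wpM2r ?(ltW p0)//.
  by case/andP: ab => a0 _; lra.
(* 17 = 1 + 16: the radial displacement plus the Lipschitz constant of [ei]. *)
have near s t : a' <= s <= b' -> c' <= t <= d' -> nc (s%:C * ei t - w) <= 17 * p.
  move=> /andP[h1 h2] /andP[h3 h4].
  have -> : s%:C * ei t - w = (s - s0)%:C * ei t + s0%:C * (ei t - ei t0) by rewrite /w rCB; ring.
  apply: (le_trans (ncD _ _)); rewrite !ncM nc_ei mulr1 !nc_real (ger0_norm s00).
  have k1 : `|s - s0| <= p by rewrite ler_norml; move: s1 s2 h1 h2 zb'; clear; lra.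
  have k2 : `|t - t0| <= p by rewrite ler_norml; lra.
  have k3 : s0 * nc (ei t - ei t0) <= 1 * (16 * `|t - t0|).
    by rewrite ler_pM ?nc_ge0 ?(ltW s01)// ei_lipschitz.
  lra.
(* The first-order expansion at the limit point integrates to 0 around the rectangle, so only the
   remainder [E] contributes. *)
pose A (u : R[i]) : R[i] := G w + l * (u - w).
pose E (u : R[i]) : R[i] := G u - A u.
have cA : disc_cont A.
  move=> v v1; apply: diff_cont; exists l => e' e'0; exists 1 => // u _.
  have -> : A u - (A v + l * (u - v)) = 0 by rewrite /A; ring.
  by rewrite nc0 mulr_ge0 ?nc_ge0 ?(ltW e'0).
have IE : rect G a' b' c' d' = rect E a' b' c' d'.
  by rewrite (rectB _ _ cG cA) ?a'0 ?ab'// rect_affine// subr0.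
have cE : disc_cont E.
  move=> v v1 e' e'0; have e20 : 0 < e' / 2 by rewrite divr_gt0.
  have [d1 d10 d1P] := cG v v1 _ e20; have [d2 d20 d2P] := cA v v1 _ e20.
  exists (Num.min d1 d2); first by rewrite lt_min d10.
  move=> u; rewrite lt_min => /andP[/d1P h1 /d2P h2].
  have -> : E u - E v = (G u - G v) - (A u - A v) by rewrite /E; ring.
  by apply: (le_lt_trans (ncB _ _)); move: h1 h2; clear; lra.
have Eb s t : a' <= s <= b' -> c' <= t <= d' -> nc (E (s%:C * ei t)) <= e1 * (17 * p).
  move=> hs ht; have h := near s t hs ht.
  apply: (le_trans (dP _ (le_lt_trans h nd))); by rewrite ler_pM2l.
have b'0 : 0 <= b' by exact: le_trans ab'.
have a'1 : a' < 1 by exact: le_lt_trans ab' b'1.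
have Xb t : c' <= t <= d' -> nc (radial_edge E a' b' t) <= e1 * (17 * p) * p.
  move=> ht; apply: le_trans (nc_cint_itv (C := e1 * (17 * p)) ab' (radial_edge_integrable t cE a'0 b'1) _) _.
    by move=> s hs; rewrite ncM nc_ei mulr1; exact: Eb.
  by rewrite ler_wpM2l// mulr_ge0 ?(ltW e10)// mulr_ge0// ltW.
have pi4 : pi < 4 :> R by have := @pihalf_lt2 R; clear; lra.
have pi0 := @pi_gt0 R.
have Yb s : a' <= s <= b' -> nc (arc_edge E c' d' s) <= e1 * (17 * p) * 8 * p.
  move=> /andP[hs1 hs2].
  have s1' : 0 <= s < 1 by rewrite (le_trans a'0)// (le_lt_trans hs2).
  have hs : a' <= s <= b' by rewrite hs1.
  apply: le_trans (nc_cint_itv (C := e1 * (17 * p) * 8) cd' (arc_edge_integrable _ _ cE s1') _) _; last by rewrite zd.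
  move=> t ht; rewrite ncM ler_pM ?nc_ge0 ?Eb// ncM nc_real /dei !ncM nc_ei mulr1 nc_real.
  rewrite (_ : nc 'i = 1) ?mulr1; last by rewrite /= expr0n/= add0r expr1n sqrtr1.
  case/andP: s1' => g1 g2; rewrite !ger0_norm ?mulr_ge0 ?(ltW pi0)//.
  have : s * (2 * pi) <= 1 * 8 by rewrite ler_pM ?mulr_ge0 ?(ltW pi0) ?(ltW g2)//; move: pi4; clear; lra.
  clear; lra.
have tot : nc (rect E a' b' c' d') <= 18 * (e1 * (17 * p) * p).
  have hc : c' <= c' <= d' by rewrite lexx. have hd : c' <= d' <= d' by rewrite lexx andbT.
  have ha : a' <= a' <= b' by rewrite lexx. have hb : a' <= b' <= b' by rewrite lexx andbT.
  have -> : 18 * (e1 * (17 * p) * p) =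
    e1 * (17 * p) * p + e1 * (17 * p) * 8 * p + e1 * (17 * p) * p + e1 * (17 * p) * 8 * p by ring.
  apply: (le_trans (ncB _ _)); apply: lerD (Yb _ ha).
  apply: (le_trans (ncB _ _)); apply: lerD (Xb _ hd).
  by apply: (le_trans (ncD _ _)); apply: lerD (Xb _ hc) (Yb _ hb).
rewrite IE.
apply: (@le_trans _ _ (4 ^+ n * (18 * (e1 * (17 * p) * p)))); first by rewrite ler_pM2l ?exprn_gt0.
have pp : 4 ^+ n * p * p = 1.
  by rewrite /p -mulrA -!exprMn (_ : 4 * (2^-1 * 2^-1) = 1) ?expr1n//; field.
have -> : 4 ^+ n * (18 * (e1 * (17 * p) * p)) = 306 * e1 * (4 ^+ n * p * p) by ring.
rewrite pp /e1; move: e0; clear; lra.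
Qed.

End goursat_theorem.

(** * Cauchy's theorem on circles *)

Section cauchy_thm.
Variable R : realType.
Local Notation leb := (@lebesgue_measure R).
Local Notation mu := (@arc_measure R).
Local Notation T := (circle R).
Implicit Types (G : R[i] -> R[i]).

Lemma derivable_diff_at (F : R[i]^o -> R[i]^o) (w : R[i]) : derivable F w 1 -> diff_at F w.
Proof.
rewrite /derivable => /cvg_ex[/= l /cvgrPdist_lt lP]; exists l => e e0.
have e20 : (0 : R[i]) < (e / 2)%:C by rewrite ltcR divr_gt0.
have [d /= d0 dP] := lP _ e20.
(* The radius lives in [R[i]], where being positive entails being real. *)
have dr : d = (complex.Re d)%:C.
  by rewrite RRe_real// gtr0_real.
have d0' : 0 < complex.Re d by rewrite -ltcR -dr.
exists (complex.Re d) => // u ud.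
have [->|uw] := eqVneq u w.
  by rewrite !subrr mulr0 addr0 subrr nc0 mulr0.
have uw0 : u - w != 0 by rewrite subr_eq0.
have := dP (u - w); rewrite /ball_/= sub0r normrN dr => /(_ _ uw0).
have : `|u - w| < (complex.Re d)%:C by rewrite normrE ltcR.
move=> h /(_ h); rewrite normrE ltcR /=.
rewrite /shift /= /GRing.scale /= mulr1 subrK => h2.
have -> : F u - (F w + l * (u - w)) = - ((l - (u - w)^-1 * (F u - F w)) * (u - w)).
  by field.
rewrite ncN ncM ler_wpM2r ?nc_ge0//; apply: (le_trans (ltW h2)).
by rewrite ler_pdivrMr//; lra.
Qed.

Lemma holo_holomorphic (F : R[i]^o -> R[i]^o) : holomorphic_on_disc F -> holo F.
Proof. by move=> hF w w1; apply/derivable_diff_at/hF; rewrite normrE ltcR. Qed.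

Lemma diff_at_mulid G w : diff_at G w -> diff_at (fun u => G u * u) w.
Proof.
move=> [l lP]; exists (l * w + G w) => e e0.
pose K := nc w + 1; have K0 : 0 < K by rewrite ltr_wpDl ?nc_ge0.
have e1 : 0 < e / (2 * K) by rewrite divr_gt0// mulr_gt0.
have [d d0 dP] := lP _ e1.
pose L := nc l + 1; have L0 : 0 < L by rewrite ltr_wpDl ?nc_ge0.
exists (Num.min d (Num.min 1 (e / (2 * L)))).
  by rewrite !lt_min d0 ltr01 divr_gt0// mulr_gt0.
move=> u; rewrite !lt_min => /and3P[u1 u2 u3].
have -> : G u * u - (G w * w + (l * w + G w) * (u - w)) =
  (G u - (G w + l * (u - w))) * u + l * (u - w) * (u - w) by ring.
apply: (le_trans (ncD _ _)); rewrite !ncM.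
have uK : nc u <= K.
  by have := ncD (u - w) w; rewrite subrK /K; lra.
set x := nc (u - w) in u1 u2 u3 *.
have x0 : 0 <= x by exact: nc_ge0.
have h1 : nc (G u - (G w + l * (u - w))) * nc u <= e / (2 * K) * x * K.
  by rewrite ler_pM ?nc_ge0// dP.
have h2 : nc l * x * x <= L * (e / (2 * L)) * x.
  rewrite ler_wpM2r// ler_pM ?nc_ge0//; last exact: ltW.
  by rewrite /L lerDl.
apply: (le_trans (lerD h1 h2)).
rewrite (_ : _ + _ = e * x)//; field; rewrite !gt_eqF//.
Qed.

Lemma diff_at_mulX G w m : diff_at G w -> diff_at (fun u => G u * u ^+ m) w.
Proof.
move=> dG; elim: m => [|m ih].
  by under eq_fun do rewrite expr0 mulr1.
by under eq_fun do rewrite exprSr mulrA; exact: diff_at_mulid.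
Qed.

Lemma ccat_dilate G r t : disc_cont G -> 0 <= r < 1 -> ccat (fun t => G (r%:C * ei t)) t.
Proof.
move=> cG /andP[r0 r1]; apply: ccat_comp; first by apply: cG; rewrite nc_polar.
by apply/ccont_ccat/ccontM; [exact: ccont_cst|exact: ccont_ei].
Qed.

Lemma ccont_dilate G r : disc_cont G -> 0 <= r < 1 -> ccont (fun t => G (r%:C * ei t)).
Proof.
by move=> cG r1; split=> t; have [] := ccat_dilate t cG r1.
Qed.

Lemma cmeas_dilate G r : disc_cont G -> 0 <= r < 1 -> cmeas setT (fun z : T => G (r%:C * coord z)).
Proof.
move=> cG r1; have [c1 c2] := ccont_dilate cG r1.
split; apply/measurable_EFinP; apply: measurable_arc; apply/measurable_EFinP.
  exact: continuous_measurable_fun.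
exact: continuous_measurable_fun.
Qed.

Lemma cauchy_circle G r m : holo G -> 0 < r < 1 ->
  cint mu setT (fun z : T => G (r%:C * coord z) * coord z ^+ m.+1) = 0.
Proof.
move=> hG /andP[r0 r1]; have r01 : 0 <= r < 1 by rewrite (ltW r0).
have cG := holo_cont hG.
(* Only the power m is inserted: the differential along the arc supplies the last factor. *)
pose H (u : R[i]) := G u * u ^+ m.
have hH : holo H by move=> w w1; exact/diff_at_mulX/hG.
have r00 : (0 : R) <= 0 <= r by apply/andP; split => //; exact: ltW.
have := goursat hH r00 r1.
(* The angles 0 and 1 give the same ray, so the radial edges cancel, and the arc of radius 0
   vanishes by the factor [s] in [arc_edge]. *)
have -> : rect H 0 r 0 1 = arc_edge H 0 1 r.
  rewrite /rect /radial_edge ei0 ei1 (_ : arc_edge H 0 1 0 = 0); first by ring.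
  rewrite -[RHS](cint0 leb `[0%R, 1%R]); apply: eq_cint => t _; by rewrite (_ : (0 : R)%:C = 0)// !mul0r mulr0.
pose k : R[i] := r%:C ^+ m.+1 * ((2 * pi)%:C * 'i).
have cF : ccont (fun t => G (r%:C * ei t) * ei t ^+ m.+1).
  apply: ccontM; first exact: ccont_dilate.
  by apply: cder_cont => t; eexists; exact: cderX (cder_ei t).
have -> : arc_edge H 0 1 r = k * cint leb `[0%R, 1%R] (fun t => G (r%:C * ei t) * ei t ^+ m.+1).
  rewrite -cintZ//; last exact: ccont_int.
  by apply: eq_cint => t _; rewrite /H /dei /k exprMn !exprS; ring.
move=> /eqP; rewrite mulf_eq0 => /orP[|/eqP h].
  have rC0 (x : R) : 0 < x -> x%:C != 0 by move=> x0; rewrite -nc_eq0 nc_real gtr0_norm ?gt_eqF.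
  rewrite /k mulf_eq0 expf_eq0 /= mulf_eq0 !(negbTE (rC0 _ _))//=; last first.
    by rewrite mulr_gt0// pi_gt0.
  by rewrite eq_complex /= oner_eq0 andbF.
apply: etrans h; rewrite -(cint_co cF); apply: etrans (arc_cint _) _; last by [].
by apply: cmeasM; [exact: cmeas_dilate|exact/cmeasX/cmeas_coord].
Qed.
End cauchy_thm.

(** * Hardy spaces and Fourier coefficients *)

Section boundary.
Variable R : realType.
Local Notation mu := (@arc_measure R).
Local Notation T := (circle R).
Implicit Types (F : R[i]^o -> R[i]^o) (f g : T -> R[i]).
Let mT : measurable (setT : set T). Proof. exact: measurableT. Qed.

(** A sequence of radii tending to 1, because dominated convergence is applied along sequences; it
    starts at 1/2, so that [cauchy_circle] applies to all of them. *)
Definition rad (k : nat) : R := 1 - 2^-1 ^+ k.+1.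

Lemma rad_itv k : 0 < rad k < 1.
Proof.
rewrite /rad subr_gt0 gtrBl exprn_gt0 ?invr_gt0// andbT exprn_ilt1 ?invr_ge0//.
by rewrite invf_lt1// ltr1n.
Qed.

Lemma rad_cvg (d : R) : 0 < d -> \forall k \near \oo, 1 - d < rad k.
Proof.
move=> d0; have half1 : `|2^-1 : R| < 1 by rewrite ger0_norm ?invr_ge0// invf_lt1// ltr1n.
have /cvgrPdist_lt/(_ _ d0) := @cvg_geometric _ (2^-1 : R) _ half1.
apply: filterS => k; rewrite sub0r normrN /geometric /= -exprS ger0_norm ?exprn_ge0 ?invr_ge0//.
by rewrite /rad; lra.
Qed.

Lemma boundary_dist F f (z : T) : F (r%:C * coord z) @[r --> (1 : R)^'-] --> (f z : R[i]^o) ->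
  forall e : R, 0 < e -> exists2 d : R, 0 < d & forall r : R, 1 - d < r < 1 -> nc (F (r%:C * coord z) - f z) < e.
Proof.
move=> /cvgrPdist_lt h e e0.
have eC : (0 : R[i]) < e%:C by rewrite ltcR.
have [d /= d0 dP] := h _ eC; exists d => // r /andP[r1 r2].
have := dP r; rewrite normrE ltcR ncBC; apply => //=.
by rewrite gtr0_norm ?subr_gt0//; lra.
Qed.

Lemma boundary_rad F f (z : T) : F (r%:C * coord z) @[r --> (1 : R)^'-] --> (f z : R[i]^o) ->
  nc (F ((rad k)%:C * coord z) - f z) @[k --> \oo] --> 0.
Proof.
move=> /boundary_dist h; apply/cvgrPdist_lt => e /h[d d0 dP].
have := rad_cvg d0; apply: filterS => k kd.
by rewrite sub0r normrN ger0_norm ?nc_ge0// dP// kd; have /andP[] := rad_itv k.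
Qed.

(* Boundedness in L^2 gives the uniform integrability needed to pass to the limit in L^1. *)
Lemma L1_cvg_of_L2_bounded (h : nat -> T -> R) (C e : R) : 0 < e ->
  (forall k z, 0 <= h k z) ->
  (forall k, measurable_fun setT (h k)) ->
  (forall k, mu.-integrable setT (EFin \o (fun z => h k z ^+ 2))) ->
  (forall k, \int[mu]_z (h k z ^+ 2) <= C) ->
  {ae mu, forall z, h k z @[k --> \oo] --> 0} ->
  exists k, \int[mu]_z h k z < e.
Proof.
move=> e0 h0 mh ih hC aeh.
have C0 : 0 <= C by apply: le_trans (hC 0%N); apply: Rintegral_ge0 => z _; exact: sqr_ge0.
(* Truncation level: h <= min(h, K) + h^2 / K, where the last term has integral at most C / K <= e /
   4 and the first is handled by dominated convergence. *)
pose K := 4 * (C + 1) / e.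
have K0 : 0 < K by rewrite divr_gt0// mulr_gt0// ltr_wpDl.
have mm k : measurable_fun setT (fun z => Num.min (h k z) K).
  by apply: measurable_minr => //; exact: measurable_cst.
have bm k z : `|Num.min (h k z) K| <= K.
  by rewrite ger0_norm ?le_min ?h0 ?(ltW K0)// ge_min lexx orbT.
have cm : \int[mu]_z Num.min (h k z) K @[k --> \oo] --> 0.
  apply: (@Rintegral_cvg0 _ _ _ mu setT _ (fun=> K)) => //.
  - apply: filterS aeh => z hz _; apply: (squeeze_cvgr _ (cvg_cst 0) hz).
    by apply: nearW => k; rewrite le_min h0 (ltW K0)/= ge_min lexx.
  - exact: arc_integrable_cst.
  - by apply: aeW => z k _; exact: bm.
have e20 : 0 < e / 2 by rewrite divr_gt0.
have /cvgrPdist_lt/(_ _ e20)[k _ /(_ k (leqnn _))] := cm.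
rewrite sub0r normrN => hk; exists k.
have key z : h k z <= Num.min (h k z) K + K^-1 * h k z ^+ 2.
  have [hK|hK] := leP (h k z) K; first by rewrite lerDl mulr_ge0 ?sqr_ge0// invr_ge0 ltW.
  have : h k z <= K^-1 * h k z ^+ 2.
    by rewrite mulrC ler_pdivlMr// expr2 ler_wpM2l// ltW.
  by lra.
have im : mu.-integrable setT (EFin \o (fun z => Num.min (h k z) K)).
  apply: (le_integrable mT _ _ (arc_integrable_cst K)); first exact/measurable_EFinP.
  by move=> z _ /=; rewrite lee_fin [leRHS]ger0_norm ?(ltW K0).
have ih2 : mu.-integrable setT (EFin \o (fun z => K^-1 * h k z ^+ 2)) by exact: arc_integrableZ.
have i1 : mu.-integrable setT (EFin \o h k).
  apply: (le_integrable mT _ _ (arc_integrableD im ih2)); first exact/measurable_EFinP.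
  by move=> z _ /=; rewrite lee_fin ger0_norm// (le_trans (key z))// ler_norm.
apply: (@le_lt_trans _ _ (\int[mu]_z (Num.min (h k z) K + K^-1 * h k z ^+ 2))).
  by apply: le_Rintegral => //; exact: arc_integrableD.
rewrite RintegralD// RintegralZl//.
have : K^-1 * \int[mu]_z (h k z ^+ 2) <= K^-1 * C by rewrite ler_pM2l ?invr_gt0.
have : K^-1 * C <= e / 4.
  rewrite /K invf_div mulrAC ler_pdivrMr ?mulr_gt0//; last by rewrite ltr_wpDl.
  have : e * C <= e * (C + 1) by rewrite ler_pM2l// lerDl.
  lra.
have := le_lt_trans (ler_norm _) hk.
set a := Rintegral _ _ _; set b := Rintegral _ _ _; move: a b => a b.
by clear -e0; lra.
Qed.

Lemma H2_hardy F : hardy2_disc F -> disc_cont F /\ exists2 C : R, 0 <= C & forall r, 0 <= r < 1 ->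
  L2 (fun z : T => F (r%:C * coord z)) /\ N2 (fun z : T => F (r%:C * coord z)) <= C.
Proof.
move=> [/holo_holomorphic/holo_cont cF [C hC]]; split => //.
exists (C ^+ 2); first exact: sqr_ge0.
move=> r r1; have LF : L2 (fun z : T => F (r%:C * coord z)).
  split; first exact: cmeas_dilate.
  by apply: le_lt_trans (hC r r1) _; exact: ltry.
split => //; have := hC r r1; rewrite L2_LnormC// lee_fin => h.
rewrite -(sqr_sqrtr (N2_ge0 _)) lerXn2r ?nnegrE ?sqrtr_ge0//.
by apply: le_trans h; rewrite sqrtr_ge0.
Qed.

(** The coefficients of negative index vanish for the dilates of [F] by [cauchy_circle]. The dilates
    are bounded in L^2 and converge almost everywhere, so some dilate is as L^1-close to [f] as
    desired, and a Fourier coefficient is bounded by the L^1 norm. *)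
Lemma H2_analytic f : H2 f -> analytic f.
Proof.
move=> [Lf [F hF bF]] m.
destruct (H2_hardy hF) as [cF [C C0 hC]].
have hol : holo F by case: hF => /holo_holomorphic.
have r01 k : 0 <= rad k < 1 by have /andP[/ltW -> ->] := rad_itv k.
pose Fk k (z : T) := F ((rad k)%:C * coord z).
have LF k : L2 (Fk k) by exact: (hC _ (r01 k)).1.
pose D := 2 * C + 2 * N2 f.
apply/eqP; rewrite -nc_eq0 eq_le nc_ge0 andbT; apply/ler_addgt0Pl => e e0; rewrite addr0.
have mg k : cmeas setT (fun z => Fk k z - f z) by apply: cmeasB; exact: L2_cmeas.
have [k] : exists k, \int[mu]_z nc (Fk k z - f z) < e.
  apply: (@L1_cvg_of_L2_bounded (fun k z => nc (Fk k z - f z)) D) => //.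
  - by move=> k z; exact: nc_ge0.
  - by move=> k; exact: measurable_nc.
  - by move=> k; apply: L2_integrable_sqr; exact: L2B.
  - move=> k; rewrite -/(N2 _).
    have := N2D_le (LF k) (L2N Lf); have [_] := hC _ (r01 k); rewrite -/(Fk k) => h1.
    rewrite (_ : N2 (fun z => - f z) = N2 f); first by move: h1; rewrite /D; clear; lra.
    by apply: eq_Rintegral => z _; rewrite ncN.
  - by apply: filterS bF => z; exact: boundary_rad.
move=> /ltW; apply: le_trans.
have i1 := cintegrable_pow m.+1 (L2_cintegrable (LF k)).
have i2 := cintegrable_pow m.+1 (L2_cintegrable Lf).
have -> : cint mu setT (fun z => f z * coord z ^+ m.+1) = - cint mu setT (fun z => (Fk k z - f z) * coord z ^+ m.+1).
  have -> : cint mu setT (fun z => (Fk k z - f z) * coord z ^+ m.+1) =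
    cint mu setT (fun z => Fk k z * coord z ^+ m.+1) - cint mu setT (fun z => f z * coord z ^+ m.+1).
    by rewrite -cintB//; apply: eq_cint => z _; rewrite mulrBl.
  by rewrite [X in X - _](cauchy_circle m hol (rad_itv k)) sub0r opprK.
have LB := L2B (LF k) Lf.
rewrite ncN; apply: (le_trans (nc_cint_le _ (cintegrable_pow m.+1 (L2_cintegrable LB)))) => //.
apply: le_Rintegral => //.
- by apply: integrable_nc => //; exact/cintegrable_pow/L2_cintegrable.
- by apply: integrable_nc => //; exact: L2_cintegrable.
- by move=> z _; rewrite ncM ler_piMr ?nc_ge0 ?nc_pow.
Qed.
End boundary.

(** * From vanishing negative coefficients to the Hardy space *)

Section analytic_H2.
Variable R : realType.
Local Notation mu := (@arc_measure R).
Local Notation T := (circle R).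
Implicit Types (f g : T -> R[i]).
Let mT : measurable (setT : set T). Proof. exact: measurableT. Qed.

(** The difference quotient minus the candidate derivative is again an integral of [f] against an
    explicit kernel, with a factor [h] in front; this replaces differentiation under the integral
    sign. *)
Lemma cauchy_derivable f w : cintegrable mu setT f -> nc w < 1 -> derivable (cauchy f : R[i]^o -> R[i]^o) w 1.
Proof.
move=> cf w1; pose rho := 1 - nc w.
have rho0 : 0 < rho by rewrite subr_gt0.
pose b (z : T) := (coord z)^*.
have mb : cmeas setT b by exact/cmeasJ/cmeas_coord.
have b1 z : nc (b z) <= 1 by exact: nc_circle1J.
have cf2 (v u : R[i]) : nc v < 1 -> nc u < 1 -> cintegrable mu setT (fun z => f z * b z / (1 - v * b z) / (1 - u * b z)).
  move=> v1 u1; apply: cintegrable_geom => //; apply: cintegrable_geom => //.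
  exact: cintegrable_bounded b1.
pose l := cint mu setT (fun z => f z * b z / (1 - w * b z) / (1 - w * b z)).
apply/cvg_ex; exists (l : R[i]^o); apply/cvgrPdist_lt => /= e e0.
have er : e = (complex.Re e)%:C by rewrite RRe_real// gtr0_real.
have e0' : 0 < complex.Re e by rewrite -ltcR -er.
set eps := complex.Re e in er e0'.
pose N := \int[mu]_z nc (f z).
have N0 : 0 <= N by apply: Rintegral_ge0 => z _; exact: nc_ge0.
(* A bound for the three inverse denominators: 1 - |w| = rho occurs twice, and 1 - |w + h| > rho / 2
   as soon as |h| < rho / 2. *)
pose M := (rho / 2)^-1 * rho^-1 * rho^-1.
have M0 : 0 < M by rewrite mulr_gt0 ?invr_gt0// mulr_gt0 ?invr_gt0// divr_gt0.
pose d := Num.min (rho / 2) (eps / (2 * (M * (N + 1)))).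
have d0 : 0 < d.
  by rewrite lt_min !divr_gt0// mulr_gt0// mulr_gt0// ltr_wpDl.
have fin (x : R) : 0 <= x -> x < eps / (2 * (M * (N + 1))) -> x * M * N < eps.
  move=> x0; have N1 : 0 < N + 1 by rewrite ltr_wpDl.
  have k0 := mulr_gt0 M0 N1; have k1 : 0 < 2 * (M * (N + 1)) by exact: mulr_gt0.
  rewrite (ltr_pdivlMr _ _ k1) => hd2.
  apply: (@le_lt_trans _ _ (x * (M * (N + 1)))).
    by rewrite -mulrA ler_wpM2l// ler_wpM2l ?(ltW M0)// lerDl.
  have : x * (2 * (M * (N + 1))) = 2 * (x * (M * (N + 1))) by ring.
  move: hd2 e0'; clear; lra.
exists d%:C => /=; first by rewrite ltcR.
move=> h; rewrite /ball_ /= sub0r normrN normrE ltcR => hd h0.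
move: hd; rewrite lt_min => /andP[hd1 hd2].
have wh1 : nc (w + h) < 1.
  by apply: (le_lt_trans (ncD _ _)); move: hd1 w1; rewrite /rho; clear; lra.
rewrite er normrE ltcR /shift /= /GRing.scale /= mulr1 [h + w]addrC.
have i1 : cintegrable mu setT (fun z => f z / (1 - (w + h) * b z)) by exact: cintegrable_geom.
have i2 : cintegrable mu setT (fun z => f z / (1 - w * b z)) by exact: cintegrable_geom.
have lowb (v : R[i]) (c : R) z : 0 < c -> c <= 1 - nc v -> nc (1 - v * b z)^-1 <= c^-1.
  move=> c0 cv; have : c <= nc (1 - v * b z).
    by apply: le_trans (nc_1B_ge _); apply: (le_trans cv); rewrite lerB// ncM ler_piMr ?nc_ge0.
  by move=> h1; rewrite ncV lef_pV2 ?posrE// (lt_le_trans c0).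
have d1 z : 1 - w * b z != 0 by apply: sub1_neq0; rewrite (le_lt_trans _ w1)// ncM ler_piMr ?nc_ge0.
have d2 z : 1 - (w + h) * b z != 0 by apply: sub1_neq0; rewrite (le_lt_trans _ wh1)// ncM ler_piMr ?nc_ge0.
have -> : l - h^-1 * (cauchy f (w + h) - cauchy f w) =
   cint mu setT (fun z => f z * (- h * (b z * b z / (1 - (w + h) * b z) / (1 - w * b z) / (1 - w * b z)))).
  rewrite /cauchy -cintB// -cintZ//; last exact: cintegrableB.
  rewrite -cintB//; [|exact: cf2|by apply: cintegrableZ => //; exact: cintegrableB].
  apply: eq_cint => z _; rewrite -/(b z).
  by field; rewrite h0 d1 d2.
have bd z : nc (- h * (b z * b z / (1 - (w + h) * b z) / (1 - w * b z) / (1 - w * b z))) <= nc h * M.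
  rewrite !ncM ncN ler_wpM2l ?nc_ge0// ler_pM ?mulr_ge0 ?nc_ge0//; last by apply: lowb.
  rewrite ler_pM ?mulr_ge0 ?nc_ge0//; last by apply: lowb.
  rewrite -[leRHS]mul1r ler_pM ?mulr_ge0 ?nc_ge0//; first by rewrite mulr_ile1 ?nc_ge0.
  apply: lowb; first by rewrite divr_gt0.
  by have := ncD w h; move: hd1 w1; rewrite /rho; clear; lra.
have ci : cintegrable mu setT (fun z => f z * (- h * (b z * b z / (1 - (w + h) * b z) / (1 - w * b z) / (1 - w * b z)))).
  apply: (cintegrable_bounded cf _ bd).
  have mi (v : R[i]) : cmeas setT (fun z => (1 - v * b z)^-1).
    apply: cmeas_inv; apply: cmeasB; first exact: cmeas_cst.
    by apply: cmeasM => //; exact: cmeas_cst.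
  apply: cmeasM; first exact: cmeas_cst.
  by apply: cmeasM (mi w); apply: cmeasM (mi w); apply: cmeasM (mi (w + h)); exact: cmeasM.
apply: (le_lt_trans (nc_cint_le _ ci)) => //.
apply: (@le_lt_trans _ _ (nc h * M * N)).
  rewrite /N -RintegralZl//; last exact: integrable_nc.
  apply: le_Rintegral => //; [exact: integrable_nc|by apply: arc_integrableZ; exact: integrable_nc|].
  by move=> z _; rewrite ncM mulrC ler_wpM2r ?nc_ge0.
exact: fin (nc_ge0 h) hd2.
Qed.

Lemma cauchy_holomorphic f : cintegrable mu setT f -> holomorphic_on_disc (cauchy f : R[i]^o -> R[i]^o).
Proof. by move=> cf w; rewrite normrE ltcR; exact: cauchy_derivable. Qed.

Lemma dot_pow n k : dot (fun z : T => coord z ^+ n) (fun z => coord z ^+ k) = (n == k)%:R.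
Proof.
have vv (z : T) : coord z * (coord z)^* = 1 by rewrite mulcJ nc_circle expr1n.
rewrite /dot; under eq_cint do rewrite conjX.
have [nk|kn|->] := ltngtP n k.
- rewrite [RHS](_ : _ = 0)// -[RHS](cint_coordJ_exp R (k - n).-1); apply: eq_cint => z _.
  have e : k = (n + (k - n).-1.+1)%N by rewrite prednK ?subn_gt0// subnKC// ltnW.
  by rewrite {1}e exprD mulrA -exprMn vv expr1n mul1r.
- rewrite [RHS](_ : _ = 0)// -[RHS](cint_coord_exp R (n - k).-1); apply: eq_cint => z _.
  have e : n = ((n - k).-1.+1 + k)%N by rewrite prednK ?subn_gt0// subnK// ltnW.
  by rewrite {1}e exprD -mulrA -exprMn vv expr1n mulr1.
- by rewrite -[RHS](cint_cst (1%:R)); apply: eq_cint => z _; rewrite -exprMn vv expr1n.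
Qed.

Lemma L2_pow n : L2 (fun z : T => coord z ^+ n).
Proof. by apply: (@L2_bounded _ _ 1) => [|z]; [exact/cmeasX/cmeas_coord|exact: nc_pow]. Qed.

Definition tpoly (a : nat -> R[i]) N (z : T) : R[i] := \sum_(n < N) a n * coord z ^+ n.

Lemma tpolyS a N : tpoly a N.+1 = fun z => tpoly a N z + a N * coord z ^+ N.
Proof. by apply/funext => z; rewrite /tpoly big_ord_recr. Qed.
Lemma tpoly0 a : tpoly a 0 = fun=> 0.
Proof. by apply/funext => z; rewrite /tpoly big_ord0. Qed.

Lemma L2_tpoly a N : L2 (tpoly a N).
Proof.
elim: N => [|N ih]; first by rewrite tpoly0; exact: L2_cst.
by rewrite tpolyS; exact: L2D ih (L2Z (a N) (L2_pow N)).
Qed.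

Lemma dot_tpoly a N k : (N <= k)%N -> dot (tpoly a N) (fun z => coord z ^+ k) = 0.
Proof.
elim: N => [|N ih] Nk.
  by rewrite tpoly0 /dot -[RHS](cint0 mu setT); apply: eq_cint => z _; rewrite mul0r.
rewrite tpolyS dotDl ?dotZl; [|exact: L2_pow..|exact: L2_tpoly|by apply: L2Z; exact: L2_pow|exact: L2_pow].
by rewrite ih ?(ltnW Nk)// dot_pow ltn_eqF// mulr0 addr0.
Qed.

Lemma N2_pow n : N2 (fun z : T => coord z ^+ n) = 1.
Proof.
have := dotff (L2_pow n); rewrite dot_pow eqxx => /(congr1 (@complex.Re _)) /= <-//.
Qed.

Lemma N2_tpoly a N : N2 (tpoly a N) = \sum_(n < N) nc (a n) ^+ 2.
Proof.
elim: N => [|N ih].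
  rewrite big_ord0 tpoly0 /N2 -[RHS](_ : \int[mu]_(z in setT) (0 : R) = 0); last by rewrite Rintegral_cst// mul0r.
  by apply: eq_Rintegral => z _; rewrite nc0 expr0n.
rewrite tpolyS N2DZ; [|exact: L2_tpoly|exact: L2_pow].
by rewrite dot_tpoly// mulr0 /= mulr0 addr0 N2_pow mulr1 ih big_ord_recr.
Qed.

Definition coef f n : R[i] := cint mu setT (fun z => f z * (coord z)^* ^+ n).

Lemma coef_dot f n : coef f n = dot f (fun z => coord z ^+ n).
Proof. by apply: eq_cint => z _; rewrite conjX. Qed.

Lemma bessel f N : L2 f -> \sum_(n < N) nc (coef f n) ^+ 2 <= N2 f.
Proof.
(* The gap in Bessel's inequality is the squared distance from f to its partial sum. *)
move=> Lf; suff -> : \sum_(n < N) nc (coef f n) ^+ 2 = N2 f - N2 (fun z => f z - tpoly (coef f) N z).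
  by rewrite gerBl N2_ge0.
elim: N => [|N ih].
  rewrite big_ord0 (_ : N2 (fun z => _ - _) = N2 f) ?subrr//; congr N2; apply/funext => z.
  by rewrite tpoly0 subr0.
have LE : L2 (fun z => f z - tpoly (coef f) N z) by exact: L2B Lf (L2_tpoly _ N).
transitivity (N2 f - N2 (fun z => f z - tpoly (coef f) N z) + nc (coef f N) ^+ 2).
  by rewrite big_ord_recr ih.
have -> : (fun z => f z - tpoly (coef f) N.+1 z) = (fun z => (f z - tpoly (coef f) N z) + (- coef f N) * coord z ^+ N).
  by apply/funext => z; rewrite tpolyS; ring.
rewrite (N2DZ _ LE (L2_pow N)) N2_pow (dotBl Lf (L2_tpoly _ N) (L2_pow N)).
rewrite dot_tpoly// subr0 -coef_dot ncN.
have -> : complex.Re ((- coef f N)^* * coef f N) = - nc (coef f N) ^+ 2.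
  by rewrite nc_sq; case: (coef f N) => a b /=; ring.
by ring.
Qed.

Lemma cauchy_tpoly f r N (z : T) : cintegrable mu setT f -> 0 <= r < 1 ->
  nc (cauchy f (r%:C * coord z) - tpoly (fun n => r%:C ^+ n * coef f n) N z) <= r ^+ N / (1 - r) * \int[mu]_z nc (f z).
Proof.
move=> cf /andP[r0 r1].
have e : nc (r%:C * coord z) = r by rewrite ncM nc_circle nc_real mulr1 ger0_norm.
have w1 : nc (r%:C * coord z) < 1 by rewrite e.
have := geom_cint N cf (cmeasJ (cmeas_coord R)) (@nc_circle1J R) w1; rewrite e.
rewrite (_ : \sum_(n <- iota 0 N) _ = tpoly (fun n => r%:C ^+ n * coef f n) N z)//.
rewrite /tpoly -(big_mkord xpredT (fun n => r%:C ^+ n * coef f n * coord z ^+ n)) /index_iota subn0.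
by apply: eq_bigr => n _; rewrite exprMn /coef; ring.
Qed.

(** At radius r the Cauchy integral is within uniform distance 1 of a partial sum, whose norm is
    controlled by Bessel's inequality. The length of that sum depends on r but the resulting bound
    does not, which is all that [hardy2_disc] asks. *)
Lemma N2_cauchy_le f r : L2 f -> 0 <= r < 1 ->
  L2 (fun z : T => cauchy f (r%:C * coord z)) /\ N2 (fun z : T => cauchy f (r%:C * coord z)) <= 2 * N2 f + 2.
Proof.
move=> Lf r01; have cf := L2_cintegrable Lf; case/andP: (r01) => r0 r1.
set g := fun z : T => _.
have mg : cmeas setT g by apply: cmeas_dilate => //; exact/holo_cont/holo_holomorphic/cauchy_holomorphic.
pose C := \int[mu]_z nc (f z) / (1 - r).
have rn : `|r| < 1 by rewrite ger0_norm.
have [N hN] : exists N, r ^+ N * C <= 1.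
  have : (fun N => r ^+ N * C) @ \oo --> 0 * C.
    apply: cvgM; last exact: cvg_cst.
    have := @cvg_geometric _ (1 : R) _ rn; rewrite /geometric.
    by under eq_fun do rewrite mul1r.
  rewrite mul0r => /cvgrPdist_lt/(_ _ ltr01)[N _ /(_ N (leqnn _))].
  by rewrite sub0r normrN => h; exists N; rewrite (le_trans (ler_norm _))// ltW.
pose S := tpoly (fun n => r%:C ^+ n * coef f n) N.
have LS : L2 S by exact: L2_tpoly.
have gS z : nc (g z - S z) <= 1.
  by apply: (le_trans (cauchy_tpoly N z cf r01)); rewrite mulrAC -mulrA -/C.
have LgS : L2 (fun z => g z - S z).
  exact: L2_bounded (cmeasB mg (L2_cmeas LS)) gS.
have gE : g = fun z => S z + (g z - S z) by apply/funext => z; rewrite addrC subrK.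
split; first by rewrite gE; exact: L2D.
rewrite gE; apply: (le_trans (N2D_le LS LgS)); apply: lerD.
  rewrite ler_pM2l// N2_tpoly; apply: le_trans (bessel N Lf); apply: ler_sum => n _.
  rewrite ncM ncX nc_real ger0_norm// exprMn ler_piMl ?sqr_ge0// -exprM exprn_ile1//; exact: ltW.
rewrite -[leRHS]mulr1 ler_pM2l//.
have : N2 (fun z => g z - S z) <= \int[mu]_z (1 : R).
  apply: N2_le => //; first exact: arc_integrable_cst.
  by move=> z; rewrite expr_le1 ?nc_ge0.
by rewrite Rintegral_cst// mul1r [X in fine X]arc_measure_setT.
Qed.

Lemma cauchy_boundary f : cintegrable mu setT f -> analytic f -> boundary_value (cauchy f : R[i]^o -> R[i]^o) f.
Proof.
move=> cf af; apply: (@filterS _ _ (ae_filter_ringOfSetsType mu) _ _ _ (poisson_ae cf)) => z hz.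
apply/cvgrPdist_lt => /= e e0.
have er : e = (complex.Re e)%:C by rewrite RRe_real// gtr0_real.
have e0' : 0 < complex.Re e by rewrite -ltcR -er.
have [d /andP[d0 d1] dP] := hz _ e0'.
exists d => //= r; rewrite /ball_ /= => h r1.
rewrite er normrE ltcR ncBC.
have rd : 1 - d < r by move: h; rewrite gtr0_norm ?subr_gt0//; lra.
have := dP r; rewrite rd r1 => /(_ isT); rewrite poisson_cauchy//.
by rewrite ncM nc_circle nc_real mulr1 ger0_norm//; lra.
Qed.

Lemma analytic_H2 f : L2 f -> analytic f -> H2 f.
Proof.
move=> Lf af; have cf := L2_cintegrable Lf; split => //.
exists (cauchy f : R[i]^o -> R[i]^o); last exact: cauchy_boundary.
split; first exact: cauchy_holomorphic.
exists (Num.sqrt (2 * N2 f + 2)) => r r01.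
have [Lr Nr] := N2_cauchy_le Lf r01.
by rewrite L2_LnormC// lee_fin ler_sqrt// addr_ge0// mulr_ge0// N2_ge0.
Qed.
End analytic_H2.

(** * Bounded analytic multipliers *)

Section multipliers.
Variable R : realType.
Local Notation mu := (@arc_measure R).
Local Notation T := (circle R).
Implicit Types (f g : T -> R[i]) (M : set (T -> R[i])).
Let mT : measurable (setT : set T). Proof. exact: measurableT. Qed.

(** Multiplication and Poisson estimates ask for a bound at every point; this supplies a
    representative that has one. *)
Lemma truncate f (C : R) : 0 <= C -> cmeas setT f -> {ae mu, forall z, nc (f z) <= C} ->
  exists f', [/\ cmeas setT f', forall z, nc (f' z) <= C & ae_eq_circle f f'].
Proof.
move=> C0 mf fC; pose A := [set z : T | nc (f z) <= C].
have mA : measurable A.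
  have := measurable_nc measurableT mf measurableT (measurable_itv `]-oo, C]).
  by rewrite setTI (_ : _ @^-1` _ = A)//; apply/seteqP; split => z; rewrite /= in_itv.
exists (fun z => (\1_A z : R)%:C * f z); split.
- apply: cmeasM => //; split => /=; first exact: measurable_indic.
  exact: measurable_cst.
- move=> z; rewrite indicE; case: (boolP (z \in A)) => zA.
    by rewrite mul1r; move: zA; rewrite inE.
  by rewrite mul0r nc0.
- by apply: filterS fC => z zC; rewrite indicE mem_set// mul1r.
Qed.

(** The bound on [F] passes to its radial limits. After a change on a null set the claim is an
    instance of the H^2 case, since a bounded function on the disc has bounded L^2 means. *)
Lemma Hinfty_analytic f : Linfty f -> (exists2 F, hardyoo_disc F & boundary_value F f) ->
  exists f' C, [/\ cmeas setT f', forall z, nc (f' z) <= C, ae_eq_circle f f' & analytic f'].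
Proof.
move=> [mf _] [F [hF [C FC]] bF].
have FC' u : nc u < 1 -> nc (F u) <= C.
  by move=> u1; have := FC u; rewrite !normrE ltcR lecR; apply.
have C0 : 0 <= C by apply: le_trans (FC' 0 _); rewrite ?nc_ge0 ?nc0.
have ae_f : {ae mu, forall z, nc (f z) <= C}.
  apply: filterS bF => z /boundary_dist bz; apply/ler_addgt0Pl => e e0.
  have [d d0 dP] := bz e e0.
  (* A radius in the range of [dP]; the minimum with 1 also keeps it nonnegative. *)
  pose r := 1 - Num.min d 1 / 2.
  have m0 : 0 < Num.min d 1 by rewrite lt_min d0 ltr01.
  have m1 : Num.min d 1 <= d by rewrite ge_min lexx.
  have m2 : Num.min d 1 <= 1 by rewrite ge_min lexx orbT.
  have rd : 1 - d < r < 1 by rewrite /r; apply/andP; split; move: m0 m1; clear; lra.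
  have h := dP r rd.
  have -> : f z = F (r%:C * coord z) - (F (r%:C * coord z) - f z) by ring.
  apply: (le_trans (ncB _ _)); rewrite [leRHS]addrC; apply: lerD; last exact: ltW.
  apply: FC'; rewrite ncM nc_circle nc_real mulr1 ger0_norm; first by case/andP: rd.
  by rewrite /r; move: m2; clear; lra.
have [f' [mf' f'C ff']] := truncate C0 mf ae_f.
exists f', C; split => //; apply: H2_analytic; split; first exact: L2_bounded mf' f'C.
exists F; last by apply: filterS2 bF ff' => z h1 <-.
split => //; exists C => r /andP[r0 r1].
have LF : L2 (fun z : T => F (r%:C * coord z)).
  apply: (@L2_bounded _ _ C); first by apply: cmeas_dilate; [exact/holo_cont/holo_holomorphic|rewrite r0].
  by move=> z; apply: FC'; rewrite ncM nc_circle nc_real mulr1 ger0_norm.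
rewrite L2_LnormC// lee_fin -[leRHS]ger0_norm// -sqrtr_sqr ler_sqrt ?sqr_ge0//.
have : N2 (fun z : T => F (r%:C * coord z)) <= \int[mu]_z (C ^+ 2).
  apply: N2_le => //; first exact: arc_integrable_cst.
  move=> z; rewrite lerXn2r ?nnegrE ?nc_ge0//; apply: FC'.
  by rewrite ncM nc_circle nc_real mulr1 ger0_norm.
by rewrite Rintegral_cst// [X in fine X]arc_measure_setT mulr1.
Qed.

Lemma N2_0 : N2 (fun=> 0 : R[i]) = 0 :> R.
Proof.
transitivity (\int[mu]_(z in setT) (0 : R)); last by rewrite Rintegral_cst// mul0r.
by apply: eq_Rintegral => z _; rewrite nc0 expr0n.
Qed.

(** The distance between the two functions is 0. This is how elements given as functions are moved
    within their class. *)
Lemma closed_ae M u v : subspace_closed M -> M u -> L2 v -> ae_eq_circle v u -> M v.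
Proof.
move=> [[ML _ _] Mc] Mu Lv vu; apply: Mc => // e e0; exists u => //.
rewrite (@N2_ae _ _ (fun=> 0)).
- by rewrite N2_0.
- by apply: cmeasB; apply: L2_cmeas => //; exact: ML.
- exact: cmeas_cst.
- by apply: filterS vu => z ->; rewrite subrr.
Qed.

Definition shift_inv M := forall g, M g -> M (fun z => coord z * g z).

Lemma shift_inv_pow M n g : shift_inv M -> M g -> M (fun z => coord z ^+ n * g z).
Proof.
move=> sM Mg; elim: n => [|n ih]; first by under eq_fun do rewrite expr0 mul1r.
by under eq_fun do rewrite exprS -mulrA; exact: sM.
Qed.

Lemma pois_meas w : cmeas setT (fun y : T => (pois w (coord y))%:C).
Proof.
split; last exact: measurable_cst.
rewrite /= /pois; under eq_fun do rewrite -powR_inv1 ?sqr_ge0//.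
apply: measurable_funM; first exact: measurable_cst.
apply: (measurableT_comp (measurable_powR _)).
apply: measurable_funX; apply: measurable_nc; first exact: measurableT.
apply: cmeasB; first exact: cmeas_cst.
by apply: cmeasM; [exact: cmeas_cst|exact/cmeasJ/cmeas_coord].
Qed.

Lemma pois_int w f : nc w < 1 -> cintegrable mu setT f ->
  cintegrable mu setT (fun y : T => (pois w (coord y))%:C * f y).
Proof.
move=> w1 cf; have bpo (y : T) : nc (pois w (coord y))%:C <= (1 - nc w)^-1 ^+ 2.
  by rewrite nc_real ger0_norm ?pois_ge0// pois_le.
apply: eq_cintegrable (cintegrable_bounded cf (pois_meas w) bpo) => // y _.
by rewrite mulrC.
Qed.

Lemma poisson_le f w (C : R) : nc w < 1 -> cmeas setT f -> (forall z, nc (f z) <= C) ->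
  nc (poisson f w) <= C.
Proof.
move=> w1 mf fC; have cf : cintegrable mu setT f by apply: L2_cintegrable; exact: L2_bounded fC.
have c1 : cintegrable mu setT (fun=> C%:C) by exact: L2_cintegrable (L2_cst _).
have ip := pois_int w1 c1.
apply: (le_trans (nc_cint_le _ (pois_int w1 cf))) => //.
apply: (@le_trans _ _ (\int[mu]_z complex.Re ((pois w (coord z))%:C * C%:C))).
  apply: le_Rintegral => //; [exact/integrable_nc/pois_int|by case: ip|].
  move=> z _; rewrite ncM nc_real ger0_norm ?pois_ge0//= mulr0 subr0.
  by rewrite ler_wpM2l ?pois_ge0.
have i1 := pois_int w1 (L2_cintegrable (L2_cst (1 : R[i]))).
suff : cint mu setT (fun z => (pois w (coord z))%:C * C%:C) = C%:C by move=> /(congr1 (@complex.Re _)) /= ->.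
transitivity (C%:C * cint mu setT (fun z => (pois w (coord z))%:C * 1)); last by rewrite [cint _ _ _]poisson1// mulr1.
by rewrite -cintZ//; apply: eq_cint => z _; rewrite mulr1 mulrC.
Qed.

Lemma cvg_cauchy_rad f : cintegrable mu setT f -> analytic f ->
  {ae mu, forall z, nc (cauchy f ((rad R k)%:C * coord z) - f z) @[k --> \oo] --> 0}.
Proof.
move=> cf af; apply: (@filterS _ _ (ae_filter_ringOfSetsType mu) _ _ _ (cauchy_boundary cf af)) => z.
exact: (@boundary_rad R (cauchy f)).
Qed.

Lemma rad_disc k (z : T) : nc ((rad R k)%:C * coord z) < 1.
Proof.
by have /andP[r0 r1] := rad_itv R k; rewrite ncM nc_circle nc_real mulr1 gtr0_norm.
Qed.

Lemma cauchy_meas_rad f k : cintegrable mu setT f -> cmeas setT (fun z : T => cauchy f ((rad R k)%:C * coord z)).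
Proof.
move=> cf; have /andP[r0 r1] := rad_itv R k.
apply: cmeas_dilate; last by rewrite ltW.
exact/holo_cont/holo_holomorphic/cauchy_holomorphic.
Qed.

(* f is the boundedly a.e. limit of its dilates, which are uniform limits of polynomials. *)
Lemma bounded_analytic_annihilator f k (C : R) : cmeas setT f -> (forall z, nc (f z) <= C) -> analytic f ->
  cintegrable mu setT k -> (forall n, cint mu setT (fun z => k z * coord z ^+ n) = 0) ->
  cint mu setT (fun z => k z * f z) = 0.
Proof.
move=> mf fC af ck k0.
have cf : cintegrable mu setT f by apply: L2_cintegrable; exact: L2_bounded fC.
pose fr n (z : T) := cauchy f ((rad R n)%:C * coord z).
have mfr n : cmeas setT (fr n) by exact: cauchy_meas_rad.
have frC n z : nc (fr n z) <= C.
  by rewrite /fr -poisson_cauchy ?rad_disc//; apply: poisson_le => //; exact: rad_disc.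
have ikf : cintegrable mu setT (fun z => k z * f z) by exact: cintegrable_bounded fC.
have ikr n : cintegrable mu setT (fun z => k z * fr n z) by exact: cintegrable_bounded (frC n).
have zero n : cint mu setT (fun z => k z * fr n z) = 0.
  have /andP[r0 r1] := rad_itv R n; set r := rad R n in r0 r1.
  have r01 : 0 <= r < 1 by rewrite ltW.
  apply/eqP; rewrite -nc_eq0 eq_le nc_ge0 andbT.
  pose Nf := \int[mu]_z nc (f z); pose Nk := \int[mu]_z nc (k z).
  apply: (@geometric_le0 _ _ r ((1 - r)^-1 * Nf * Nk)) => // N.
  pose S := tpoly (fun n => r%:C ^+ n * coef f n) N.+1.
  have bS z : nc (fr n z - S z) <= r ^+ N.+1 * ((1 - r)^-1 * Nf).
    by rewrite mulrA; exact: cauchy_tpoly.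
  have iS : cintegrable mu setT (fun z => k z * S z) /\ cint mu setT (fun z => k z * S z) = 0.
    rewrite /S; elim: N.+1 => [|m [ih1 ih2]].
      rewrite tpoly0 (_ : (fun z => k z * 0) = fun=> 0); last by apply/funext => z; rewrite mulr0.
      by rewrite cint0; split => //; exact: cintegrable0.
    rewrite tpolyS; set a := _ * coef f m.
    have -> : (fun z => k z * (tpoly (fun n => r%:C ^+ n * coef f n) m z + a * coord z ^+ m)) =
      (fun z => k z * tpoly (fun n => r%:C ^+ n * coef f n) m z + a * (k z * coord z ^+ m)).
      by apply/funext => z; ring.
    have i2 := cintegrable_pow m ck.
    split; first by apply: cintegrableD => //; exact: cintegrableZ.
    by rewrite cintD ?cintZ ?k0 ?ih2 ?mulr0 ?addr0//; exact: cintegrableZ.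
  have -> : cint mu setT (fun z => k z * fr n z) = cint mu setT (fun z => k z * (fr n z - S z)).
    rewrite -[LHS]subr0 -iS.2 -cintB//; last exact: iS.1.
    by apply: eq_cint => z _; rewrite mulrBr.
  have mS : cmeas setT (fun z => fr n z - S z) by exact: cmeasB (mfr n) (L2_cmeas (L2_tpoly _ _)).
  have i3 := cintegrable_bounded ck mS bS.
  apply: (le_trans (nc_cint_le _ i3)) => //.
  rewrite mulrA [X in _ <= X](_ : _ = \int[mu]_z (r ^+ N.+1 * ((1 - r)^-1 * Nf) * nc (k z))).
    apply: le_Rintegral => //; [exact: integrable_nc|apply: arc_integrableZ; exact: integrable_nc|].
    by move=> z _; rewrite ncM mulrC ler_wpM2r ?nc_ge0.
  by rewrite RintegralZl//; exact: integrable_nc.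
have cv : nc (cint mu setT (fun z => k z * fr n z) - cint mu setT (fun z => k z * f z)) @[n --> \oo] --> 0.
  apply: (cint_cvg (g := fun z => 2 * C * nc (k z)) measurableT ikr ikf).
  - apply: (@filterS _ _ (ae_filter_ringOfSetsType mu) _ _ _ (cvg_cauchy_rad cf af)) => z hz _.
    have -> : (fun n => nc (k z * fr n z - k z * f z)) = fun n => nc (k z) * nc (fr n z - f z).
      by apply/funext => n; rewrite -mulrBr ncM.
    by rewrite -(mulr0 (nc (k z))); apply: cvgM => //; exact: cvg_cst.
  - by apply: arc_integrableZ; exact: integrable_nc.
  - apply: aeW => z n _; rewrite -mulrBr ncM mulrC ler_wpM2r ?nc_ge0//.
    by apply: (le_trans (ncB _ _)); have := fC z; have := frC n z; lra.
have cc : nc (cint mu setT (fun z => k z * fr n z) - cint mu setT (fun z => k z * f z)) @[n --> \oo]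
   --> nc (cint mu setT (fun z => k z * f z)).
  by under eq_fun do rewrite zero sub0r ncN; exact: cvg_cst.
by apply/eqP; rewrite -nc_eq0; apply/eqP; exact: cvg_unique cc cv.
Qed.

Lemma dotC f g : L2 f -> L2 g -> dot g f = (dot f g)^*.
Proof.
move=> Lf Lg; rewrite /dot -cintJ//; last exact: L2_dotP.
by apply: eq_cint => z _; rewrite conjM conjK mulrC.
Qed.

(** Let u be f g minus its projection to M. Since u is orthogonal to every z^n g, the integrable
    function g conj(u) annihilates all powers of z, hence also f by [bounded_analytic_annihilator].
    So f g is orthogonal to u, and u vanishes. *)
Lemma shift_inv_bounded_analytic M f g (C : R) : subspace_closed M -> shift_inv M ->
  cmeas setT f -> (forall z, nc (f z) <= C) -> analytic f -> M g -> M (fun z => f z * g z).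
Proof.
move=> cM sM mf fC af Mg; have [[ML _ _] _] := cM.
have Lg : L2 g by exact: ML.
have Lh : L2 (fun z => f z * g z) by exact: L2_mul_bounded fC.
have [P MP Port] := L2_projection cM Lh.
have LP : L2 P by exact: ML.
pose u z := f z * g z - P z.
have Lu : L2 u by exact: L2B.
have uM m : M m -> dot m u = 0.
  by move=> Mm; rewrite dotC ?Port ?conj0//; exact: ML.
have : dot u u = 0.
  rewrite {1}/u dotBl// (uM _ MP) subr0 /dot.
  rewrite -(@bounded_analytic_annihilator f (fun z => g z * (u z)^*) C)//.
  - by apply: eq_cint => z _; ring.
  - exact: L2_dotP.
  - move=> n; rewrite -(uM _ (shift_inv_pow n sM Mg)); apply: eq_cint => z _; ring.
rewrite dotff// => /(congr1 (@complex.Re _)) /= /(N2_eq0 Lu) u0.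
by apply: closed_ae MP Lh _ => //; apply: filterS u0 => z /eqP; rewrite /u subr_eq0 => /eqP.
Qed.

Lemma invariant_Hinfty M : subspace_closed M -> shift_inv M -> invariant_for (@Hinfty R) M.
Proof.
move=> cM sM f g [Lf Hf] Mg; have [[ML _ _] _] := cM.
have [f' [C [mf' f'C ff' af']]] := Hinfty_analytic Lf Hf.
have Mf'g := shift_inv_bounded_analytic cM sM mf' f'C af' Mg.
apply: (closed_ae cM Mf'g); last by apply: filterS ff' => z ->.
apply: L2_ae (ML _ Mf'g) _ _; last by apply: filterS ff' => z ->.
by apply: cmeasM; [case: Lf|apply/L2_cmeas/ML].
Qed.

Lemma Linfty_bounded f (C : R) : cmeas setT f -> {ae mu, forall z, nc (f z) <= C} -> Linfty f.
Proof.
move=> mf fC; split => //; rewrite /LnormC unlock.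
rewrite [X in (0 < X)%E]arc_measure_setT lte01.
apply: (@le_lt_trans _ _ C%:E); last exact: ltry.
by apply/ess_supP; apply: filterS fC => z zC /=; rewrite lee_fin ger0_norm ?nc_ge0.
Qed.

Lemma pow_Hinfty1 n : Hinfty1 (fun z : T => coord z ^+ n.+2).
Proof.
split; first by apply: (@Linfty_bounded _ 1); [exact/cmeasX/cmeas_coord|apply: aeW => z; exact: nc_pow].
have dX (w : R[i]) : derivable ((fun u => u ^+ n.+2) : R[i]^o -> R[i]^o) w 1.
  exact: exprn_derivable.
exists (fun u => u ^+ n.+2).
  split; last by rewrite exp_derive1 expr0n/= scaler0.
  split; first by move=> w _; exact: dX.
  by exists 1 => w w1; rewrite normrX exprn_ile1 ?normr_ge0// ltW.
apply: aeW => z; apply/cvgrPdist_lt => /= e e0.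
have er : e = (complex.Re e)%:C by rewrite RRe_real// gtr0_real.
have e0' : 0 < complex.Re e by rewrite -ltcR -er.
have cX : ((fun r : R => r ^+ n.+2) : R -> R) @ (1 : R)^'- --> (1 : R).
  apply: cvg_at_left_filter; rewrite -[X in _ --> X](expr1n _ n.+2); exact: exprn_continuous.
move/cvgrPdist_lt : cX => /(_ _ e0'); apply: filterS => r.
rewrite er normrE ltcR exprMn.
have -> : coord z ^+ n.+2 - r%:C ^+ n.+2 * coord z ^+ n.+2 = (1 - r ^+ n.+2)%:C * coord z ^+ n.+2.
  by rewrite rCB rC1 mulrBl mul1r rmorphXn.
by rewrite ncM nc_real ncX nc_circle expr1n mulr1.
Qed.

(** The extension is the Cauchy integral, which equals a Poisson integral because [J] is analytic;
    as an average with positive weights of total mass 1 it is bounded by 1. *)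
Lemma analytic_Hinfty J : cmeas setT J -> {ae mu, forall z, nc (J z) = 1} -> analytic J -> Hinfty J.
Proof.
move=> mJ J1 aJ.
have J1' : {ae mu, forall z, nc (J z) <= 1} by apply: filterS J1 => z ->.
split; first exact: Linfty_bounded J1'.
have [J' [mJ' J'1 JJ']] := truncate ler01 mJ J1'.
have LJ' := L2_bounded mJ' J'1.
have cJ' := L2_cintegrable LJ'.
have cJ : cintegrable mu setT J.
  by apply: (ae_eq_cintegrable measurableT cJ' mJ); apply: filterS JJ' => z ->.
exists (cauchy J : R[i]^o -> R[i]^o); last exact: cauchy_boundary.
split; first exact: cauchy_holomorphic.
exists 1 => w; rewrite normrE ltcR => w1; rewrite lecR -poisson_cauchy//.
have -> : poisson J w = poisson J' w.
  apply: (ae_eq_cint measurableT (cmeasM (pois_meas w) mJ) (cmeasM (pois_meas w) mJ')).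
  by apply: filterS JJ' => z ->.
exact: poisson_le.
Qed.
End multipliers.

(** * Shift-invariant subspaces *)

Section invariant_subspaces.
Variable R : realType.
Local Notation mu := (@arc_measure R).
Local Notation T := (circle R).
Implicit Types (f g h u : T -> R[i]) (M : set (T -> R[i])).
Let mT : measurable (setT : set T). Proof. exact: measurableT. Qed.

Lemma coord_coordJ (z : T) : coord z * (coord z)^* = 1.
Proof. by rewrite mulcJ nc_circle expr1n. Qed.

Lemma L2_coord f : L2 f -> L2 (fun z => coord z * f z).
Proof. by move=> Lf; apply: L2_mul_bounded Lf (cmeas_coord R) (@nc_circle1 R). Qed.
Lemma L2_coordJ f : L2 f -> L2 (fun z => (coord z)^* * f z).
Proof. by move=> Lf; apply: L2_mul_bounded Lf (cmeasJ (cmeas_coord R)) (@nc_circle1J R). Qed.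
Lemma L2_coordX n f : L2 f -> L2 (fun z => coord z ^+ n * f z).
Proof. by move=> Lf; apply: L2_mul_bounded Lf (cmeasX n (cmeas_coord R)) (fun z => nc_pow z n). Qed.

Lemma N2_unimodular (b f : T -> R[i]) : (forall z, nc (b z) = 1) -> N2 (fun z => b z * f z) = N2 f.
Proof. by move=> b1; apply: eq_Rintegral => z _; rewrite ncM b1 mul1r. Qed.

Section linear_closed.
Variables (M : set (T -> R[i])) (cM : subspace_closed M).

Lemma subspace_L2 f : M f -> L2 f. Proof. by case: cM => -[h _ _] _; exact: h. Qed.
Lemma subspaceD f g : M f -> M g -> M (fun z => f z + g z).
Proof.
case: cM => -[_ _ h] _ Mf Mg; have := h 1 1 f g Mf Mg.
by under eq_fun do rewrite !mul1r.
Qed.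
Lemma subspace0 : M (fun=> 0). Proof. by case: cM => -[]. Qed.
Lemma subspaceZ (c : R[i]) f : M f -> M (fun z => c * f z).
Proof.
case: cM => -[_ M0 h] _ Mf; have := h c 0 f _ Mf M0.
by under eq_fun do rewrite mulr0 addr0.
Qed.
Lemma subspaceB f g : M f -> M g -> M (fun z => f z - g z).
Proof. by move=> Mf Mg; under eq_fun do rewrite -mulN1r; apply: subspaceD => //; exact: subspaceZ. Qed.

(* The closure of [M + zM]. *)
Definition shift_hull : set (T -> R[i]) := [set f | L2 f /\ forall e : R, 0 < e ->
  exists m1 m2, [/\ M m1, M m2 & N2 (fun z => f z - (m1 z + coord z * m2 z)) < e]].

Lemma shift_hull_closed : subspace_closed shift_hull.
Proof.
split.
  split; first by move=> f [].
    split; first exact: L2_cst.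
    move=> e e0; exists (fun=> 0), (fun=> 0); split; [exact: subspace0|exact: subspace0|].
    by under eq_fun do rewrite mulr0 addr0 subrr; rewrite N2_0.
  move=> a b f g [Lf hf] [Lg hg]; split; first by apply: L2D; exact: L2Z.
  move=> e e0; pose K := 4 * (nc a ^+ 2 + nc b ^+ 2 + 1).
  have K0 : 0 < K by rewrite mulr_gt0// ltr_wpDl// addr_ge0 ?sqr_ge0.
  have eK : 0 < e / K by rewrite divr_gt0.
  destruct (hf _ eK) as [m1 [m2 [M1 M2 hm]]], (hg _ eK) as [k1 [k2 [N1 N2' hk]]].
  exists (fun z => a * m1 z + b * k1 z), (fun z => a * m2 z + b * k2 z); split.
  - by apply: subspaceD; exact: subspaceZ.
  - by apply: subspaceD; exact: subspaceZ.
  have Lm : L2 (fun z => f z - (m1 z + coord z * m2 z)).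
    exact: L2B Lf (L2D (subspace_L2 M1) (L2_coord (subspace_L2 M2))).
  have Lk : L2 (fun z => g z - (k1 z + coord z * k2 z)).
    exact: L2B Lg (L2D (subspace_L2 N1) (L2_coord (subspace_L2 N2'))).
  have -> : (fun z => a * f z + b * g z - (a * m1 z + b * k1 z + coord z * (a * m2 z + b * k2 z))) =
    (fun z => a * (f z - (m1 z + coord z * m2 z)) + b * (g z - (k1 z + coord z * k2 z))).
    by apply/funext => z; ring.
  apply: (le_lt_trans (N2D_le (L2Z a Lm) (L2Z b Lk))); rewrite !N2Z//.
  move: hm hk; rewrite !(ltr_pdivlMr _ _ K0); set x := N2 _; set y := N2 _ => hm hk.
  have x0 : 0 <= x by exact: N2_ge0. have y0 : 0 <= y by exact: N2_ge0.
  have A0 := sqr_ge0 (nc a); have B0 := sqr_ge0 (nc b).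
  set A := nc a ^+ 2 in A0 K K0 hm hk eK *; set B := nc b ^+ 2 in B0 K K0 hm hk eK *.
  have h1 : 4 * (A * x) <= x * K by have := mulr_ge0 x0 B0; move: x0; rewrite /K; clear; lra.
  have h2 : 4 * (B * y) <= y * K by have := mulr_ge0 y0 A0; move: y0; rewrite /K; clear; lra.
  move: hm hk h1 h2; clear; lra.
move=> f Lf hf; split => // e e0.
have e4 : 0 < e / 4 by rewrite divr_gt0.
destruct (hf _ e4) as [g [Lg hg] fg]; destruct (hg _ e4) as [m1 [m2 [M1 M2 hm]]].
exists m1, m2; split => //.
have Lm : L2 (fun z => m1 z + coord z * m2 z) by apply: L2D; [exact: subspace_L2|apply/L2_coord/subspace_L2].
apply: (le_lt_trans (N2_tri Lf Lg Lm)); move: e0 fg hm; clear; lra.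
Qed.

Lemma sub_shift_hull f : M f -> shift_hull f.
Proof.
move=> Mf; split; first exact: subspace_L2.
move=> e e0; exists f, (fun=> 0); split; [by []|exact: subspace0|].
by under eq_fun do rewrite mulr0 addr0 subrr; rewrite N2_0.
Qed.

Lemma shift_shift_hull f : M f -> shift_hull (fun z => coord z * f z).
Proof.
move=> Mf; split; first exact/L2_coord/subspace_L2.
move=> e e0; exists (fun=> 0), f; split; [exact: subspace0|by []|].
by under eq_fun do rewrite add0r subrr; rewrite N2_0.
Qed.

Hypothesis M_X : forall n f, M f -> M (fun z => coord z ^+ n.+2 * f z).

Lemma shift_hull_inv : shift_inv shift_hull.
Proof.
move=> g [Lg hg]; split; first exact: L2_coord.
move=> e e0; destruct (hg e e0) as [m1 [m2 [M1 M2 hm]]]; exists (fun z => coord z ^+ 2 * m2 z), m1; split; [exact: (M_X 0)|exact: M1|].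
rewrite -(N2_unimodular _ (@nc_circle R)) in hm; apply: le_lt_trans hm.
by rewrite le_eqVlt; apply/orP; left; apply/eqP; congr N2; apply/funext => z; ring.
Qed.

Lemma shift_hull_sqr f : shift_hull f -> M (fun z => coord z ^+ 2 * f z).
Proof.
move=> [Lf hf]; case: (cM) => _; apply; first exact: L2_coordX.
move=> e e0; destruct (hf e e0) as [m1 [m2 [M1 M2 hm]]].
exists (fun z => coord z ^+ 2 * m1 z + coord z ^+ 3 * m2 z).
  by apply: subspaceD; [exact: (M_X 0)|exact: (M_X 1)].
have n1 (z : T) : nc (coord z ^+ 2) = 1 by rewrite ncX nc_circle expr1n.
rewrite -(N2_unimodular _ n1) in hm; apply: le_lt_trans hm.
by rewrite le_eqVlt; apply/orP; left; apply/eqP; congr N2; apply/funext => z; ring.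
Qed.

End linear_closed.

(** The value is replaced by 1 where the modulus is not 1. Having modulus 1 everywhere makes J
    conj(J) = 1 an identity of functions. *)
Lemma unimodular_modify f : cmeas setT f -> {ae mu, forall z, nc (f z) = 1} ->
  exists J, [/\ cmeas setT J, forall z, nc (J z) = 1 & ae_eq_circle J f].
Proof.
move=> mf f1.
have mA : measurable [set z | nc (f z) = 1].
  have := measurable_nc measurableT mf measurableT (measurable_set1 1).
  by rewrite setTI.
set A := [set z | _] in mA.
have mi : cmeas setT (fun z => (\1_A z : R)%:C).
  by split => /=; [exact: measurable_indic|exact: measurable_cst].
exists (fun z => (\1_A z)%:C * f z + (1 - (\1_A z)%:C)); split.
- apply: cmeasD; first exact: cmeasM.
  by apply: cmeasB => //; exact: cmeas_cst.
- move=> z; rewrite indicE; case: (boolP (z \in A)) => zA.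
    by rewrite mul1r subrr addr0; move: zA; rewrite inE.
  by rewrite mul0r add0r subr0 nc1.
- by apply: filterS f1 => z z1; rewrite indicE mem_set// mul1r subrr addr0.
Qed.

(* A unit vector orthogonal to [z N] in a shift invariant [N] is unimodular, since the Fourier
   coefficients of its squared modulus are those of the constant function 1. *)
Lemma wandering_unimodular (N : set (T -> R[i])) : subspace_closed N -> shift_inv N ->
  ~ (forall f, N f -> N (fun z => (coord z)^* * f z)) ->
  exists J, [/\ cmeas setT J, forall z, nc (J z) = 1, N J &
    forall f, N f -> dot (fun z => coord z * f z) J = 0].
Proof.
move=> cN sN nN.
(* This is zN; describing it by the condition that conj(z) f lies in N makes it visibly linear and
   closed. *)
pose N' : set (T -> R[i]) := [set f | L2 f /\ N (fun z => (coord z)^* * f z)].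
have vJ1 (z : T) : nc (coord z)^* = 1 by rewrite ncJ nc_circle.
have cN' : subspace_closed N'.
  split.
    split; first by move=> f [].
      by split; [exact: L2_cst|under eq_fun do rewrite mulr0; exact: subspace0].
    move=> a b f g [Lf Nf] [Lg Ng]; split; first by apply: L2D; exact: L2Z.
    have -> : (fun z : T => (coord z)^* * (a * f z + b * g z)) =
      (fun z => a * ((coord z)^* * f z) + b * ((coord z)^* * g z)) by apply/funext => z; ring.
    by apply: subspaceD => //; exact: subspaceZ.
  move=> f Lf hf; split => //; case: (cN) => _; apply; first exact: L2_coordJ.
  move=> e /hf[g [Lg Ng] fg]; exists (fun z => (coord z)^* * g z) => //.
  rewrite -(N2_unimodular _ vJ1) in fg; apply: le_lt_trans fg.
  by rewrite le_eqVlt; apply/orP; left; apply/eqP; congr N2; apply/funext => z; rewrite mulrBr.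
have shN' f : N f -> N' (fun z => coord z * f z).
  move=> Nf; split; first exact/L2_coord/(subspace_L2 cN).
  by under eq_fun do rewrite mulrA [(coord _)^* * _]mulrC coord_coordJ mul1r.
have [g Ng nN'g] : exists2 g, N g & ~ N' g.
  apply: contrapT => h; apply: nN => f Nf; apply: contrapT => nf; apply: h; exists f => //.
  by move=> [_].
have Lg := subspace_L2 cN Ng.
have [P N'P Port] := L2_projection cN' Lg.
have LP : L2 P by case: N'P.
pose J0 z := g z - P z.
have NP : N P.
  case: N'P => _ /sN; by under eq_fun do rewrite mulrA coord_coordJ mul1r.
have NJ0 : N J0 by exact: subspaceB.
have LJ0 : L2 J0 by exact: L2B.
have n0 : 0 < N2 J0.
  rewrite lt_neqAle N2_ge0 andbT eq_sym; apply/eqP => /(N2_eq0 LJ0) J00; apply: nN'g.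
  by apply: closed_ae N'P Lg _ => //; apply: filterS J00 => z /eqP; rewrite /J0 subr_eq0 => /eqP.
pose s := Num.sqrt (N2 J0); have s0 : 0 < s by rewrite sqrtr_gt0.
pose J1 z := (s^-1)%:C * J0 z.
have NJ1 : N J1 by exact: subspaceZ.
have LJ1 : L2 J1 := subspace_L2 cN NJ1.
have J1J1 : dot J1 J1 = 1.
  rewrite dotff// /J1 N2Z// nc_real ger0_norm ?invr_ge0 ?(ltW s0)// exprVn sqr_sqrtr ?N2_ge0//.
  by rewrite mulVf// gt_eqF.
have J1ort f : N f -> dot (fun z => coord z * f z) J1 = 0.
  move=> Nf; have N'zf := shN' f Nf; have Lzf := N'zf.1.
  rewrite dotC// /J1 dotZl// Port// mulr0 conj0//.
clearbody J1.
have modJ1 : {ae mu, forall z, nc (J1 z) = 1}.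
  (* Being a product of two L^2 functions, [k] is only known to be integrable. *)
  pose k z : R[i] := J1 z * (J1 z)^* - 1.
  have ik : cintegrable mu setT k.
    by apply: cintegrableB => //; [exact: L2_dotP|exact: L2_cintegrable (L2_cst _)].
  have kn n : cint mu setT (fun z => k z * coord z ^+ n) = 0.
    have -> : cint mu setT (fun z => k z * coord z ^+ n) = dot (fun z => coord z ^+ n * J1 z) J1 - cint mu setT (fun z => coord z ^+ n).
      rewrite -(cintB measurableT (L2_dotP (L2_coordX n LJ1) LJ1) (L2_cintegrable (L2_pow R n))).
      by apply: eq_cint => z _; rewrite /k; ring.
    case: n => [|n].
      rewrite (_ : (fun z => coord z ^+ 0 * J1 z) = J1); last by apply/funext => z; rewrite mul1r.
      by rewrite J1J1 (@eq_cint _ _ _ _ _ _ (fun=> 1))// cint_cst subrr.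
    rewrite cint_coord_exp subr0.
    under [X in dot X _]eq_fun do rewrite exprS -mulrA.
    by rewrite J1ort//; exact: shift_inv_pow.
  have := fourier_unique ik kn.
  case=> [n|N0 [mN0 N00 sub]].
    (* [k] is real-valued, so these coefficients are the conjugates of those already computed. *)
    rewrite -[RHS]conj0 -(kn n) -cintJ//; last exact: cintegrable_pow.
    by apply: eq_cint => z _; rewrite conjM conjX /k conjB conjM conjK conj1; ring.
  exists N0; split => // z /= nz; apply: sub => /= kz; apply: nz.
  move: kz; rewrite /k mulcJ => /eqP; rewrite subr_eq0 => /eqP[] /eqP.
  by rewrite pexpr_eq1 ?nc_ge0// => /eqP.
have [J [mJ Jn JJ1]] := unimodular_modify (L2_cmeas LJ1) modJ1.
have LJ : L2 J by apply: (@L2_bounded _ _ 1) => // z; rewrite Jn.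
exists J; split => //; first exact: closed_ae NJ1 LJ JJ1.
move=> f Nf; rewrite -(J1ort _ Nf) /dot; apply: ae_eq_cint; first exact: measurableT.
- by apply: cmeasM; [exact/L2_cmeas/L2_coord/(subspace_L2 cN)|exact: cmeasJ].
- by apply: cmeasM; [exact/L2_cmeas/L2_coord/(subspace_L2 cN)|exact/cmeasJ/L2_cmeas].
- by apply: filterS JJ1 => z ->.
Qed.

End invariant_subspaces.

(** * Coefficients of analytic functions and division by the unimodular function *)

Section beurling.
Variable R : realType.
Local Notation mu := (@arc_measure R).
Local Notation T := (circle R).
Implicit Types (f g h u : T -> R[i]) (M N : set (T -> R[i])).
Let mT : measurable (setT : set T). Proof. exact: measurableT. Qed.


Lemma unimodularE (J : T -> R[i]) : cmeas setT J -> (forall z, nc (J z) = 1) -> unimodular J.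
Proof. by move=> mJ J1; split => //; apply: aeW => z; rewrite normrE J1. Qed.

Lemma normalize_pair (a b : R[i]) : a != 0 ->
  exists2 s : R, s%:C != 0 & nc (a / s%:C) ^+ 2 + nc (b / s%:C) ^+ 2 = 1.
Proof.
move=> a0; pose s := Num.sqrt (nc a ^+ 2 + nc b ^+ 2).
have s20 : 0 < nc a ^+ 2 + nc b ^+ 2 by rewrite ltr_pwDl ?sqr_ge0// exprn_gt0// lt_neqAle nc_ge0 eq_sym nc_eq0 a0.
have s0 : 0 < s by rewrite sqrtr_gt0.
have s2 : s ^+ 2 = nc a ^+ 2 + nc b ^+ 2 by exact/sqr_sqrtr/ltW.
exists s; first by rewrite -nc_eq0 nc_real gt_eqF// normr_gt0 gt_eqF.
rewrite !ncM !ncV nc_real ger0_norm ?(ltW s0)// !exprMn -mulrDl exprVn s2.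
by rewrite mulfV// gt_eqF.
Qed.

Lemma analyticD f g : L2 f -> L2 g -> analytic f -> analytic g -> analytic (fun z => f z + g z).
Proof.
move=> Lf Lg af ag m; under eq_cint do rewrite mulrDl.
by rewrite cintD ?af ?ag ?addr0//; exact/cintegrable_pow/L2_cintegrable.
Qed.
Lemma analyticZ (c : R[i]) f : L2 f -> analytic f -> analytic (fun z => c * f z).
Proof.
move=> Lf af m; under eq_cint do rewrite -mulrA.
by rewrite cintZ ?af ?mulr0//; exact/cintegrable_pow/L2_cintegrable.
Qed.
Lemma analyticB f g : L2 f -> L2 g -> analytic f -> analytic g -> analytic (fun z => f z - g z).
Proof.
move=> Lf Lg af ag; under eq_fun do rewrite -mulN1r.
exact: analyticD Lf (L2Z _ Lg) af (analyticZ _ Lg ag).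
Qed.
Lemma analytic_coord f : analytic f -> analytic (fun z => coord z * f z).
Proof. by move=> af m; rewrite -[RHS](af m.+1); apply: eq_cint => z _; rewrite [in RHS]exprS; ring. Qed.
Lemma analytic_cst (c : R[i]) : analytic (fun=> c : R[i]).
Proof.
move=> m; rewrite cintZ; first by rewrite cint_coord_exp mulr0.
  exact: measurableT.
exact: L2_cintegrable (L2_pow R _).
Qed.

Lemma coefD f g n : L2 f -> L2 g -> coef (fun z => f z + g z) n = coef f n + coef g n.
Proof.
move=> Lf Lg; rewrite /coef -cintD//; [|exact/cintegrable_powJ/L2_cintegrable..].
by apply: eq_cint => z _; rewrite mulrDl.
Qed.
Lemma coefZ (c : R[i]) f n : L2 f -> coef (fun z => c * f z) n = c * coef f n.
Proof.
move=> Lf; rewrite /coef -cintZ//; last exact/cintegrable_powJ/L2_cintegrable.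
by apply: eq_cint => z _; rewrite mulrA.
Qed.
Lemma coefB f g n : L2 f -> L2 g -> coef (fun z => f z - g z) n = coef f n - coef g n.
Proof.
move=> Lf Lg; under eq_fun do rewrite -mulN1r.
by rewrite (coefD _ Lf (L2Z _ Lg)) (coefZ _ _ Lg) mulN1r.
Qed.
Lemma coef_coordS f n : coef (fun z => coord z * f z) n.+1 = coef f n.
Proof.
apply: eq_cint => z _; rewrite exprS.
transitivity (coord z * (coord z)^* * (f z * (coord z)^* ^+ n)); first by ring.
by rewrite coord_coordJ mul1r.
Qed.
Lemma coef_coord0 f : analytic f -> coef (fun z => coord z * f z) 0 = 0.
Proof. by move=> af; rewrite -[RHS](af 0%N); apply: eq_cint => z _; rewrite expr0 expr1; ring. Qed.
Lemma coef_cst (c : R[i]) n : coef (fun=> c : R[i]) n = if n is 0 then c else 0.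
Proof.
rewrite /coef cintZ//; last first.
  by have := cintegrable_powJ n (L2_cintegrable (L2_cst (1 : R[i]))); under eq_fun do rewrite mul1r.
case: n => [|n]; last by rewrite cint_coordJ_exp mulr0.
by rewrite (@eq_cint _ _ _ _ _ _ (fun=> 1))// cint_cst mulr1.
Qed.

Definition affine (a b : R[i]) (z : T) : R[i] := a + b * coord z.
Lemma affineP a b : [/\ L2 (affine a b), analytic (affine a b), coef (affine a b) 0 = a & coef (affine a b) 1 = b].
Proof.
have Lz : L2 (fun z : T => b * coord z).
  by have := L2Z b (L2_pow R 1); under eq_fun do rewrite expr1.
have e : (fun z : T => b * coord z) = (fun z => coord z * b) by apply/funext => z; rewrite mulrC.
have Lb := L2_cst b; have La := L2_cst a.
split; first exact: L2D.
- by apply: analyticD => //; [exact: analytic_cst|rewrite e; exact/analytic_coord/analytic_cst].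
- by rewrite coefD// coef_cst e coef_coord0 ?addr0//; exact: analytic_cst.
- by rewrite coefD// coef_cst e coef_coordS coef_cst add0r.
Qed.

(** Multiplication by z^2 controls the integrals of g z^n for n >= 3. The other product gives a
    relation between consecutive integrals in which the lower one has coefficient [a]; as [a] is
    nonzero, one descends from n = 3 to n = 2 and then to n = 1. *)
Lemma analytic_of_multiples (a b : R[i]) g : L2 g -> a != 0 ->
  analytic (fun z => g z * affine a b z) -> analytic (fun z => g z * coord z ^+ 2) -> analytic g.
Proof.
move=> Lg a0 g1 g2.
have c n : cintegrable mu setT (fun z => g z * coord z ^+ n) by exact/cintegrable_pow/L2_cintegrable.
have z2 m : cint mu setT (fun z => g z * coord z ^+ m.+3) = 0.
  by rewrite -[RHS](g2 m); apply: eq_cint => z _; rewrite -mulrA -exprD.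
have rel m : a * cint mu setT (fun z => g z * coord z ^+ m.+1) + b * cint mu setT (fun z => g z * coord z ^+ m.+2) = 0.
  rewrite -[RHS](g1 m) -(cintZ _ mT (c m.+1)) -(cintZ _ mT (c m.+2)).
  rewrite -(cintD mT (cintegrableZ _ mT (c m.+1)) (cintegrableZ _ mT (c m.+2))).
  by apply: eq_cint => z _; rewrite /affine !exprS; ring.
have z1 : cint mu setT (fun z => g z * coord z ^+ 2) = 0.
  by apply: (mulfI a0); rewrite mulr0 -(rel 1%N) z2 mulr0 addr0.
case=> [|[|m]]; [|exact: z1|exact: z2].
by apply: (mulfI a0); rewrite mulr0 -(rel 0%N) z1 mulr0 addr0.
Qed.

(** Dividing by z^2 on the circle is multiplying by conj(z)^2; it moves the coefficients of index 0
    and 1 to the indices -2 and -1. *)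
Lemma analytic_div f : L2 f -> analytic f -> coef f 0 = 0 -> coef f 1 = 0 ->
  exists g, [/\ L2 g, analytic g & f = (fun z => coord z ^+ 2 * g z)].
Proof.
move=> Lf af f0 f1; exists (fun z => (coord z)^* * ((coord z)^* * f z)).
have e (z : T) : coord z ^+ 2 * ((coord z)^* * ((coord z)^* * f z)) = f z.
  transitivity ((coord z * (coord z)^*) ^+ 2 * f z); first by ring.
  by rewrite coord_coordJ expr1n mul1r.
split; [exact/L2_coordJ/L2_coordJ| |by apply/funext => z; rewrite e].
case=> [|[|m]].
- rewrite -[RHS]f1; apply: eq_cint => z _; rewrite !expr1.
  transitivity (coord z * (coord z)^* * (f z * (coord z)^*)); first by ring.
  by rewrite coord_coordJ mul1r.
- by rewrite -[RHS]f0; apply: eq_cint => z _; rewrite expr0 mulr1 mulrC e.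
- by rewrite -[RHS](af m); apply: eq_cint => z _; rewrite -[in RHS](e z) [RHS]mulrAC mulrC -exprD.
Qed.

(** * The hull as J H^2 *)

Section structure.
Variables (N : set (T -> R[i])) (J : T -> R[i]).
Hypotheses (cN : subspace_closed N) (sN : shift_inv N).
Hypotheses (mJ : cmeas setT J) (J1 : forall z, nc (J z) = 1) (NJ : N J).
Hypothesis Jort : forall f, N f -> dot (fun z => coord z * f z) J = 0.

Lemma JJ1 z : J z * (J z)^* = 1.
Proof. by rewrite mulcJ J1 expr1n. Qed.
Lemma nJ1 z : nc (J z) <= 1. Proof. by rewrite J1. Qed.
Lemma nJ1J z : nc (J z)^* <= 1. Proof. by rewrite ncJ J1. Qed.
Lemma L2_Jmul f : L2 f -> L2 (fun z => J z * f z).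
Proof. by move=> Lf; exact: L2_mul_bounded Lf mJ nJ1. Qed.
Lemma L2_Jdiv f : L2 f -> L2 (fun z => (J z)^* * f z).
Proof. by move=> Lf; exact: L2_mul_bounded Lf (cmeasJ mJ) nJ1J. Qed.
Lemma Jdiv f z : J z * ((J z)^* * f z) = f z.
Proof. by rewrite mulrA JJ1 mul1r. Qed.
Lemma divJ f z : (J z)^* * (J z * f z) = f z.
Proof. by rewrite mulrA [_^* * _]mulrC JJ1 mul1r. Qed.

(** The coefficient of index -(m + 1) of conj(J) f is the inner product of z (z^m f) with J. *)
Lemma hull_analytic f : N f -> analytic (fun z => (J z)^* * f z).
Proof.
move=> Nf m; rewrite -[RHS](Jort (shift_inv_pow m sN Nf)).
by apply: eq_cint => z _; rewrite exprS; ring.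
Qed.

(** Let P be the projection of J h to N and k = h - conj(J) P. Its negative coefficients vanish
    since both terms are analytic; the others are the inner products of J h - P with z^n J, which
    lies in N. So k = 0 by uniqueness. *)
Lemma analytic_hull h : L2 h -> analytic h -> N (fun z => J z * h z).
Proof.
move=> Lh ah; have Lg := L2_Jmul Lh.
have [P NP Port] := L2_projection cN Lg.
have LP := subspace_L2 cN NP.
pose k z := h z - (J z)^* * P z.
have Lk : L2 k by exact: L2B Lh (L2_Jdiv LP).
have ak : analytic k by exact: analyticB Lh (L2_Jdiv LP) ah (hull_analytic NP).
have k0 n : coef k n = 0.
  rewrite -[RHS](Port _ (shift_inv_pow n sN NJ)); apply: eq_cint => z _.
  rewrite conjM conjX /k -[X in X - _](divJ h z); ring.
have kp n : cint mu setT (fun z => k z * coord z ^+ n) = 0.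
  case: n => [|n]; last exact: ak.
  by rewrite -[RHS](k0 0%N).
have [N0 [mN0 N00 sub]] := fourier_unique (L2_cintegrable Lk) kp k0.
apply: closed_ae NP Lg _ => //; exists N0; split => // z /= nz; apply: sub => /= kz; apply: nz.
move/eqP: kz; rewrite /k subr_eq0 => /eqP ->; exact: Jdiv.
Qed.
End structure.
End beurling.

(** * Description of M by two coefficients *)

Theorem theorem1p3 (R : realType) (M : set (circle R -> R[i]))
    (subM : L2_subspace M) (closedM : L2_closed M)
    (invM : invariant_for (@Hinfty1 R) M)
    (ninvM : ~ invariant_for (@Hinfty R) M) :
  exists (alpha beta : R[i]) (J : circle R -> R[i]),
    [/\ `|alpha| ^+ 2 + `|beta| ^+ 2 = 1,
        alpha != 0,
        unimodular J,
        M = L2_mul J (H2_ab alpha beta) &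
        (M `<=` @H2 R -> inner J)].
Proof.
have ML : M `<=` @L2 R by case: subM.
have cM : subspace_closed M by split => //; exact: (L2_closedP ML).1.
have M_X n f : M f -> M (fun z => coord z ^+ n.+2 * f z) by exact/invM/pow_Hinfty1.
have nsM : ~ shift_inv M by move=> sM; apply: ninvM; exact: invariant_Hinfty.
pose N := shift_hull M.
have cN : subspace_closed N := shift_hull_closed cM.
have sN : shift_inv N := shift_hull_inv M_X.
have NM f : M f -> N f := @sub_shift_hull _ _ cM f.
(* If N were stable under conj(z), then for m in M the function conj(z)^2 (z m) would lie in N, and
   multiplying it by z^2 would put z m in M. *)
have nN : ~ (forall f, N f -> N (fun z => (coord z)^* * f z)).
  move=> h; apply: nsM => m Mm; have := h _ (h _ (shift_shift_hull cM Mm)).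
  move=> /(shift_hull_sqr cM M_X).
  congr M; apply/funext => z.
  transitivity ((coord z * (coord z)^*) ^+ 2 * (coord z * m z)); first by ring.
  by rewrite coord_coordJ expr1n mul1r.
have [J [mJ J1 NJ Jort]] := wandering_unimodular cN sN nN.
have Jdv := Jdiv J1; have dvJ := divJ J1.
pose c f n := coef (fun z => (J z)^* * f z) n.
have Lc f : M f -> L2 (fun z => (J z)^* * f z) by move=> Mf; apply: (L2_Jdiv mJ J1); exact: ML.
have cB f g n : M f -> M g -> c (fun z => f z - g z) n = c f n - c g n.
  by move=> Mf Mg; rewrite /c; under eq_fun do rewrite mulrBr; rewrite (coefB _ (Lc _ Mf) (Lc _ Mg)).
have cZ (a : R[i]) f n : M f -> c (fun z => a * f z) n = a * c f n.
  by move=> Mf; rewrite /c; under eq_fun do rewrite mulrCA; rewrite (coefZ _ _ (Lc _ Mf)).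
have anM f : M f -> analytic (fun z => (J z)^* * f z) by move=> /NM; exact: hull_analytic.
(* [z^2 J H^2] is contained in [M], so membership in [M] only depends on two coefficients. *)
have crit h : L2 h -> analytic h -> coef h 0 = 0 -> coef h 1 = 0 -> M (fun z => J z * h z).
  move=> Lh ah h0 h1; have [g [Lg ag ->]] := analytic_div Lh ah h0 h1.
  have := shift_hull_sqr cM M_X (analytic_hull cN sN mJ J1 NJ Jort Lg ag).
  by under eq_fun do rewrite mulrCA.
have cz0 f : M f -> coef (fun z => coord z * ((J z)^* * f z)) 0 = 0 by move=> Mf; exact/coef_coord0/anM.
have cz1 f : coef (fun z => coord z * ((J z)^* * f z)) 1 = c f 0 by exact: coef_coordS.
(* Relative to J, the first two coefficients of z f are 0 and [c f 0], so [crit] applies as soon as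
   [c f 0] vanishes. *)
have shift_of f : M f -> (c f 0 = 0 -> M (fun z => coord z * f z)).
  move=> Mf f0; have -> : (fun z => coord z * f z) = (fun z => J z * (coord z * ((J z)^* * f z))).
    by apply/funext => z; rewrite mulrCA Jdv.
  apply: crit.
  - exact/L2_coord/Lc.
  - exact/analytic_coord/anM.
  - exact: cz0.
  - by rewrite cz1.
(* Its coefficient pair spans the line; alpha and beta are this pair after normalisation. *)
have [u0 Mu0 u00] : exists2 u0, M u0 & c u0 0 != 0.
  apply: contrapT => h; apply: nsM => f Mf; apply: (shift_of _ Mf).
  by apply: contrapT => /eqP f0; apply: h; exists f.
have Lu0 := Lc _ Mu0.
set a0 := c u0 0 in u00; pose b0 := c u0 1.
have prop u : M u -> c u 1 = c u 0 / a0 * b0.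
  move=> Mu; apply: contrapT => ne; apply: nsM => m Mm.
  (* [v] has first coefficient 0 and, if proportionality fails for [u], a nonzero second one. *)
  pose v z := u z - c u 0 / a0 * u0 z.
  have Mv : M v by exact: (subspaceB cM Mu (subspaceZ cM _ Mu0)).
  have v0 : c v 0 = 0.
    by rewrite (cB _ _ _ Mu (subspaceZ cM _ Mu0)) (cZ _ _ _ Mu0) -/a0 (divfK u00) subrr.
  have v1 : c v 1 != 0.
    rewrite (cB _ _ _ Mu (subspaceZ cM _ Mu0)) (cZ _ _ _ Mu0).
    by rewrite subr_eq0; apply/eqP.
  (* [q] makes the second coefficients of z m and q v agree; the first ones are both 0, so z m - q v
     lies in M by [crit]. *)
  pose q := c m 0 / c v 1.
  pose h z := coord z * ((J z)^* * m z) - q * ((J z)^* * v z).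
  have L1 : L2 (fun z => coord z * ((J z)^* * m z)) by exact/L2_coord/Lc.
  have L2' : L2 (fun z => q * ((J z)^* * v z)) by exact/L2Z/Lc.
  have Mh : M (fun z => J z * h z).
    apply: crit.
    - exact: L2B.
    - exact: (analyticB L1 L2' (analytic_coord (anM _ Mm)) (analyticZ q (Lc _ Mv) (anM _ Mv))).
    - by rewrite (coefB _ L1 L2') (coefZ _ _ (Lc _ Mv)) (cz0 _ Mm) -[coef _ 0]/(c v 0) v0 mulr0 subrr.
    - by rewrite (coefB _ L1 L2') (coefZ _ _ (Lc _ Mv)) cz1 -[coef (fun z => (J z)^* * v z) 1]/(c v 1) /q (divfK v1) subrr.
  have := subspaceD cM Mh (subspaceZ cM q Mv).
  congr M; apply/funext => z.
  transitivity (coord z * (J z * ((J z)^* * m z)) + q * v z - q * (J z * ((J z)^* * v z))).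
    by rewrite /h; ring.
  by rewrite !Jdv addrK.
have [s sC ab1] := normalize_pair b0 u00.
pose alpha := a0 / s%:C; pose beta := b0 / s%:C.
have al0 : alpha != 0 by exact: mulf_neq0 u00 (invr_neq0 sC).
have [Lal aal cal0 cal1] := affineP alpha beta.
exists alpha, beta, J; split; [|exact: al0| | |].
- by rewrite !normrE -!rmorphXn -rmorphD /= ab1.
- exact: unimodularE mJ J1.
- apply/seteqP; split=> [u Mu|u [Lu [h [Lh [k [g Hg hE]]] uE]]].
    split; first exact: ML.
    exists (fun z => (J z)^* * u z); last by apply: aeW => z; rewrite Jdv.
    split; first exact: Lc.
    (* [k] is forced by the first coefficient; [prop] makes the second one match as well. *)
    pose k := c u 0 / alpha.
    pose h z := (J z)^* * u z - k * affine alpha beta z.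
    have Lk : L2 (fun z => k * affine alpha beta z) by exact: L2Z.
    have Lh : L2 h by exact: L2B (Lc _ Mu) Lk.
    have ah : analytic h by exact: analyticB (Lc _ Mu) Lk (anM _ Mu) (analyticZ k Lal aal).
    have [||g [Lg ag hg]] := analytic_div Lh ah.
    + by rewrite (coefB _ (Lc _ Mu) Lk) (coefZ _ _ Lal) cal0 -[coef _ 0]/(c u 0) /k (divfK al0) subrr.
    + rewrite (coefB _ (Lc _ Mu) Lk) (coefZ _ _ Lal) cal1 -[coef (fun z => (J z)^* * u z) 1]/(c u 1) (prop _ Mu).
      by rewrite /k /alpha /beta; apply/eqP; rewrite subr_eq0; apply/eqP; field; rewrite u00 sC.
    exists k, g; first exact: analytic_H2.
    by apply: aeW => z; rewrite -[\val z]/(coord z) -[coord z ^+ 2 * g z]/((fun z => coord z ^+ 2 * g z) z) -hg /h /affine; ring.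
  pose h' z := k * affine alpha beta z + coord z ^+ 2 * g z.
  have Lg : L2 g by case: Hg.
  have ag := H2_analytic Hg.
  have Lk : L2 (fun z => k * affine alpha beta z) by exact: L2Z.
  have Lzg : L2 (fun z => coord z ^+ 2 * g z) by exact: L2_coordX.
  have e2 : (fun z : circle R => coord z ^+ 2 * g z) = (fun z => coord z * (coord z * g z)).
    by apply/funext => z; rewrite expr2 mulrA.
  have azg : analytic (fun z => coord z ^+ 2 * g z) by rewrite e2; exact/analytic_coord/analytic_coord.
  have Lh' : L2 h' by exact: L2D Lk Lzg.
  have ah' : analytic h' by exact: analyticD Lk Lzg (analyticZ k Lal aal) azg.
  have h'E n : coef h' n = k * coef (affine alpha beta) n + coef (fun z => coord z ^+ 2 * g z) n.
    by rewrite -(coefZ _ _ Lal) -(coefD _ Lk Lzg).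
  (* Since (alpha, beta) is the pair of [u0] divided by s, the functions J h' and q u0 share their
     first two coefficients and differ by an element of M. *)
  pose q := k / s%:C.
  have Mw : M (fun z => J z * (h' z - q * ((J z)^* * u0 z))).
    have Lq : L2 (fun z => q * ((J z)^* * u0 z)) by exact: L2Z.
    apply: crit; first exact: L2B Lh' Lq.
    - exact: analyticB Lh' Lq ah' (analyticZ q Lu0 (anM _ Mu0)).
    - rewrite (coefB _ Lh' Lq) h'E (coefZ _ _ Lu0) cal0 -[coef (fun z => (J z)^* * u0 z) 0]/a0.
      by rewrite e2 (coef_coord0 (analytic_coord ag)) addr0 /alpha /q mulrA [k / _ * _]mulrAC subrr.
    - rewrite (coefB _ Lh' Lq) h'E (coefZ _ _ Lu0) cal1 -[coef (fun z => (J z)^* * u0 z) 1]/b0.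
      by rewrite e2 coef_coordS (coef_coord0 ag) addr0 /beta /q mulrA [k / _ * _]mulrAC subrr.
  have := subspaceD cM Mw (subspaceZ cM q Mu0).
  move=> Mh'; apply: (closed_ae cM Mh' Lu).
  apply: filterS2 uE hE => z -> ->.
  by rewrite mulrBr [J z * (q * _)]mulrCA Jdv subrK.
- move=> MH; have aJ : analytic J.
    have z2 : analytic (fun z => J z * coord z ^+ 2).
      apply/H2_analytic/MH; apply: (crit _ (L2_pow R 2)); [|by rewrite coef_dot dot_pow|by rewrite coef_dot dot_pow].
      by move=> m; under eq_cint do rewrite -exprD; exact: cint_coord_exp.
    (* Here too the comparison is with a multiple of [u0]: J (alpha + beta z) and u0 / s have the
       same first two coefficients, so [crit] covers their difference. *)
    have ML' : M (fun z => J z * affine alpha beta z).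
      pose h z := affine alpha beta z - (s%:C)^-1 * ((J z)^* * u0 z).
      have Lq : L2 (fun z => (s%:C)^-1 * ((J z)^* * u0 z)) by exact: L2Z.
      have ah : analytic h by exact: analyticB Lal Lq aal (analyticZ _ Lu0 (anM _ Mu0)).
      have h0 : coef h 0 = 0.
        rewrite (coefB _ Lal Lq) (coefZ _ _ Lu0) cal0 -[coef (fun z => (J z)^* * u0 z) 0]/a0.
        by rewrite /alpha [a0 / _]mulrC subrr.
      have h1 : coef h 1 = 0.
        rewrite (coefB _ Lal Lq) (coefZ _ _ Lu0) cal1 -[coef (fun z => (J z)^* * u0 z) 1]/b0.
        by rewrite /beta [b0 / _]mulrC subrr.
      have := subspaceD cM (crit h (L2B Lal Lq) ah h0 h1) (subspaceZ cM (s%:C)^-1 Mu0).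
      congr M; apply/funext => z.
      by rewrite /h mulrBr [J z * (_^-1 * _)]mulrCA Jdv subrK.
    exact: analytic_of_multiples (L2_bounded mJ (nJ1 J1)) al0 (H2_analytic (MH _ ML')) z2.
  split; [exact: unimodularE mJ J1|exact: analytic_Hinfty mJ (aeW _ J1) aJ].
Qed.
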